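(* Let $E$ be a Drinfeld module over $K$ of rank $r \geq 2$. (a) The group $\mathrm{Ext}^1(E,C)$ is naturally a $t$-module of dimension $r$ and sits in an exact sequence of $t$-modules $$0 \to E^{\vee} \to \mathrm{Ext}^1(E,C) \to \mathbb{G}_a \to 0.$$ Furthermore, $E^{\vee}$ is the Cartier-Taguchi dual $t$-module associated to $E$, and in particular, $E^{\vee}$ is isomorphic to the $(r-1)$-st exterior power $\wedge^{r-1}E$ of $E$. (b) The group $\mathrm{Ext}^1(E^{\vee},C)$ is also naturally a $t$-module of dimension $r$ and sits in an exact sequence $$0 \to E \to \mathrm{Ext}^1(E^{\vee},C) \to \mathbb{G}_a^{r-1} \to 0.$$ Moreover, we have a biduality: $(E^{\vee})^{\vee} \cong E$. (c) Any morphism $\beta: E \to F$ of Drinfeld modules (of rank $\geq 2$) induces a morphism of dual $t$-modules $\beta^{\vee}: F^{\vee} \to E^{\vee}$.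
   Context: Let $K \supseteq \mathbb{F}_q$ be a perfect field of characteristic $p>0$, $q$ a power of $p$, and fix an $\mathbb{F}_q$-linear ring homomorphism $\iota:\mathbb{F}_q[t]\to K$; put $\theta=\iota(t)$. All Drinfeld modules and $t$-modules are over $K$ and with respect to $\iota$. $K\{\tau\}$ is the ring of twisted polynomials, $\tau x = x^q\tau$ for $x\in K$; $\tau$ acts on $\mathbb{G}_a$ as $x\mapsto x^q$. A $d$-dimensional $t$-module over $K$ is an algebraic group $E$ over $K$, isomorphic over $K$ to $\mathbb{G}_a^d$, with an $\mathbb{F}_q$-linear endomorphism $t$ such that $d(t-\theta)^n\,\mathrm{Lie}(E)=0$ for all sufficiently large $n$. In coordinates, $E=(\mathbb{G}_a^d,\Phi)$ with $\Phi:\mathbb{F}_q[t]\to \mathrm{Mat}_d(K\{\tau\})$ an $\mathbb{F}_q$-linear ring homomorphism such that $\Phi(t)=(\theta I_d+N)+M_1\tau+\cdots$ with $N$ nilpotent. Morphisms are $\mathbb{F}_q$-linear morphisms of algebraic groups over $K$ commuting with $t$. A Drinfeld module of rank $r$ is $E=(\mathbb{G}_a,\Phi)$ with $\Phi(t)=\theta+a_1\tau+\cdots+a_r\tau^r$, $a_r\ne 0$. The Carlitz module $C$ is given by $C(t)=\theta+\tau$. The $t$-modules $\mathbb{G}_a$ and $\mathbb{G}_a^{r-1}$ carry the action of $t$ as multiplication by $\theta$. $\mathrm{Ext}^1(E,F)$ is the group (under Baer sum) of Yoneda equivalence classes of $t$-module extensions $0\to F\to X\to E\to 0$. It is an $\mathbb{F}_q[t]$-module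 through the endomorphisms of $E$ (pullback) or, equivalently, of $F$ (pushout). Explicitly, if $E=(\mathbb{G}_a^d,\Phi)$, $F=(\mathbb{G}_a^e,\Psi)$, a $(\Phi,\Psi)$-biderivation is an $\mathbb{F}_q$-linear map $\delta:\mathbb{F}_q[t]\to\mathrm{Mat}_{e\times d}(K\{\tau\})$ with $\delta(ab)=\Psi(a)\delta(b)+\delta(a)\Phi(b)$; it defines the extension $a\mapsto\begin{pmatrix}\Phi(a)&0\\ \delta(a)&\Psi(a)\end{pmatrix}$, and it is inner if $\delta(a)=U\Phi(a)-\Psi(a)U$ for some $U\in \mathrm{Mat}_{e\times d}(K\{\tau\})$. $\mathrm{Ext}^1(E,F)$ is identified with biderivations modulo inner biderivations, with $b\in\mathbb{F}_q[t]$ acting by $\delta\mapsto\Psi(b)\delta(\cdot)$ (equivalently $\delta(\cdot)\Phi(b)$). $\mathrm{Ext}^1_0(E,F)\subseteq\mathrm{Ext}^1(E,F)$ is the $\mathbb{F}_q[t]$-submodule of classes represented by biderivations $\delta$ for which $\delta(t)$ has zero constant term in $\tau$ (the extensions inducing trivial $t$-module extensions of tangent spaces). For a $t$-module $E$, $E^\vee:=\mathrm{Ext}^1_0(E,C)$. Saying that an $\mathbb{F}_q[t]$-module such as $\mathrm{Ext}^1(E,C)$ is a $t$-module means that it is identified, as an $\mathbb{F}_q[t]$-module, with the $K$-points of a $t$-module over $K$; in (a), $E^\vee$ is the sub-$t$-module corresponding to the subgroup $\mathrm{Ext}^1_0(E,C)$. The map $\beta^\vee$ in (c) is the one induced by pullback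 of extensions along $\beta$ (on biderivations, $\delta\mapsto\delta(\cdot)\beta$). Cartier-Taguchi dual: for $E$ with $\Phi(t)=\theta+a_1\tau+\cdots+a_r\tau^r$ it is the $t$-module $(\mathbb{G}_a^{r-1},D)$ with $$D(t)=\theta I_{r-1}+\sum_{i=1}^{r-2}\tau\, e_{i+1,i}-\sum_{j=1}^{r-1}\frac{a_j}{a_r}\tau\, e_{j,r-1}+\frac{1}{a_r^q}\tau^2 e_{1,r-1},$$ where $e_{i,j}$ are the matrix units of size $r-1$. Exterior power: the $t$-motive of $E$ is $M(E)=\mathrm{Hom}_{\mathbb{F}_q}(E,\mathbb{G}_a)$ ($\mathbb{F}_q$-linear morphisms of algebraic groups over $K$), a left module over $K[t,\tau]$ (the ring generated over $K$ by $t$ and $\tau$ with $t\tau=\tau t$, $xt=tx$, $\tau x=x^q\tau$ for $x\in K$), which for a Drinfeld module of rank $r$ is free of rank $r$ over $K[t]$. $\wedge^{r-1}E$ is the $t$-module whose $t$-motive is $\wedge^{r-1}_{K[t]}M(E)$ with $\tau$ acting by $\tau(m_1\wedge\cdots\wedge m_{r-1})=\tau m_1\wedge\cdots\wedge\tau m_{r-1}$.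
   Formalization: The isomorphism of E^∨ with ∧^{r-1}E is asserted not over K, where it can fail (q=3, K=F_3, Φ(t)=θ+τ+τ²), but over every field L ⊇ K containing λ with λ^{q-1} = (-1)^{r-1}a_r; ∧^{r-1}E itself is constructed over K. *)

(* Defs.v *)
From HB Require Import structures.
From mathcomp Require Import all_boot all_order all_algebra all_field.

Set Implicit Arguments.
Unset Strict Implicit.
Unset Printing Implicit Defensive.

Import GRing.Theory.
Local Open Scope ring_scope.

(* Base data: a finite field Fq, a field K and a ring homomorphism
   iota : Fq[t] -> K.  The inclusion of Fq in K is c |-> iota c%:P, so that K
   contains Fq and iota is Fq-linear by construction; q is #|Fq|, and K has
   the characteristic of Fq. *)

Definition perfect_field (K : fieldType) : Prop :=
  forall p, p \in [pchar K] -> forall x : K, exists y : K, y ^+ p = x.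

Definition theta (Fq : finFieldType) (K : fieldType)
  (iota : {rmorphism {poly Fq} -> K}) : K := iota 'X.

(* K{tau}: the sum of the a_i tau^i is stored as the polynomial with
   coefficients a_i, and tau a = a^q tau. *)
Definition Ktau (Fq : finFieldType) (K : fieldType)
  (iota : {rmorphism {poly Fq} -> K}) : Type := {poly K}.

Section TwistedPolynomials.

Variables (Fq : finFieldType) (K : fieldType).
Variable iota : {rmorphism {poly Fq} -> K}.

HB.instance Definition _ := GRing.Zmodule.copy (Ktau iota) {poly K}.

Definition frob (i : nat) (x : K) : K := x ^+ (#|Fq| ^ i).

Lemma frob_is_additive i : {morph frob i : x y / x + y}.
Proof.
have [p _ pF] := finPcharP Fq.
have pK : p \in [pchar K].
  have /andP[pr /eqP p0] := pF; rewrite inE pr /=.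
  by rewrite -(rmorph_nat (iota \o polyC)) p0 rmorph0.
have qE : exists n, #|Fq| = (p ^ n)%N.
  by exists (logn p #|Fq|); rewrite {1}(card_pprimeChar pF).
move=> x y; rewrite /frob exprDn_pchar //.
case: qE => n ->; rewrite -expnM (eq_pnat _ (pcharf_eq pK)).
by rewrite pnatX pnat_id // (pcharf_prime pK).
Qed.

Lemma frob_add i x y : frob i (x + y) = frob i x + frob i y.
Proof. exact: frob_is_additive. Qed.

Lemma frob_mul i x y : frob i (x * y) = frob i x * frob i y.
Proof. by rewrite /frob exprMn. Qed.

Lemma frob_zero i : frob i 0 = 0.
Proof. by apply: (addrI (frob i 0)); rewrite -frob_add !addr0. Qed.

Lemma frob_one i : frob i 1 = 1.
Proof. by rewrite /frob expr1n. Qed.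

Lemma frob_comp i j x : frob i (frob j x) = frob (i + j) x.
Proof. by rewrite /frob -exprM -expnD addnC. Qed.

Lemma frob_sum i (I : Type) (r : seq I) (P : pred I) (E : I -> K) :
  frob i (\sum_(k <- r | P k) E k) = \sum_(k <- r | P k) frob i (E k).
Proof. exact: (big_morph _ (frob_add i) (frob_zero i)). Qed.

Definition tcoef (f : Ktau iota) (i : nat) : K := (f : {poly K})`_i.

Definition tmul (f g : Ktau iota) : Ktau iota :=
  \poly_(k < size (f : {poly K}) + size (g : {poly K}))
     \sum_(i < k.+1) tcoef f i * (tcoef g (k - i)) ^+ (#|Fq| ^ i).

Lemma tcoefP (f g : Ktau iota) : (forall i, tcoef f i = tcoef g i) -> f = g.
Proof. by move=> fg; apply/(@polyP K) => i; apply: fg. Qed.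

Lemma tcoef_mul f g k :
  tcoef (tmul f g) k = \sum_(i < k.+1) tcoef f i * frob i (tcoef g (k - i)).
Proof.
rewrite /tcoef coef_poly; case: ltnP => // le_k; apply/esym.
apply: big1 => i _; have [lt_i|le_i] := ltnP i (size (f : {poly K})); last first.
  by rewrite (nth_default _ le_i) mul0r.
have le_ik : (i <= k)%N by rewrite -ltnS.
rewrite [X in frob _ X]nth_default ?frob_zero ?mulr0 //.
by rewrite -(leq_add2l i) subnKC // (leq_trans _ le_k) // leq_add2r ltnW.
Qed.

Lemma tcoef_mul_rev f g k :
  tcoef (tmul f g) k =
    \sum_(i < k.+1) tcoef f (k - i) * frob (k - i) (tcoef g i).
Proof.
rewrite tcoef_mul (reindex_inj rev_ord_inj) /=.
by apply: eq_bigr => i _; rewrite (sub_ordK i).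
Qed.

Lemma tcoef_add f g k : tcoef (f + g) k = tcoef f k + tcoef g k.
Proof. exact: coefD. Qed.

Fact tmulA : associative tmul.
Proof.
move=> f g h; apply: tcoefP => i; rewrite tcoef_mul tcoef_mul_rev.
pose cf j k := tcoef f j * frob j (tcoef g (i - j - k) *
                                   frob (i - j - k) (tcoef h k)).
transitivity (\sum_(j < i.+1) \sum_(k < i.+1 | (k <= i - j)%N) cf j k).
  apply: eq_bigr => /= j _; rewrite tcoef_mul_rev frob_sum big_distrr /=.
  by rewrite (big_ord_narrow_leq (leq_subr _ _)).
rewrite (exchange_big_dep predT) //=; apply: eq_bigr => k _.
transitivity (\sum_(j < i.+1 | (j <= i - k)%N) cf j k).
  apply: eq_bigl => j; rewrite -ltnS -(ltnS j) -!subSn ?leq_ord //.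
  by rewrite -subn_gt0 -(subn_gt0 j) -!subnDA addnC.
rewrite (big_ord_narrow_leq (leq_subr _ _)) tcoef_mul big_distrl /=.
apply: eq_bigr => j _; rewrite /cf -!subnDA addnC !subnDA frob_mul mulrA.
by rewrite frob_comp subnKC // -ltnS.
Qed.

Fact tmul1l : left_id (1%:P : Ktau iota) tmul.
Proof.
move=> f; apply: tcoefP => i; rewrite tcoef_mul big_ord_recl subn0.
rewrite big1 => [|j _]; last by rewrite /tcoef coefC mul0r.
by rewrite /tcoef coefC mul1r addr0 /frob expn0 expr1.
Qed.

Fact tmul1r : right_id (1%:P : Ktau iota) tmul.
Proof.
move=> f; apply: tcoefP => i; rewrite tcoef_mul_rev big_ord_recl subn0.
rewrite big1 => [|j _]; last by rewrite /tcoef coefC frob_zero mulr0.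
by rewrite /tcoef coefC frob_one mulr1 addr0.
Qed.

Fact tmulDl : left_distributive tmul +%R.
Proof.
move=> f g h; apply: tcoefP => i; rewrite tcoef_add !tcoef_mul -big_split.
by apply: eq_bigr => j _; rewrite tcoef_add mulrDl.
Qed.

Fact tmulDr : right_distributive tmul +%R.
Proof.
move=> f g h; apply: tcoefP => i; rewrite tcoef_add !tcoef_mul -big_split.
by apply: eq_bigr => j _; rewrite tcoef_add frob_add mulrDr.
Qed.

Fact tone_neq0 : (1%:P : Ktau iota) != 0.
Proof. exact: (@oner_neq0 {poly K}). Qed.

HB.instance Definition _ := GRing.Zmodule_isNzRing.Build (Ktau iota)
  tmulA tmul1l tmul1r tmulDl tmulDr tone_neq0.

Definition tau : Ktau iota := ('X : {poly K}).
Definition tconst (a : K) : Ktau iota := a%:P.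

Lemma tcoefM (f g : Ktau iota) k :
  tcoef (f * g) k = \sum_(i < k.+1) tcoef f i * frob i (tcoef g (k - i)).
Proof. exact: tcoef_mul. Qed.

Lemma tcoef_const a k : tcoef (tconst a) k = if k == 0%N then a else 0.
Proof. exact: coefC. Qed.

Lemma tcoef_constM a (f : Ktau iota) k : tcoef (tconst a * f) k = a * tcoef f k.
Proof.
rewrite tcoefM big_ord_recl subn0 big1 => [|j _].
  by rewrite tcoef_const addr0 /frob expn0 expr1.
by rewrite tcoef_const mul0r.
Qed.

Lemma tconst_is_additive : zmod_morphism tconst.
Proof. by move=> a b; apply: polyCB. Qed.

Lemma tconst_is_monoid : monoid_morphism tconst.
Proof.
split=> // a b; apply: tcoefP => i; rewrite tcoef_constM !tcoef_const.
by case: (i == 0%N) => //; rewrite mulr0.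
Qed.

HB.instance Definition _ := GRing.isZmodMorphism.Build K (Ktau iota) tconst
  tconst_is_additive.
HB.instance Definition _ := GRing.isMonoidMorphism.Build K (Ktau iota) tconst
  tconst_is_monoid.

Lemma tau_const a : tau * tconst a = tconst (a ^+ #|Fq|) * tau.
Proof.
apply: tcoefP => k; rewrite tcoef_constM tcoefM.
have tc i : tcoef tau i = (i == 1%N)%:R by apply: coefX.
under eq_bigr do rewrite tc tcoef_const.
rewrite tc; case: k => [|[|k]].
- by rewrite big_ord1 mul0r mulr0.
- by rewrite !big_ord_recl big_ord0 /= !mul0r add0r addr0 mul1r mulr1 /frob expn1.
- rewrite mulr0 big1 // => i _; case: eqP => [->|_]; last by rewrite mul0r.
  by rewrite subn1 /= frob_zero mulr0.
Qed.

Definition cscal (c : Fq) : Ktau iota := tconst (iota c%:P).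

Lemma frob_fix c : (iota c%:P) ^+ #|Fq| = iota c%:P.
Proof. by rewrite -!rmorphXn /= expf_card. Qed.

Lemma cscal_comm c (f : Ktau iota) : cscal c * f = f * cscal c.
Proof.
apply: tcoefP => k; rewrite tcoef_constM tcoefM big_ord_recr big1 /=.
  rewrite add0r subnn tcoef_const /= mulrC; congr (_ * _).
  rewrite /frob; elim: k => [|k IHk]; first by rewrite expn0 expr1.
  by rewrite expnS exprM frob_fix.
move=> i _; rewrite tcoef_const subn_eq0 leqNgt ltn_ord /=.
by rewrite frob_zero mulr0.
Qed.

End TwistedPolynomials.

Arguments tau {Fq K iota}.
Arguments tconst {Fq K iota} a.
Arguments cscal {Fq K iota} c.

Section TModules.

Variables (Fq : finFieldType) (K : fieldType).
Variable iota : {rmorphism {poly Fq} -> K}.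
Local Notation Kt := (Ktau iota).

(* The action on tangent spaces induced by a matrix over K{tau}. *)
Definition lie m n (M : 'M[Kt]_(m, n)) : 'M[K]_(m, n) :=
  map_mx (fun f => tcoef f 0) M.

Record tmodule (d : nat) := TModule {
  tact :> {rmorphism {poly Fq} -> 'M[Kt]_d};
  tactC : forall c : Fq, tact c%:P = (cscal c)%:M;
  tact_lie : exists n : nat, (lie (tact 'X) - (theta iota)%:M) ^+ n = 0
}.

Section OfMatrix.

Variables (d : nat) (M : 'M[Kt]_d).

Definition mxact (a : {poly Fq}) : 'M[Kt]_d :=
  \sum_(i < size a) cscal a`_i *: M ^+ i.

Lemma mxact_widen n (a : {poly Fq}) : (size a <= n)%N ->
  mxact a = \sum_(i < n) cscal a`_i *: M ^+ i.
Proof.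
move=> le_an; rewrite /mxact (big_ord_widen n (fun i => cscal a`_i *: M ^+ i)) //.
rewrite big_mkcond; apply: eq_bigr => i _; case: ltnP => // le_ai.
by rewrite nth_default // /cscal !rmorph0 scale0r.
Qed.

Lemma mxact_is_additive : zmod_morphism mxact.
Proof.
move=> a b; pose n := maxn (size a) (size b).
rewrite (@mxact_widen n (a - b)); last first.
  by rewrite (leq_trans (size_polyD _ _)) // size_polyN.
rewrite (@mxact_widen n a) ?leq_maxl // (@mxact_widen n b) ?leq_maxr // -sumrB.
by apply: eq_bigr => i _; rewrite coefB /cscal !rmorphB scalerBl.
Qed.

HB.instance Definition _ := GRing.isZmodMorphism.Build {poly Fq} 'M[Kt]_d mxact
  mxact_is_additive.

Lemma mxactC c : mxact c%:P = (cscal c)%:M.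
Proof.
rewrite (@mxact_widen 1) ?size_polyC_leq1 // big_ord1 coefC expr0.
exact: scalemx1.
Qed.

Lemma mxactMX a : mxact (a * 'X) = mxact a *m M.
Proof.
rewrite (@mxact_widen (size a).+1); last by rewrite (leq_trans (size_polyMleq _ _)) // size_polyX addn2.
rewrite big_ord_recl coefMX /= /cscal !rmorph0 scale0r add0r mulmx_suml.
by apply: eq_bigr => i _; rewrite coefMX /= -scalemxAl exprSr.
Qed.

Lemma mxactX : mxact 'X = M.
Proof. by rewrite -['X]mul1r mxactMX mxactC /cscal !rmorph1 mul1mx. Qed.

Lemma mxact_comm a : mxact a *m M = M *m mxact a.
Proof.
elim/poly_ind: a => [|a c IHa]; first by rewrite raddf0 mul0mx mulmx0.
rewrite raddfD /= mxactMX mxactC mulmxDl mulmxDr; congr (_ + _); first by rewrite mulmxA -IHa.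
apply/matrixP => i j; rewrite mul_scalar_mx !mxE (bigD1 j) //= big1 => [|k nkj].
  by rewrite !mxE eqxx mulr1n addr0 cscal_comm.
by rewrite !mxE (negPf nkj) mulr0n mulr0.
Qed.

Lemma mxact_is_monoid : monoid_morphism mxact.
Proof.
split=> [|a b]; first by rewrite mxactC /cscal !rmorph1.
elim/poly_ind: b => [|b c IHb]; first by rewrite mulr0 raddf0 mulr0.
rewrite mulrDr mulrA !raddfD /= !mxactMX IHb mulrDr -!mulmxE mulmxA; congr (_ + _); rewrite mulmxE.
rewrite mxactC mulrC; elim/poly_ind: a {IHb b} => [|a e IHa].
  by rewrite mulr0 raddf0 mul0r.
rewrite mulrDr mulrA !raddfD /= !mxactMX IHa -polyCM !mxactC mulrDl.
congr (_ + _); last by rewrite mulrC /cscal !rmorphM.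
by rewrite -!mulmxE -!mulmxA -mxactC mxact_comm.
Qed.

HB.instance Definition _ := GRing.isMonoidMorphism.Build {poly Fq} 'M[Kt]_d mxact
  mxact_is_monoid.

End OfMatrix.

Definition tmodule_of d (M : 'M[Kt]_d) (lieM : lie M = (theta iota)%:M) :
  tmodule d.
Proof.
exists (mxact M); first exact: mxactC.
by exists 1%N; rewrite /= mxactX lieM subrr expr1.
Defined.

Lemma tmodule_ofX d (M : 'M[Kt]_d) (lieM : lie M = (theta iota)%:M) :
  tmodule_of lieM 'X = M.
Proof. exact: mxactX. Qed.


Definition carlitz_mx : 'M[Kt]_1 := (tconst (theta iota) + tau)%:M.

Fact carlitz_lie : lie carlitz_mx = (theta iota)%:M.
Proof.
apply/matrixP => i j; rewrite !mxE (ord1 i) (ord1 j) eqxx !mulr1n tcoef_add.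
by rewrite tcoef_const /tcoef coefX addr0.
Qed.

Definition carlitz : tmodule 1 := tmodule_of carlitz_lie.

Fact Ga_lie n : lie (tconst (theta iota))%:M = (theta iota)%:M :> 'M[K]_n.
Proof.
apply/matrixP => i j; rewrite !mxE; case: (i == j); first by rewrite tcoef_const.
by rewrite mulr0n /tcoef coef0.
Qed.

Definition Ga (n : nat) : tmodule n := tmodule_of (Ga_lie n).

Definition drinfeld_of_rank (r : nat) (E : tmodule 1) : Prop :=
  (0 < r)%N /\ size (E 'X 0 0 : {poly K}) = r.+1.

Definition dcoef (E : tmodule 1) (j : nat) : K := tcoef (E 'X 0 0) j.

(* Rows and columns are numbered from 0, so that the entry (i, j) below is the
   coefficient of e_(i+1, j+1). *)
Definition ctdual_mx (r : nat) (E : tmodule 1) : 'M[Kt]_(r.-1) :=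
  \matrix_(i, j)
    ((if i == j then tconst (theta iota) else 0)
     + (if i == j.+1 :> nat then tau else 0)
     + (if j.+1 == r.-1
        then - (tconst (dcoef E i.+1 / dcoef E r) * tau) else 0)
     + (if (i == 0 :> nat) && (j.+1 == r.-1)
        then tconst (dcoef E r ^+ #|Fq|)^-1 * tau ^+ 2 else 0)).

Fact ctdual_lie r E : lie (ctdual_mx r E) = (theta iota)%:M.
Proof.
have t0 : tcoef (tau : Kt) 0 = 0 by rewrite /tcoef coefX.
have z0 : tcoef (0 : Kt) 0 = 0 by rewrite /tcoef coef0.
have t20 : tcoef (tau ^+ 2 : Kt) 0 = 0 by rewrite expr2 tcoefM big_ord1 t0 mul0r.
have n0 (f : Kt) : tcoef (- f) 0 = - tcoef f 0 by apply: coefN.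
apply/matrixP => i j; rewrite !mxE !tcoef_add.
rewrite !(fun_if (fun f : Kt => tcoef f 0)) n0 !tcoef_constM t0 z0 t20 tcoef_const.
by rewrite !mulr0 oppr0 !if_same !addr0; case: (i == j).
Qed.

(* The Cartier-Taguchi dual of a Drinfeld module of rank r. *)
Definition ctdual (r : nat) (E : tmodule 1) : tmodule r.-1 :=
  tmodule_of (ctdual_lie r E).

(* Points with values in a commutative K-algebra A (given by i : K -> A), on
   which tau acts as x |-> x ^ q. *)
Definition tev (A : comPzRingType) (i : {rmorphism K -> A}) (f : Kt) (x : A) : A :=
  \sum_(k < size (f : {poly K})) i (tcoef f k) * x ^+ (#|Fq| ^ k).

Definition mxev (A : comPzRingType) (i : {rmorphism K -> A}) m n
    (M : 'M[Kt]_(m, n)) (x : 'cV[A]_n) : 'cV[A]_m :=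
  \col_a \sum_b tev i (M a b) (x b 0).

Definition kpt m n (M : 'M[Kt]_(m, n)) (x : 'cV[K]_n) : 'cV[K]_m :=
  mxev (idfun : {rmorphism K -> K}) M x.

(* Fq-linear morphisms from G_a^d to G_a^e are the e x d matrices over
   K{tau}. *)
Definition tmorphism d e (E : tmodule d) (G : tmodule e) (U : 'M[Kt]_(e, d)) :
  Prop := forall a, U *m E a = G a *m U.

Definition tiso d e (E : tmodule d) (G : tmodule e) : Prop :=
  exists (U : 'M[Kt]_(e, d)) (V : 'M[Kt]_(d, e)),
    [/\ tmorphism E G U, U *m V = 1%:M & V *m U = 1%:M].

(* Exactness of 0 -> E -> X -> G -> 0 as algebraic groups: E is the
   scheme-theoretic kernel of X -> G, which is tested on all commutative
   K-algebras, and X -> G is an epimorphism onto the smooth group G, which is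
   tested on algebraically closed extensions of K. *)
Definition short_exact d m e (E : tmodule d) (X : tmodule m) (G : tmodule e)
    (u : 'M[Kt]_(m, d)) (v : 'M[Kt]_(e, m)) : Prop :=
  [/\ tmorphism E X u,
      tmorphism X G v,
      forall (A : comPzRingType) (i : {rmorphism K -> A}),
        injective (mxev i u) /\
        (forall y, mxev i v y = 0 <-> exists x, mxev i u x = y)
    & forall (L : closedFieldType) (i : {rmorphism K -> L}) z,
        exists y, mxev i v y = z].

Definition bifun (d e : nat) : Type := {poly Fq} -> 'M[Kt]_(e, d).

Section Ext.

Variables (d e : nat) (E : tmodule d) (G : tmodule e).

Definition biderivation (dl : bifun d e) : Prop :=
  (forall (c : Fq) a b, dl (c *: a + b) = cscal c *: dl a + dl b) /\
  (forall a b, dl (a * b) = G a *m dl b + dl a *m E b).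

Definition inner (dl : bifun d e) : Prop :=
  exists U : 'M[Kt]_(e, d), forall a, dl a = U *m E a - G a *m U.

(* Equality of classes in Ext^1(E, G). *)
Definition ext_eq (dl dl' : bifun d e) : Prop := inner (fun a => dl a - dl' a).

(* Ext^1(E, G) and its submodules are given by the biderivations whose classes
   they contain, taken up to ext_eq. *)
Definition Ext1 : bifun d e -> Prop := biderivation.

Definition Ext10 (dl : bifun d e) : Prop :=
  biderivation dl /\
  exists dl', [/\ biderivation dl', ext_eq dl dl' & lie (dl' 'X) = 0].

(* phi induces an isomorphism of Fq[t]-modules from X(K) onto the submodule S
   of Ext^1(E, G), where a in Fq[t] acts on classes through G a. *)
Definition represents (S : bifun d e -> Prop) n (X : tmodule n)
    (phi : 'cV[K]_n -> bifun d e) : Prop :=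
  [/\ forall x, S (phi x),
      forall x y, ext_eq (phi (x + y)) (fun b => phi x b + phi y b),
      forall a x, ext_eq (phi (kpt (X a) x)) (fun b => G a *m phi x b),
      forall x, inner (phi x) -> x = 0
    & forall dl, S dl -> exists x, ext_eq dl (phi x)].

End Ext.

Definition pullback d d' e (dl : bifun d e) (beta : 'M[Kt]_(d, d')) :
  bifun d' e := fun a => dl a *m beta.

(* If phi identifies X(K) with a submodule of Ext^1(E, G), and phi' identifies
   X'(K) with one of Ext^1(E', G), then pullback along beta : E' -> E is given
   by a morphism of t-modules X -> X'. *)
Definition pullback_tmorphism d d' e (E' : tmodule d') (G : tmodule e)
    (beta : 'M[Kt]_(d, d')) n n'
    (X : tmodule n) (phi : 'cV[K]_n -> bifun d e)
    (X' : tmodule n') (phi' : 'cV[K]_n' -> bifun d' e) : Prop :=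
  exists h : 'M[Kt]_(n', n), tmorphism X X' h /\
    forall x, ext_eq E' G (phi' (kpt h x)) (pullback (phi x) beta).

End TModules.

Arguments carlitz {Fq K} iota.
Arguments Ga {Fq K} iota n.

(* The t-motive Hom(E, G_a), as a module over K[t]: K acts on the left, and t
   by precomposition with the action of t on E. *)
Definition motive (Fq : finFieldType) (K : fieldType)
  (iota : {rmorphism {poly Fq} -> K}) d (E : tmodule iota d) : Type :=
  'rV[Ktau iota]_d.

Section Motive.

Variables (Fq : finFieldType) (K : fieldType).
Variable iota : {rmorphism {poly Fq} -> K}.
Variables (d : nat) (E : tmodule iota d).

HB.instance Definition _ := GRing.Zmodule.copy (motive E) 'rV[Ktau iota]_d.

Definition motive_scale (f : {poly K}) (m : motive E) : motive E :=
  \sum_(i < size f) tconst f`_i *: ((m : 'rV[Ktau iota]_d) *m E 'X^i).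

Definition motive_tau (m : motive E) : motive E :=
  tau *: (m : 'rV[Ktau iota]_d).

Lemma motive_scale_widen n (f : {poly K}) m : (size f <= n)%N ->
  motive_scale f m =
    \sum_(i < n) tconst f`_i *: ((m : 'rV[Ktau iota]_d) *m E 'X^i).
Proof.
move=> le_fn; rewrite /motive_scale.
rewrite (big_ord_widen n (fun i => tconst f`_i *: ((m : 'rV_d) *m E 'X^i))) //.
rewrite big_mkcond; apply: eq_bigr => i _; case: ltnP => // le_fi.
by rewrite nth_default // rmorph0 scale0r.
Qed.

Fact motive_scaleDr : right_distributive motive_scale +%R.
Proof.
move=> f m n; rewrite /motive_scale -big_split; apply: eq_bigr => i _ /=.
by rewrite mulmxDl scalerDr.
Qed.

Fact motive_scaleDl m : {morph motive_scale^~ m : f g / f + g}.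
Proof.
move=> f g; pose n := maxn (size f) (size g).
rewrite (@motive_scale_widen n (f + g)) ?size_polyD //.
rewrite (@motive_scale_widen n f) ?leq_maxl // (@motive_scale_widen n g) ?leq_maxr //.
rewrite -big_split; apply: eq_bigr => i _.
by rewrite coefD rmorphD scalerDl.
Qed.

Lemma motive_scaleC c m :
  motive_scale c%:P m = tconst c *: (m : 'rV[Ktau iota]_d).
Proof.
rewrite (@motive_scale_widen 1) ?size_polyC_leq1 // big_ord1 coefC expr0.
by rewrite rmorph1 mulmx1.
Qed.

Lemma motive_scaleMX f m :
  motive_scale (f * 'X) m = motive_scale f ((m : 'rV[Ktau iota]_d) *m E 'X).
Proof.
rewrite (@motive_scale_widen (size f).+1); last first.
  by rewrite (leq_trans (size_polyMleq _ _)) // size_polyX addn2.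
rewrite big_ord_recl coefMX /= rmorph0 scale0r add0r; apply: eq_bigr => i _.
by rewrite coefMX /= exprS rmorphM -mulmxE mulmxA.
Qed.

Lemma motive_scale_mul f (m : 'rV[Ktau iota]_d) :
  motive_scale f (m *m E 'X) = (motive_scale f m : 'rV[Ktau iota]_d) *m E 'X.
Proof.
rewrite /motive_scale mulmx_suml; apply: eq_bigr => i _.
rewrite -scalemxAl; congr (_ *: _); rewrite -!mulmxA; congr (_ *m _).
by rewrite !mulmxE -!rmorphM mulrC.
Qed.

Lemma motive_scale_const f c (m : 'rV[Ktau iota]_d) :
  motive_scale f (tconst c *: m) = motive_scale (c *: f) m.
Proof.
rewrite (@motive_scale_widen (size f) (c *: f)) ?size_scale_leq //.
apply: eq_bigr => i _.
by rewrite -scalemxAl scalerA -rmorphM coefZ mulrC.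
Qed.

Fact motive_scaleA f g m :
  motive_scale f (motive_scale g m) = motive_scale (f * g) m.
Proof.
elim/poly_ind: g m => [|g c IHg] m.
  by rewrite mulr0 /motive_scale size_poly0 !big_ord0 big1 // => i _;
     rewrite mul0mx scaler0.
rewrite motive_scaleDl motive_scaleDr mulrDr motive_scaleDl mulrA.
rewrite !motive_scaleMX IHg motive_scaleC motive_scale_const.
by rewrite [f * c%:P]mulrC mul_polyC.
Qed.

Fact motive_scale1 : left_id 1 motive_scale.
Proof. by move=> m; rewrite motive_scaleC rmorph1 scale1r. Qed.

HB.instance Definition _ := GRing.Zmodule_isLmodule.Build {poly K} (motive E)
  motive_scaleA motive_scale1 motive_scaleDr motive_scaleDl.

End Motive.

Section Exterior.

Variables (R : comNzRingType) (n : nat).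

Definition subst_at (M : Type) (m : {ffun 'I_n -> M}) (i : 'I_n) (x : M) :
  {ffun 'I_n -> M} := [ffun j => if j == i then x else m j].

Definition alternating_multilinear (M N : lmodType R)
    (w : {ffun 'I_n -> M} -> N) : Prop :=
  (forall m i a x y,
     w (subst_at m i (a *: x + y)) = a *: w (subst_at m i x) + w (subst_at m i y))
  /\ (forall (m : {ffun 'I_n -> M}) i j, i != j -> m i = m j -> w m = 0).

(* The pair (P, w) is the n-th exterior power of M over R. *)
Definition exterior_power (M P : lmodType R) (w : {ffun 'I_n -> M} -> P) : Prop :=
  alternating_multilinear w /\
  forall (N : lmodType R) (f : {ffun 'I_n -> M} -> N),
    alternating_multilinear f ->
    exists g : {linear P -> N},
      (forall m, g (w m) = f m) /\
      (forall g' : {linear P -> N}, (forall m, g' (w m) = f m) -> g' =1 g).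

End Exterior.

(* W is the n-th exterior power of E. *)
Definition tmodule_exterior_power (Fq : finFieldType) (K : fieldType)
    (iota : {rmorphism {poly Fq} -> K}) (n d e : nat)
    (E : tmodule iota d) (W : tmodule iota e) : Prop :=
  exists w : {ffun 'I_n -> motive E} -> motive W,
    exterior_power w /\
    forall m, motive_tau (w m) = w [ffun i => motive_tau (m i)].

Section BaseChange.

Variables (Fq : finFieldType) (K L : fieldType).
Variables (iota : {rmorphism {poly Fq} -> K}) (i : {rmorphism K -> L}).

Definition iotaL : {rmorphism {poly Fq} -> L} := i \o iota.

Definition tmap (f : Ktau iota) : Ktau iotaL := map_poly i (f : {poly K}).

Lemma tcoef_map f k : tcoef (tmap f) k = i (tcoef f k).
Proof. exact: coef_map. Qed.

Fact tmap_is_additive : zmod_morphism tmap.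
Proof. by move=> f g; apply: (raddfB (map_poly i)). Qed.

Fact tmap_is_monoid : monoid_morphism tmap.
Proof.
split=> [|f g]; first exact: (rmorph1 (map_poly i)).
apply: tcoefP => k; rewrite tcoef_map !tcoefM rmorph_sum; apply: eq_bigr => j _.
by rewrite rmorphM !tcoef_map /frob rmorphXn.
Qed.

HB.instance Definition _ := GRing.isZmodMorphism.Build (Ktau iota) (Ktau iotaL)
  tmap tmap_is_additive.
HB.instance Definition _ := GRing.isMonoidMorphism.Build (Ktau iota) (Ktau iotaL)
  tmap tmap_is_monoid.

Variables (d : nat) (E : tmodule iota d).

Definition bcact (a : {poly Fq}) : 'M[Ktau iotaL]_d := map_mx tmap (E a).

Fact bcact_is_additive : zmod_morphism bcact.
Proof. by move=> a b; rewrite /bcact rmorphB /= map_mxB. Qed.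

Fact bcact_is_monoid : monoid_morphism bcact.
Proof.
by split=> [|a b]; rewrite /bcact ?rmorph1 ?rmorphM -?mulmxE ?map_mx1 ?map_mxM.
Qed.

HB.instance Definition _ := GRing.isZmodMorphism.Build {poly Fq}
  'M[Ktau iotaL]_d bcact bcact_is_additive.
HB.instance Definition _ := GRing.isMonoidMorphism.Build {poly Fq}
  'M[Ktau iotaL]_d bcact bcact_is_monoid.

Definition base_change : tmodule iotaL d.
Proof.
exists bcact => [c|].
  rewrite /= /bcact tactC map_scalar_mx /=; congr (_%:M).
  by apply: tcoefP => k; rewrite tcoef_map !tcoef_const; case: eqP; rewrite ?rmorph0.
have [n nil_n] := tact_lie E; exists n.
have -> : lie (bcact 'X) - (theta iotaL)%:M =
          map_mx i (lie (E 'X) - (theta iota)%:M).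
  rewrite map_mxB map_scalar_mx; congr (_ - _).
  by apply/matrixP => a b; rewrite !mxE tcoef_map.
have mapX (A : 'M[K]_d) k : map_mx i (A ^+ k) = map_mx i A ^+ k.
  elim: k => [|k IHk]; first by rewrite !expr0 map_mx1.
  by rewrite !exprS -!mulmxE map_mxM IHk.
by rewrite -mapX nil_n map_mx0.
Defined.

End BaseChange.

(* Main.v *)
Require Import Defs.
From mathcomp Require Import all_boot all_order all_fingroup all_algebra all_field.
From HB Require Import structures.

Set Implicit Arguments.
Unset Strict Implicit.
Unset Printing Implicit Defensive.

Import GRing.Theory.
Local Open Scope ring_scope.

(** Idea. A biderivation into C is determined by its value at t, so Ext^1(E, C)
    is the group of rows over K{tau} modulo the rows U E_t - C_t U. In each
    class there is exactly one row in normal form: for E of rank r, a polynomial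
    of degree < r, and for the dual of E, a row of constants plus (w / a_r) tau
    in the last place. Multiplying a normal form by C_t and reducing again gives
    the t-action on its coordinates; the constant coefficients of a row never
    change, and killing them cuts out Ext^1_0.

    All reductions are carried out with coefficients in an arbitrary left
    K{tau}-module V instead of K. For V = K this describes the points; for
    V = K{tau}^n the coordinates of the reduction of a generic row are the
    matrix of a morphism. As K may be finite, morphisms of t-modules cannot be
    recognized on K-points, and this generic case is really needed.

    For the exterior power, the t-motives of E and of the candidate W have
    explicit K[t]-bases on which tau acts by a companion matrix A, respectively
    by the transpose of its adjugate; and the maximal minors N of an (r-1) x r
    matrix satisfy A N(B A) = det A N(B). *)

(** In U E_t - C_t U the first term dominates, because C_t has degree 1 while E_t has degree r >= 2.
    This lets every row be reduced, and descent from the top coefficient of U gives uniqueness. For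
    the dual, the dominating entry of D_t is tau^2 / a_r^q in the first row of the last column, and
    the subdiagonal entries tau let the first entry of U determine the others.

    The representing matrices record the corrections made when C_t times a normal form is reduced
    again: they are D_t, respectively E_t, bordered by the coordinates that split off. Scaling the
    tau coordinate over the dual by a_r makes E itself appear there.

    The exterior power has a model W over K whose matrix differs from D_t. The two are conjugate by
    a scalar lambda with lambda^(q-1) = (-1)^(r-1) a_r, which K need not contain; hence the
    isomorphism is stated over every extension field that holds such a lambda. *)

(** * Twisted polynomials acting on additive groups *)

(* K as a left K{tau}-module, with tau acting as x |-> x ^ q. *)
Definition Kpt (Fq : finFieldType) (K : fieldType)
  (iota : {rmorphism {poly Fq} -> K}) : Type := K.

Section Basics.

Variables (Fq : finFieldType) (K : fieldType).
Variable iota : {rmorphism {poly Fq} -> K}.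
Local Notation Kt := (Ktau iota).
Local Notation frob := (@frob Fq K).

Lemma frob0n (x : K) : frob 0 x = x.
Proof. by rewrite /Defs.frob expn0 expr1. Qed.

Lemma frob_tconst_tau n (a : K) :
  tau ^+ n * tconst a = tconst (frob n a) * tau ^+ n :> Kt.
Proof.
elim: n a => [|n IHn] a; first by rewrite expr0 mul1r mulr1 frob0n.
rewrite exprSr -mulrA tau_const mulrA IHn -mulrA -exprSr; congr (tconst _ * _).
have -> : a ^+ #|Fq| = frob 1 a by rewrite /Defs.frob expn1.
by rewrite frob_comp addn1.
Qed.

Lemma tcoef0 k : tcoef (0 : Kt) k = 0.
Proof. exact: coef0. Qed.

Lemma tcoefN (f : Kt) k : tcoef (- f) k = - tcoef f k.
Proof. exact: coefN. Qed.

Lemma tcoef_sum I (s : seq I) (P : pred I) (F : I -> Kt) k :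
  tcoef (\sum_(i <- s | P i) F i) k = \sum_(i <- s | P i) tcoef (F i) k.
Proof. exact: (big_morph (fun f : Kt => tcoef f k) (fun f g => tcoef_add f g k) (tcoef0 k)). Qed.

Lemma tcoef_Mtau (f : Kt) k :
  tcoef (f * tau) k = if k is k'.+1 then tcoef f k' else 0.
Proof.
have tc i : tcoef (tau : Kt) i = (i == 1%N)%:R by apply: coefX.
rewrite tcoefM; case: k => [|k].
  by rewrite big_ord1 tc frob_zero // mulr0.
rewrite big_ord_recr /= subnn tc frob_zero // mulr0 addr0 big_ord_recr /=.
rewrite subSnn tc frob_one mulr1 big1 ?add0r // => i _; rewrite tc.
by rewrite subSn ?(ltnW (ltn_ord i)) // eqSS subn_eq0 leqNgt ltn_ord frob_zero ?mulr0.
Qed.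

Lemma tcoef_tauM (f : Kt) k :
  tcoef (tau * f) k = if k is k'.+1 then frob 1 (tcoef f k') else 0.
Proof.
have tc i : tcoef (tau : Kt) i = (i == 1%N)%:R by apply: coefX.
rewrite tcoefM; case: k => [|k]; first by rewrite big_ord1 tc mul0r.
rewrite !big_ord_recl /= !tc mul0r mul1r add0r subn1 big1 ?addr0 // => i _.
by rewrite tc mul0r.
Qed.

Lemma tcoef_tauX n k : tcoef (tau ^+ n : Kt) k = (k == n)%:R.
Proof.
elim: n k => [|n IHn] k; first by rewrite expr0 [LHS]coefC; case: k.
by rewrite exprSr tcoef_Mtau; case: k.
Qed.

Lemma tcoef_const_tauX a n k :
  tcoef (tconst a * tau ^+ n : Kt) k = if k == n then a else 0.
Proof.
by rewrite tcoef_constM tcoef_tauX; case: eqP => _; rewrite ?mulr1 ?mulr0.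
Qed.

Lemma Ktau_expand n (f : Kt) : (size (f : {poly K}) <= n)%N ->
  f = \sum_(k < n) tconst (tcoef f k) * tau ^+ k.
Proof.
move=> le_fn; apply: tcoefP => i; rewrite tcoef_sum.
under eq_bigr do rewrite tcoef_const_tauX.
have [lt_in|le_ni] := ltnP i n.
  by rewrite (bigD1 (Ordinal lt_in)) //= eqxx big1 ?addr0 // => j; rewrite eq_sym -val_eqE /= => /negPf->.
rewrite big1 => [|j _]; first by rewrite /tcoef nth_default // (leq_trans le_fn).
by case: eqP => // ij; move: (ltn_ord j); rewrite -ij ltnNge le_ni.
Qed.

Section TwistedAction.

Variables (V : zmodType) (sc : K -> V -> V) (T : V -> V).
Hypotheses (scDr : forall a, {morph sc a : x y / x + y})
  (scDl : forall x, {morph sc^~ x : a b / a + b})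
  (scA : forall a b x, sc a (sc b x) = sc (a * b) x) (sc1 : forall x, sc 1 x = x)
  (TD : {morph T : x y / x + y}) (TZ : forall a x, T (sc a x) = sc (frob 1 a) (T x)).

(** The abstract form serves twice: for K with the q-power map, and for rows over K[t] with the
    semilinear map through which tau acts on a t-motive. *)
Definition twact (f : Kt) (x : V) : V :=
  \sum_(k < size (f : {poly K})) sc (tcoef f k) (iter k T x).

Let sc0l x : sc 0 x = 0.
Proof. by apply: (addrI (sc 0 x)); rewrite -scDl !addr0. Qed.

Let iterTD k : {morph iter k T : x y / x + y}.
Proof. by move=> x y; elim: k => //= k ->; rewrite TD. Qed.

Let iterTZ k a x : iter k T (sc a x) = sc (frob k a) (iter k T x).
Proof.
elim: k => [|k /= ->]; first by rewrite frob0n.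
by rewrite TZ frob_comp add1n.
Qed.

Lemma twactE n (f : Kt) x : (size (f : {poly K}) <= n)%N ->
  twact f x = \sum_(k < n) sc (tcoef f k) (iter k T x).
Proof.
move=> le_fn; rewrite /twact (big_ord_widen n (fun k => sc (tcoef f k) (iter k T x))) //.
rewrite big_mkcond; apply: eq_bigr => k _; case: ltnP => // le_fk.
by rewrite /tcoef nth_default // sc0l.
Qed.

Lemma twactDr : right_distributive twact +%R.
Proof.
move=> f x y; rewrite /twact -big_split /=; apply: eq_bigr => k _.
by rewrite iterTD scDr.
Qed.

Lemma twactDl x : {morph twact^~ x : f g / f + g}.
Proof.
move=> f g; pose n := maxn (size (f : {poly K})) (size (g : {poly K})).
rewrite (@twactE n (f + g)) ?(@size_polyD K) // (@twactE n f) ?leq_maxl //.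
rewrite (@twactE n g) ?leq_maxr // -big_split /=; apply: eq_bigr => k _.
by rewrite tcoef_add scDl.
Qed.

Lemma twact_mono a k x : twact (tconst a * tau ^+ k) x = sc a (iter k T x).
Proof.
rewrite (@twactE k.+1); last first.
  apply/leq_sizeP => j le_kj; have := tcoef_const_tauX a k j.
  by rewrite /tcoef gtn_eqF.
rewrite big_ord_recr /= tcoef_const_tauX eqxx big1 ?add0r // => i _.
by rewrite tcoef_const_tauX ltn_eqF.
Qed.

Lemma twact_sum I (s : seq I) F x :
  twact (\sum_(i <- s) F i) x = \sum_(i <- s) twact (F i) x.
Proof.
apply: (big_morph (twact^~ x) (twactDl x)).
by rewrite /twact size_poly0 big_ord0.
Qed.

Lemma twact_sumr I (s : seq I) F f :
  twact f (\sum_(i <- s) F i) = \sum_(i <- s) twact f (F i).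
Proof.
apply: (big_morph (twact f) (twactDr f)).
by apply: (addrI (twact f 0)); rewrite -twactDr !addr0.
Qed.

(** Both sides are additive in [f] and [g], so the relation tau^i b = b^(q^i) tau^i on monomials
    suffices; [iterTZ] is its counterpart for the operator [T]. *)
Lemma twactA f g x : twact f (twact g x) = twact (f * g) x.
Proof.
rewrite {1 2}(Ktau_expand (leqnn (size (f : {poly K})))) mulr_suml !twact_sum.
apply: eq_bigr => i _.
rewrite {1 2}(Ktau_expand (leqnn (size (g : {poly K})))) mulr_sumr !twact_sum twact_sumr.
apply: eq_bigr => j _.
rewrite mulrA -(mulrA (tconst _)) frob_tconst_tau mulrA -rmorphM -mulrA -exprD.
by rewrite !twact_mono iterTZ scA iterD.
Qed.

Lemma twact_tconst a x : twact (tconst a) x = sc a x.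
Proof. by have := twact_mono a 0 x; rewrite expr0 mulr1. Qed.

Lemma twact_tauX k x : twact (tau ^+ k) x = iter k T x.
Proof. by have := twact_mono 1 k x; rewrite rmorph1 mul1r sc1. Qed.

Lemma twact_tau x : twact tau x = T x.
Proof. by have := twact_tauX 1 x; rewrite expr1. Qed.

Lemma twact1 : left_id 1 twact.
Proof. by move=> x; have := twact_tconst 1 x; rewrite rmorph1 sc1. Qed.

End TwistedAction.

Local Notation Kpt := (Kpt iota).

HB.instance Definition _ := GRing.Zmodule.copy Kpt K.

Definition Kpt_scale (f : Kt) (x : Kpt) : Kpt :=
  tev (idfun : {rmorphism K -> K}) f x.

Let Kmul (a : K) (x : Kpt) : Kpt := a * x.

Let KmulDr a : {morph Kmul a : x y / x + y}. Proof. exact: mulrDr. Qed.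
Let KmulDl x : {morph Kmul^~ x : a b / a + b}. Proof. by move=> a b; apply: mulrDl. Qed.
Let KmulA a b x : Kmul a (Kmul b x) = Kmul (a * b) x. Proof. exact: mulrA. Qed.
Let Kmul1 x : Kmul 1 x = x. Proof. exact: mul1r. Qed.
Let frob1D : {morph (frob 1 : Kpt -> Kpt) : x y / x + y}.
Proof. exact: (frob_add iota 1). Qed.
Let frob1Z a (x : Kpt) : frob 1 (Kmul a x) = Kmul (frob 1 a) (frob 1 x).
Proof. exact: frob_mul. Qed.

Lemma Kpt_scaleE f x : Kpt_scale f x = twact Kmul (frob 1) f x.
Proof.
apply: eq_bigr => k _; congr (_ * _); elim: (nat_of_ord k) x => [|m IHm] x.
  by rewrite expn0 expr1.
by rewrite iterS -IHm /Defs.frob -exprM expn1 expnSr.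
Qed.

Fact Kpt_scaleA f g x : Kpt_scale f (Kpt_scale g x) = Kpt_scale (f * g) x.
Proof. by rewrite !Kpt_scaleE (twactA KmulDr KmulDl KmulA frob1D frob1Z). Qed.

Fact Kpt_scale1 : left_id 1 Kpt_scale.
Proof. by move=> x; rewrite Kpt_scaleE (twact1 _ KmulDl Kmul1). Qed.

Fact Kpt_scaleDr : right_distributive Kpt_scale +%R.
Proof. by move=> f x y; rewrite !Kpt_scaleE (twactDr KmulDr frob1D). Qed.

Fact Kpt_scaleDl x : {morph Kpt_scale^~ x : f g / f + g}.
Proof. by move=> f g; rewrite !Kpt_scaleE (twactDl _ KmulDl). Qed.

HB.instance Definition _ := GRing.Zmodule_isLmodule.Build Kt Kpt
  Kpt_scaleA Kpt_scale1 Kpt_scaleDr Kpt_scaleDl.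

Lemma Kpt_tconst a (x : Kpt) : tconst a *: x = a * x.
Proof. by rewrite [LHS]Kpt_scaleE (twact_tconst _ KmulDl). Qed.

Lemma Kpt_tau (x : Kpt) : tau *: x = frob 1 x.
Proof. by rewrite [LHS]Kpt_scaleE (twact_tau _ KmulDl Kmul1). Qed.

Lemma kptE m n (M : 'M[Kt]_(m, n)) (x : 'cV[K]_n) a :
  kpt M x a 0 = \sum_b M a b *: (x b 0 : Kpt).
Proof. by rewrite mxE. Qed.

Lemma tactM d (E : tmodule iota d) a b : E (a * b) = E a *m E b.
Proof. exact: (rmorphM (tact E)). Qed.

Lemma tact_linear d (E : tmodule iota d) c a b :
  E (c *: a + b) = (cscal c)%:M *m E a + E b.
Proof. by rewrite -mul_polyC (rmorphD (tact E)) (rmorphM (tact E)) /= tactC. Qed.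

Lemma tact_step d (E : tmodule iota d) a c :
  E (a * 'X + c%:P) = E a *m E 'X + (cscal c)%:M.
Proof. by rewrite (rmorphD (tact E)) (rmorphM (tact E)) /= tactC. Qed.

Lemma mxact_step d (M : 'M[Kt]_d) a c :
  mxact M (a * 'X + c%:P) = mxact M a *m M + (cscal c)%:M.
Proof. by rewrite (raddfD (mxact M)) /= mxactMX mxactC. Qed.

Lemma cscal_mx_comm m n c (U : 'M[Kt]_(m, n)) :
  U *m (cscal c)%:M = (cscal c)%:M *m U.
Proof.
apply/matrixP => i j; rewrite mul_scalar_mx !mxE (bigD1 j) //= big1 => [|k nkj].
  by rewrite !mxE eqxx mulr1n addr0 cscal_comm.
by rewrite !mxE (negPf nkj) mulr0n mulr0.
Qed.

(** t generates Fq[t] over Fq, and constants from Fq commute with every matrix over K{tau}. *)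
Lemma tmorphismX d e (E : tmodule iota d) (G : tmodule iota e) (U : 'M[Kt]_(e, d)) :
  U *m E 'X = G 'X *m U -> tmorphism E G U.
Proof.
move=> UX; elim/poly_ind => [|a c IHa].
  by rewrite (rmorph0 (tact E)) (rmorph0 (tact G)) mulmx0 mul0mx.
rewrite (tact_step E a c) (tact_step G a c) mulmxDl mulmxDr cscal_mx_comm; congr (_ + _).
by rewrite mulmxA IHa -!mulmxA UX.
Qed.

End Basics.

(** * Twisted polynomials with coefficients in a module *)

Section Sequences.

Variables (Fq : finFieldType) (K : fieldType).
Variable iota : {rmorphism {poly Fq} -> K}.
Local Notation Kt := (Ktau iota).
Local Notation frob := (@frob Fq K).
Local Notation theta := (theta iota).

Section Module.

Variable V : lmodType Kt.

(* Rows over V{tau}: the entry b of f is the sum of the (f b k) tau^k, a finite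
   sum when finsupp f holds. *)
Definition vrow (d : nat) := 'I_d -> nat -> V.

Definition finsupp d (f : vrow d) := exists n, forall b k, (n <= k)%N -> f b k = 0.

(** V carries only a left action, so the rule is (v tau^l)(b tau^m) = (b^(q^l) v) tau^(l+m), which
    for V = K is the product in K{tau}. *)
Definition rmul d d' (f : vrow d) (B : 'M[Kt]_(d, d')) : vrow d' := fun c k =>
  \sum_b \sum_(l < k.+1) tconst (frob l (tcoef (B b c) (k - l))) *: f b l.

(** Left multiplication by theta + tau, with tau (v tau^k) = (tau v) tau^(k+1). *)
Definition lcarlitz d (f : vrow d) : vrow d := fun b k =>
  tconst theta *: f b k + (if k is k'.+1 then tau *: f b k' else 0).

Definition vact m n (M : 'M[Kt]_(m, n)) (x : 'I_n -> V) : 'I_m -> V :=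
  fun a => \sum_b M a b *: x b.

Definition nform d n (N : nat -> 'M[K]_(d, n)) (x : 'I_n -> V) : vrow d :=
  fun b k => \sum_i tconst (N k b i) *: x i.

Definition vinner d (E : tmodule iota d) (U : vrow d) : vrow d :=
  fun b k => rmul U (E 'X) b k - lcarlitz U b k.

(** The support of [U] is finite: uniqueness of normal forms is proved by descending from its top
    degree. *)
Definition vcong d (E : tmodule iota d) (f g : vrow d) :=
  exists2 U : vrow d, finsupp U & forall b k, f b k - g b k = vinner E U b k.

Lemma eq_rmul d d' (f g : vrow d) (B : 'M[Kt]_(d, d')) c k :
  (forall b l, f b l = g b l) -> rmul f B c k = rmul g B c k.
Proof. by move=> fg; apply: eq_bigr => b _; apply: eq_bigr => l _; rewrite fg. Qed.

Lemma rmulD d d' (f g : vrow d) (B : 'M[Kt]_(d, d')) c k :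
  rmul (fun b l => f b l + g b l) B c k = rmul f B c k + rmul g B c k.
Proof.
rewrite -big_split; apply: eq_bigr => b _; rewrite -big_split.
by apply: eq_bigr => l _; rewrite scalerDr.
Qed.

Lemma rmulN d d' (f : vrow d) (B : 'M[Kt]_(d, d')) c k :
  rmul (fun b l => - f b l) B c k = - rmul f B c k.
Proof.
rewrite -sumrN; apply: eq_bigr => b _; rewrite -sumrN.
by apply: eq_bigr => l _; rewrite scalerN.
Qed.

Lemma rmulB d d' (f g : vrow d) (B : 'M[Kt]_(d, d')) c k :
  rmul (fun b l => f b l - g b l) B c k = rmul f B c k - rmul g B c k.
Proof. by rewrite (@rmulD d d' f (fun b l => - g b l)) rmulN. Qed.

Lemma rmulA d d' d'' (f : vrow d) (B : 'M[Kt]_(d, d')) (B' : 'M[Kt]_(d', d'')) c k :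
  rmul (rmul f B) B' c k = rmul f (B *m B') c k.
Proof.
(* Contribution of the coefficient l of [f] through degree i of the intermediate product; [i - l]
   truncates, so the sum is restricted to l <= i. *)
pose cf b (b' : 'I_d') (l i : nat) := tconst (frob i (tcoef (B' b' c) (k - i))
     * frob l (tcoef (B b b') (i - l))) *: f b l.
transitivity (\sum_(b' < d') \sum_(b < d) \sum_(l < k.+1) \sum_(i < k.+1 | (l <= i)%N) cf b b' l i).
  apply: eq_bigr => b' _; under eq_bigr do rewrite scaler_sumr.
  rewrite exchange_big; apply: eq_bigr => b _ /=.
  rewrite [RHS](exchange_big_dep predT) //=; apply: eq_bigr => i _.
  rewrite scaler_sumr (big_ord_widen _ (fun l => tconst (frob i (tcoef (B' b' c) (k - i)))
        *: (tconst (frob l (tcoef (B b b') (i - l))) *: f b l)) (ltn_ord i)).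
  by apply: eq_bigr => l _; rewrite scalerA -rmorphM.
rewrite exchange_big; apply: eq_bigr => b _.
rewrite exchange_big; apply: eq_bigr => l _.
have le_lk : (l <= k)%N by rewrite -ltnS.
rewrite !mxE tcoef_sum (frob_sum iota) rmorph_sum scaler_suml; apply: eq_bigr => b' _.
rewrite tcoefM (frob_sum iota) rmorph_sum scaler_suml /=.
rewrite -(big_mkord (fun i => (l <= i)%N) (cf b b' l)).
rewrite (big_cat_nat (n := l)) ?leqW //= big_nat_cond big1 ?add0r; last first.
  by move=> i /andP[/andP[_ lt_il]]; rewrite leqNgt lt_il.
rewrite -{1}[nat_of_ord l]add0n big_addn subSn // big_mkord.
apply: eq_big => [i|i _]; first by rewrite leq_addl.
rewrite /cf addnK frob_mul frob_comp [(i + l)%N]addnC subnDA.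
by rewrite mulrC.
Qed.

Lemma lcarlitzD d (f g : vrow d) b k :
  lcarlitz (fun b l => f b l + g b l) b k = lcarlitz f b k + lcarlitz g b k.
Proof.
rewrite /lcarlitz scalerDr addrACA; case: k => [|k]; last by rewrite scalerDr.
by rewrite !addr0.
Qed.

Lemma lcarlitzB d (f g : vrow d) b k :
  lcarlitz (fun b l => f b l - g b l) b k = lcarlitz f b k - lcarlitz g b k.
Proof.
rewrite /lcarlitz scalerBr opprD addrACA; case: k => [|k]; last by rewrite scalerBr.
by rewrite subr0 addr0.
Qed.

Lemma eq_lcarlitz d (f g : vrow d) b k :
  (forall b l, f b l = g b l) -> lcarlitz f b k = lcarlitz g b k.
Proof. by move=> fg; rewrite /lcarlitz fg; case: k => // k; rewrite fg. Qed.

(** Left and right multiplication on V{tau} commute. Hence multiplying by C_t, or pulling back along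
    a morphism, preserves congruence. *)
Lemma lcarlitz_rmul d d' (f : vrow d) (B : 'M[Kt]_(d, d')) c k :
  lcarlitz (rmul f B) c k = rmul (lcarlitz f) B c k.
Proof.
rewrite [RHS]/rmul; under [RHS]eq_bigr do under eq_bigr do rewrite scalerDr.
under [RHS]eq_bigr do rewrite big_split /=.
rewrite big_split /=; congr (_ + _).
  rewrite scaler_sumr; apply: eq_bigr => b _; rewrite scaler_sumr.
  by apply: eq_bigr => l _; rewrite !scalerA -!rmorphM /= mulrC.
case: k => [|k].
  by rewrite big1 // => b _; rewrite big_ord1 scaler0.
rewrite scaler_sumr; apply: eq_bigr => b _.
rewrite [RHS]big_ord_recl scaler0 add0r scaler_sumr; apply: eq_bigr => l _ /=.
rewrite !scalerA tau_const; congr (_ *: _); congr (tconst _ * _).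
by rewrite /bump /= add1n subSS -[l.+1]add1n -frob_comp [in RHS]/Defs.frob expn1.
Qed.

Lemma finsupp_rmul d d' (f : vrow d) (B : 'M[Kt]_(d, d')) :
  finsupp f -> finsupp (rmul f B).
Proof.
case=> n f0; pose m := \max_b \max_c size (B b c : {poly K}).
exists (n + m)%N => c k le_k; apply: big1 => b _; apply: big1 => l _.
have [le_nl|lt_ln] := leqP n l; first by rewrite f0 ?scaler0.
have le_m : (size (B b c : {poly K}) <= m)%N.
  apply: leq_trans (leq_bigmax b); exact: (leq_bigmax c).
have tB : tcoef (B b c) (k - l) = 0.
  rewrite /tcoef nth_default //; apply: (leq_trans le_m).
  rewrite leq_subRL; last by rewrite -ltnS.
  by rewrite (leq_trans _ le_k) // leq_add2r ltnW.
by rewrite tB (frob_zero iota) rmorph0 scale0r.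
Qed.

Lemma finsupp_lcarlitz d (f : vrow d) : finsupp f -> finsupp (lcarlitz f).
Proof.
case=> n f0; exists n.+1 => b [|k] // le_nk; rewrite /lcarlitz.
by rewrite !f0 ?scaler0 ?addr0 // ltnW.
Qed.

Lemma finsuppD d (f g : vrow d) :
  finsupp f -> finsupp g -> finsupp (fun b k => f b k + g b k).
Proof.
case=> n f0 [m g0]; exists (maxn n m) => b k.
by rewrite geq_max => /andP[? ?]; rewrite f0 // g0 // addr0.
Qed.

Lemma finsuppN d (f : vrow d) : finsupp f -> finsupp (fun b k => - f b k).
Proof. by case=> n f0; exists n => b k ?; rewrite f0 ?oppr0. Qed.

Lemma finsuppB d (f g : vrow d) :
  finsupp f -> finsupp g -> finsupp (fun b k => f b k - g b k).
Proof. by move=> ff fg; apply: finsuppD => //; apply: finsuppN. Qed.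

Lemma vinnerB d (E : tmodule iota d) (U W : vrow d) b k :
  vinner E (fun b k => U b k - W b k) b k = vinner E U b k - vinner E W b k.
Proof. by rewrite /vinner rmulB lcarlitzB !opprB addrACA [RHS]addrACA; congr (_ + _); rewrite addrC. Qed.

Lemma vinner0 d (E : tmodule iota d) b k : vinner E (fun _ _ => 0) b k = 0.
Proof.
rewrite -[RHS](subrr (vinner E (fun _ _ => 0) b k)) -vinnerB.
by congr (_ - _); [apply: eq_rmul | apply: eq_lcarlitz] => ? ?; rewrite subrr.
Qed.

Lemma vinnerD d (E : tmodule iota d) (U W : vrow d) b k :
  vinner E (fun b k => U b k + W b k) b k = vinner E U b k + vinner E W b k.
Proof. by rewrite /vinner rmulD lcarlitzD opprD addrACA. Qed.

(** The constant coefficient is U_0 theta - theta U_0, since Lie(E) carries no nilpotent part. This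
    makes the constant coefficients invariants of the class. *)
Lemma vinner_coef0 d (E : tmodule iota d) (U : vrow d) b :
  lie (E 'X) = theta%:M -> vinner E U b 0 = 0.
Proof.
move=> lieE; rewrite /vinner /rmul /lcarlitz addr0.
under eq_bigr => c _ do rewrite big_ord1 subn0 frob0n.
have lE c : tcoef (E 'X c b) 0 = theta *+ (c == b).
  by have /matrixP/(_ c b) := lieE; rewrite !mxE.
rewrite (bigD1 b) //= lE eqxx big1 ?addr0 ?subrr // => c /negPf ncb.
by rewrite lE ncb rmorph0 scale0r.
Qed.

Lemma lcarlitz_vinner d (E : tmodule iota d) (U : vrow d) b k :
  lcarlitz (vinner E U) b k = vinner E (lcarlitz U) b k.
Proof. by rewrite lcarlitzB lcarlitz_rmul. Qed.

Lemma vinner_pullback d d' (E : tmodule iota d) (F : tmodule iota d')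
    (beta : 'M[Kt]_(d', d)) (U : vrow d') b k : tmorphism E F beta ->
  rmul (vinner F U) beta b k = vinner E (rmul U beta) b k.
Proof.
move=> betaE; rewrite rmulB /vinner !rmulA betaE; congr (_ - _).
by rewrite lcarlitz_rmul.
Qed.

Section Congruence.

Variables (d : nat) (E : tmodule iota d).

Lemma vcong_refl (f g : vrow d) : (forall b k, f b k = g b k) -> vcong E f g.
Proof.
move=> fg; exists (fun _ _ => 0); first by exists 0%N.
by move=> b k; rewrite fg subrr vinner0.
Qed.

Lemma vcong_trans (f g h : vrow d) : vcong E f g -> vcong E g h -> vcong E f h.
Proof.
case=> U fU fg [W fW gh]; exists (fun b k => U b k + W b k); first exact: finsuppD.
by move=> b k; rewrite vinnerD -fg -gh addrA subrK.
Qed.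

Lemma vcongB (f g f' g' : vrow d) : vcong E f g -> vcong E f' g' ->
  vcong E (fun b k => f b k - f' b k) (fun b k => g b k - g' b k).
Proof.
case=> U fU fg [W fW gh]; exists (fun b k => U b k - W b k); first exact: finsuppB.
by move=> b k; rewrite vinnerB -fg -gh !opprB addrACA [RHS]addrACA [- f' b k + _]addrC.
Qed.

Lemma vcong_sym (f g : vrow d) : vcong E f g -> vcong E g f.
Proof.
case=> U fU fg; exists (fun b k => 0 - U b k).
  by apply: finsuppB => //; exists 0%N.
by move=> b k; rewrite vinnerB vinner0 -fg sub0r opprB.
Qed.

Lemma vcong_lcarlitz (f g : vrow d) : vcong E f g -> vcong E (lcarlitz f) (lcarlitz g).
Proof.
case=> U fU fg; exists (lcarlitz U); first exact: finsupp_lcarlitz.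
by move=> b k; rewrite -lcarlitz_vinner -lcarlitzB; apply: eq_lcarlitz.
Qed.

End Congruence.

Lemma vcong_pullback d d' (E : tmodule iota d) (F : tmodule iota d')
    (beta : 'M[Kt]_(d', d)) (f g : vrow d') : tmorphism E F beta ->
  vcong F f g -> vcong E (rmul f beta) (rmul g beta).
Proof.
move=> betaE [U fU fg]; exists (rmul U beta); first exact: finsupp_rmul.
by move=> b k; rewrite -(vinner_pullback _ _ _ betaE) -rmulB; apply: eq_rmul.
Qed.

Lemma nformB d n (N : nat -> 'M[K]_(d, n)) (x y : 'I_n -> V) b k :
  nform N (fun i => x i - y i) b k = nform N x b k - nform N y b k.
Proof. by rewrite -sumrB; apply: eq_bigr => i _; rewrite scalerBr. Qed.

End Module.

Section Functoriality.

Variables (V W : lmodType Kt) (ev : V -> W).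
Hypothesis evD : {morph ev : x y / x + y}.
Hypothesis evZ : forall a x, ev (a *: x) = a *: ev x.

Let ev0 : ev 0 = 0.
Proof. by rewrite -(scale0r (0 : V)) evZ scale0r. Qed.

Let ev_sum I (s : seq I) (P : pred I) (F : I -> V) :
  ev (\sum_(i <- s | P i) F i) = \sum_(i <- s | P i) ev (F i).
Proof. exact: (big_morph ev evD ev0). Qed.

Let evN x : ev (- x) = - ev x.
Proof. by rewrite -scaleN1r evZ scaleN1r. Qed.

Lemma ev_rmul d d' (f : vrow V d) (B : 'M[Kt]_(d, d')) c k :
  ev (rmul f B c k) = rmul (fun b l => ev (f b l)) B c k.
Proof. by rewrite ev_sum; apply: eq_bigr => b _; rewrite ev_sum; apply: eq_bigr. Qed.

Lemma ev_lcarlitz d (f : vrow V d) b k :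
  ev (lcarlitz f b k) = lcarlitz (fun b l => ev (f b l)) b k.
Proof. by rewrite evD evZ; case: k => [|k]; rewrite ?ev0 ?evZ. Qed.

Lemma ev_nform d n (N : nat -> 'M[K]_(d, n)) (x : 'I_n -> V) b k :
  ev (nform N x b k) = nform N (fun i => ev (x i)) b k.
Proof. by rewrite ev_sum; apply: eq_bigr. Qed.

(** A K{tau}-linear map of coefficients transports congruences. It is applied to specializations of
    a generic row and to right multiplication by a matrix on K{tau}^n. *)
Lemma ev_vcong d (E : tmodule iota d) (f g : vrow V d) : vcong E f g ->
  vcong E (fun b k => ev (f b k)) (fun b k => ev (g b k)).
Proof.
case=> U [n U0] fg; exists (fun b k => ev (U b k)).
  by exists n => b k ?; rewrite U0.
by move=> b k; rewrite /vinner -ev_rmul -ev_lcarlitz -!evN -!evD fg.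
Qed.

End Functoriality.

End Sequences.

(** * Biderivations *)

Section Biderivations.

Variables (Fq : finFieldType) (K : fieldType).
Variable iota : {rmorphism {poly Fq} -> K}.
Local Notation Kt := (Ktau iota).
Local Notation C := (carlitz iota).

Section General.

Variables (d e : nat) (E : tmodule iota d) (G : tmodule iota e).

(** The biderivation with value [f] at t, read off the action of [a] on the corresponding extension
    of E by G; multiplicativity of the block matrices is the biderivation law. *)
Definition bider (f : 'M[Kt]_(e, d)) : bifun iota d e :=
  fun a => dlsubmx (mxact (block_mx (E 'X) 0 f (G 'X)) a).

Lemma mxact_block f a :
  mxact (block_mx (E 'X) 0 f (G 'X)) a = block_mx (E a) 0 (bider f a) (G a).
Proof.
have stepE : forall M : 'M[Kt]_(d + e), M = block_mx (E a) 0 (dlsubmx M) (G a) ->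
    M = block_mx (E a) 0 (dlsubmx M) (G a) by [].
apply: stepE; elim/poly_ind: a => [|a c IHa].
  rewrite raddf0 (rmorph0 (tact E)) (rmorph0 (tact G)).
  by rewrite -[LHS]submxK /ulsubmx /ursubmx /drsubmx !raddf0.
rewrite mxact_step (tact_step E a c) (tact_step G a c).
have -> : (cscal c)%:M = block_mx (cscal c)%:M 0 0 (cscal c)%:M :> 'M[Kt]_(d + e).
  exact: scalar_mx_block.
rewrite {}IHa mulmx_block add_block_mx block_mxKdl !mul0mx !mulmx0 !addr0 !add0r.
by [].
Qed.

Lemma bider_biderivation f : biderivation E G (bider f).
Proof.
split=> [c a b|a b]; rewrite /bider; set M := block_mx _ _ _ _.
  have -> : c *: a + b = c%:P * a + b by rewrite mul_polyC.
  rewrite (rmorphD (mxact M)) (rmorphM (mxact M)) /= mxactC.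
  rewrite -mulmxE !mxact_block (scalar_mx_block d e) mulmx_block add_block_mx.
  by rewrite !block_mxKdl mul0mx add0r mul_scalar_mx.
rewrite (rmorphM (mxact M)) /= -mulmxE !mxact_block mulmx_block !block_mxKdl.
by rewrite addrC.
Qed.

Lemma biderX f : bider f 'X = f.
Proof. by rewrite /bider mxactX block_mxKdl. Qed.

(** The identity delta(1) = delta(1) + delta(1) kills the constants, so the Horner scheme determines
    delta from its value at t. *)
Lemma biderivation_step dl a c : biderivation E G dl ->
  dl (a * 'X + c%:P) = G a *m dl 'X + dl a *m E 'X.
Proof.
case=> dlL dlM; have dl0 : dl 0 = 0.
  have := dlL 1 0 0; rewrite scaler0 addr0 /cscal polyC1 !rmorph1 scale1r.
  by move/eqP; rewrite -subr_eq0 opprD addNKr oppr_eq0 => /eqP.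
have dl1 : dl 1 = 0.
  have := dlM 1 1; rewrite mulr1 (rmorph1 (tact G)) (rmorph1 (tact E)).
  by rewrite mul1mx mulmx1 => /eqP; rewrite -subr_eq0 opprD addNKr oppr_eq0 => /eqP.
have -> : a * 'X + c%:P = c *: 1 + a * 'X by rewrite addrC alg_polyC.
by rewrite dlL dl1 scaler0 add0r dlM.
Qed.

Lemma eq_biderivation dl dl' : biderivation E G dl -> biderivation E G dl' ->
  dl 'X = dl' 'X -> forall a, dl a = dl' a.
Proof.
move=> dlB dlB' eqX; elim/poly_ind => [|a c IHa]; last first.
  by rewrite !biderivation_step // eqX IHa.
have := biderivation_step 0 0 dlB; have := biderivation_step 0 0 dlB'.
rewrite mul0r addr0 (rmorph0 (tact G)) !mul0mx !add0r.
case: dlB dlB' => dlL _ [dlL' _] _ _.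
have := dlL 1 0 0; have := dlL' 1 0 0.
rewrite scaler0 addr0 /cscal polyC1 !rmorph1 !scale1r.
by move/eqP; rewrite -subr_eq0 opprD addNKr oppr_eq0 => /eqP -> /eqP;
   rewrite -subr_eq0 opprD addNKr oppr_eq0 => /eqP ->.
Qed.

Lemma inner_biderivation (U : 'M[Kt]_(e, d)) :
  biderivation E G (fun a => U *m E a - G a *m U).
Proof.
split=> [c a b|a b].
  rewrite (tact_linear E c a b) (tact_linear G c a b) mulmxDr mulmxDl mulmxA.
  by rewrite cscal_mx_comm opprD addrACA -!mulmxA -mulmxBr mul_scalar_mx.
rewrite (tactM E a b) (tactM G a b) mulmxBr mulmxBl !mulmxA.
by rewrite [RHS]addrC addrA subrK.
Qed.

Lemma biderivationB dl dl' : biderivation E G dl -> biderivation E G dl' ->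
  biderivation E G (fun a => dl a - dl' a).
Proof.
case=> dlL dlM [dlL' dlM']; split=> [c a b|a b].
  by rewrite dlL dlL' scalerBr opprD addrACA.
by rewrite dlM dlM' mulmxBr mulmxBl opprD addrACA.
Qed.

Lemma biderivationD dl dl' : biderivation E G dl -> biderivation E G dl' ->
  biderivation E G (fun a => dl a + dl' a).
Proof.
case=> dlL dlM [dlL' dlM']; split=> [c a b|a b].
  by rewrite dlL dlL' scalerDr addrACA.
by rewrite dlM dlM' mulmxDr mulmxDl addrACA.
Qed.

Lemma biderivation_act b dl : biderivation E G dl ->
  biderivation E G (fun a => G b *m dl a).
Proof.
case=> dlL dlM; split=> [c a a'|a a'].
  rewrite dlL mulmxDr; congr (_ + _).
  by rewrite -!mul_scalar_mx mulmxA cscal_mx_comm mulmxA.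
by rewrite dlM mulmxDr !mulmxA -(tactM G b a) [b * a]mulrC (tactM G a b).
Qed.

Lemma biderivation_pullback d' (F : tmodule iota d') beta dl :
  biderivation E G dl -> tmorphism F E beta ->
  biderivation F G (pullback dl beta).
Proof.
case=> dlL dlM betaE; split=> [c a b|a b]; rewrite /pullback.
  by rewrite dlL mulmxDl scalemxAl.
by rewrite dlM mulmxDl -!mulmxA betaE.
Qed.

(** Inner maps are biderivations too, so equality at t propagates to all of Fq[t]. *)
Lemma innerX dl : biderivation E G dl ->
  inner E G dl <-> exists U : 'M[Kt]_(e, d), dl 'X = U *m E 'X - G 'X *m U.
Proof.
move=> dlB; split=> [[U dlU]|[U dlU]]; exists U => //.
exact: eq_biderivation (inner_biderivation U) dlU.
Qed.

End General.

Definition rowseq d (f : 'rV[Kt]_d) : vrow (Kpt iota) d := fun b k => tcoef (f ord0 b) k.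

Definition seqrow d n (f : vrow (Kpt iota) d) : 'rV[Kt]_d :=
  \row_b (\poly_(k < n) (f b k : K) : Kt).

Lemma seqrowK d n (f : vrow (Kpt iota) d) : (forall b k, (n <= k)%N -> f b k = 0) ->
  forall b k, rowseq (seqrow n f) b k = f b k.
Proof.
move=> f0 b k; rewrite /rowseq mxE /tcoef coef_poly.
by case: ltnP => // le_nk; rewrite f0.
Qed.

Lemma finsupp_rowseq d (f : 'rV[Kt]_d) : finsupp (rowseq f).
Proof.
exists (\max_(b < d) size (f ord0 b : {poly K})) => b k le_k.
by rewrite /rowseq /tcoef nth_default // (leq_trans _ le_k) // (leq_bigmax b).
Qed.

Lemma rowseq_mul d d' (f : 'rV[Kt]_d) (B : 'M[Kt]_(d, d')) c k :
  rowseq (f *m B) c k = rmul (rowseq f) B c k.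
Proof.
rewrite /rowseq !mxE tcoef_sum; apply: eq_bigr => b _; rewrite tcoefM.
by apply: eq_bigr => l _; rewrite Kpt_tconst mulrC.
Qed.

Lemma carlitzX : C 'X = carlitz_mx iota.
Proof. exact: tmodule_ofX. Qed.

Lemma rowseq_carlitz d (f : 'rV[Kt]_d) b k :
  rowseq (C 'X *m f) b k = lcarlitz (rowseq f) b k.
Proof.
rewrite carlitzX mul_scalar_mx /rowseq mxE mulrDl tcoef_add tcoef_constM.
rewrite tcoef_tauM /lcarlitz Kpt_tconst; congr (_ + _).
by case: k => // k; rewrite Kpt_tau.
Qed.

Lemma rowseqB d (f g : 'rV[Kt]_d) b k :
  rowseq (f - g) b k = rowseq f b k - rowseq g b k.
Proof. by rewrite /rowseq !mxE tcoef_add tcoefN. Qed.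

Lemma rowseqD d (f g : 'rV[Kt]_d) b k :
  rowseq (f + g) b k = rowseq f b k + rowseq g b k.
Proof. by rewrite /rowseq !mxE tcoef_add. Qed.

Lemma rowseq_inj d (f g : 'rV[Kt]_d) :
  (forall b k, rowseq f b k = rowseq g b k) -> f = g.
Proof. by move=> fg; apply/rowP => b; apply: tcoefP => k; apply: fg. Qed.

Lemma rowseq_inner d (E : tmodule iota d) (U : 'rV[Kt]_d) b k :
  rowseq (U *m E 'X - C 'X *m U) b k = vinner E (rowseq U) b k.
Proof. by rewrite rowseqB rowseq_mul rowseq_carlitz. Qed.

(** A finitely supported family is the same thing as a row over K{tau}. *)
Lemma vcong_rowseq d (E : tmodule iota d) (f g : 'rV[Kt]_d) :
  vcong E (rowseq f) (rowseq g) <->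
  exists U : 'rV[Kt]_d, f - g = U *m E 'X - C 'X *m U.
Proof.
split=> [[U [n U0] fg]|[U fg]].
  exists (seqrow n U); apply: rowseq_inj => b k.
  rewrite rowseq_inner rowseqB fg; congr (_ - _); last first.
    by apply: eq_lcarlitz => b' l; rewrite seqrowK.
  by apply: eq_rmul => b' l; rewrite seqrowK.
exists (rowseq U); first exact: finsupp_rowseq.
by move=> b k; rewrite -rowseqB fg rowseq_inner.
Qed.

Lemma ext_eqP d (E : tmodule iota d) dl dl' :
  biderivation E C dl -> biderivation E C dl' ->
  ext_eq E C dl dl' <-> vcong E (rowseq (dl 'X)) (rowseq (dl' 'X)).
Proof.
move=> B B'.
exact: iff_trans (innerX (biderivationB B B')) (iff_sym (vcong_rowseq E _ _)).
Qed.

Lemma innerP d (E : tmodule iota d) dl : biderivation E C dl ->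
  inner E C dl <-> vcong E (rowseq (dl 'X)) (fun _ _ => 0).
Proof.
move=> B; have z b k : rowseq (0 : 'rV[Kt]_d) b k = 0 by rewrite /rowseq mxE tcoef0.
split.
  move/(innerX B) => dlU; apply: (vcong_trans (g := rowseq 0)).
    by apply/vcong_rowseq; rewrite subr0.
  exact: vcong_refl.
move=> dlU; apply/(innerX B); rewrite -[dl 'X]subr0; apply/vcong_rowseq.
by apply: vcong_trans dlU _; apply: vcong_refl.
Qed.

End Biderivations.

(** * Normal forms of extension classes *)

Section Presentations.

Variables (Fq : finFieldType) (K : fieldType).
Variable iota : {rmorphism {poly Fq} -> K}.
Local Notation Kt := (Ktau iota).
Local Notation theta := (theta iota).
Local Notation C := (carlitz iota).

Lemma kptM m n p (M : 'M[Kt]_(m, n)) (M' : 'M[Kt]_(n, p)) x :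
  kpt (M *m M') x = kpt M (kpt M' x).
Proof.
apply/colP => a; rewrite !kptE.
under eq_bigr do rewrite mxE scaler_suml.
rewrite exchange_big; apply: eq_bigr => b _ /=.
rewrite (kptE M' x b) scaler_sumr; apply: eq_bigr => c _; by rewrite scalerA.
Qed.

Lemma kptDl m n (M M' : 'M[Kt]_(m, n)) x : kpt (M + M') x = kpt M x + kpt M' x.
Proof.
apply/colP => a; rewrite [RHS]mxE !kptE -big_split; apply: eq_bigr => b _ /=.
by rewrite mxE scalerDl.
Qed.

Lemma kptDr m n (M : 'M[Kt]_(m, n)) x y : kpt M (x + y) = kpt M x + kpt M y.
Proof.
apply/colP => a; rewrite [RHS]mxE !kptE -big_split; apply: eq_bigr => b _ /=.
by rewrite mxE scalerDr.
Qed.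

Lemma kpt0l m n x : kpt (0 : 'M[Kt]_(m, n)) x = 0.
Proof. by apply: (addrI (kpt (0 : 'M[Kt]_(m, n)) x)); rewrite -kptDl !addr0. Qed.

(** For every V, normal forms identify V^n with the classes of rows over V{tau}, and X_t with C_t,
    so X represents a functor of V. Normal forms have degree below [n0]. *)
Definition presents d n (E : tmodule iota d) (X : tmodule iota n)
    (n0 : nat) (N : nat -> 'M[K]_(d, n)) : Prop :=
  [/\ forall k, (n0 <= k)%N -> N k = 0,
      forall (V : lmodType Kt) (f : vrow V d), finsupp f ->
        exists x : 'I_n -> V, vcong E f (nform N x),
      forall (V : lmodType Kt) (x : 'I_n -> V),
        vcong E (nform N x) (fun _ _ => 0) -> forall i, x i = 0
    & forall (V : lmodType Kt) (x : 'I_n -> V),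
        vcong E (lcarlitz (nform N x)) (nform N (vact (X 'X) x))].

Definition nfrow d n n0 (N : nat -> 'M[K]_(d, n)) (x : 'cV[K]_n) : 'rV[Kt]_d :=
  seqrow n0 (nform N (fun i => x i 0 : Kpt iota)).

Definition nfclass d n (E : tmodule iota d) n0 (N : nat -> 'M[K]_(d, n))
  (x : 'cV[K]_n) : bifun iota d 1 := bider E C (nfrow n0 N x).

Definition rcong d (E : tmodule iota d) (f g : 'rV[Kt]_d) :=
  exists U : 'rV[Kt]_d, f - g = U *m E 'X - C 'X *m U.

Section RowCongruence.

Variables (d : nat) (E : tmodule iota d).

Lemma rcongP f g : rcong E f g <-> vcong E (rowseq f) (rowseq g).
Proof. exact: iff_sym (vcong_rowseq E f g). Qed.

Lemma rcong_refl f : rcong E f f.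
Proof. by exists 0; rewrite subrr mul0mx mulmx0 subrr. Qed.

Lemma rcong_sym f g : rcong E f g -> rcong E g f.
Proof. by move=> fg; apply/rcongP; apply: vcong_sym; apply/rcongP. Qed.

Lemma rcong_trans f g h : rcong E f g -> rcong E g h -> rcong E f h.
Proof. by move=> /rcongP fg /rcongP gh; apply/rcongP; apply: vcong_trans fg gh. Qed.

Lemma rcongD f g f' g' : rcong E f g -> rcong E f' g' -> rcong E (f + f') (g + g').
Proof.
case=> U fg [W fg']; exists (U + W); rewrite mulmxDl mulmxDr !opprD.
by rewrite addrACA fg fg' addrACA.
Qed.

Lemma rcong_act a f g : rcong E f g -> rcong E (C a *m f) (C a *m g).
Proof.
case=> U fg; exists (C a *m U); rewrite -mulmxBr fg mulmxBr !mulmxA.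
by rewrite -(tactM C a 'X) [a * 'X]mulrC (tactM C 'X a).
Qed.

End RowCongruence.

Section Represents.

Variables (d n : nat) (E : tmodule iota d) (X : tmodule iota n).
Variables (n0 : nat) (N : nat -> 'M[K]_(d, n)).
Hypothesis presE : presents E X n0 N.

Lemma rowseq_nfrow (x : 'cV[K]_n) b k :
  rowseq (nfrow n0 N x) b k = nform N (fun i => x i 0 : Kpt iota) b k.
Proof.
have [N0 _ _ _] := presE; apply: seqrowK => {}b {}k le_k; rewrite /nform.
by apply: big1 => i _; rewrite N0 // mxE rmorph0 scale0r.
Qed.

Lemma nfrowD x y : nfrow n0 N (x + y) = nfrow n0 N x + nfrow n0 N y.
Proof.
apply: rowseq_inj => b k; rewrite rowseqD !rowseq_nfrow -big_split.
by apply: eq_bigr => i _; rewrite mxE scalerDr.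
Qed.

(** The presentation only knows t; Horner's scheme extends the compatibility to all of Fq[t]. *)
Lemma nfrow_act a x : rcong E (nfrow n0 N (kpt (X a) x)) (C a *m nfrow n0 N x).
Proof.
have [_ _ _ actX] := presE.
have actXx y : rcong E (nfrow n0 N (kpt (X 'X) y)) (C 'X *m nfrow n0 N y).
  apply: rcong_sym; apply/rcongP; apply: (vcong_trans _ (vcong_trans (actX _ _) _)).
    apply: vcong_refl => b k; rewrite rowseq_carlitz; apply: eq_lcarlitz => b' l.
    exact: rowseq_nfrow.
  apply: vcong_refl => b k; rewrite rowseq_nfrow; apply: eq_bigr => i _.
  by rewrite (kptE (X 'X) y i).
elim/poly_ind: a x => [|a c IHa] x.
  rewrite (rmorph0 (tact X)) (rmorph0 (tact C)) kpt0l mul0mx.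
  suff -> : nfrow n0 N 0 = 0 by apply: rcong_refl.
  by apply: (addrI (nfrow n0 N 0)); rewrite -nfrowD !addr0.
rewrite (tact_step X a c) (tact_step C a c) kptDl nfrowD mulmxDl.
apply: rcongD; last first.
  suff -> : nfrow n0 N (kpt (cscal c : Kt)%:M x) = (cscal c)%:M *m nfrow n0 N x.
    exact: rcong_refl.
  apply: rowseq_inj => b k; rewrite rowseq_nfrow mul_scalar_mx.
  rewrite /rowseq mxE tcoef_constM [tcoef _ k]rowseq_nfrow /nform mulr_sumr.
  apply: eq_bigr => i _; rewrite kptE (bigD1 i) //= big1 => [|j].
    rewrite mxE eqxx mulr1n addr0 /cscal -Kpt_tconst !scalerA -!rmorphM /=.
    by rewrite mulrC.
  by rewrite eq_sym => /negPf nij; rewrite mxE nij mulr0n scale0r.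
rewrite kptM -mulmxA; apply: rcong_trans (IHa _) _; apply: rcong_act.
exact: actXx.
Qed.

Lemma nfclass_biderivation x : biderivation E C (nfclass E n0 N x).
Proof. exact: bider_biderivation. Qed.

Lemma nfclass_eqP x dl : biderivation E C dl ->
  ext_eq E C (nfclass E n0 N x) dl <-> rcong E (nfrow n0 N x) (dl 'X).
Proof.
move=> dlB; apply: iff_trans (ext_eqP (nfclass_biderivation x) dlB) _.
by rewrite /nfclass biderX; apply: iff_sym; apply: rcongP.
Qed.

Lemma nfclassD x y : ext_eq E C (nfclass E n0 N (x + y))
  (fun b => nfclass E n0 N x b + nfclass E n0 N y b).
Proof.
apply/nfclass_eqP; first by apply: biderivationD; apply: nfclass_biderivation.
by rewrite /nfclass !biderX nfrowD; apply: rcong_refl.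
Qed.

Lemma nfclass_act a x : ext_eq E C (nfclass E n0 N (kpt (X a) x))
  (fun b => C a *m nfclass E n0 N x b).
Proof.
apply/nfclass_eqP; first by apply: biderivation_act; apply: nfclass_biderivation.
by rewrite /nfclass !biderX; apply: nfrow_act.
Qed.

Lemma nfclass_inner0 x : inner E C (nfclass E n0 N x) -> x = 0.
Proof.
have [_ _ inj _] := presE.
move/(innerP (nfclass_biderivation x)); rewrite /nfclass biderX => x0.
apply/colP => i; rewrite mxE; apply: (inj _ (fun i => x i 0 : Kpt iota)).
by apply: vcong_trans x0; apply: vcong_refl => b k; rewrite rowseq_nfrow.
Qed.

Lemma nfclass_surj dl : biderivation E C dl -> exists x, ext_eq E C dl (nfclass E n0 N x).
Proof.
have [_ surj _ _] := presE.
move=> dlB; have [x fx] := surj _ _ (finsupp_rowseq (dl 'X)).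
exists (\col_i x i); apply/(ext_eqP dlB (nfclass_biderivation _)).
apply: vcong_trans fx _; apply: vcong_refl => b k; rewrite /nfclass biderX rowseq_nfrow.
by apply: eq_bigr => i _; rewrite mxE.
Qed.

Theorem represents_Ext1 : represents E C (Ext1 E C) X (nfclass E n0 N).
Proof.
split; [exact: nfclass_biderivation | exact: nfclassD | exact: nfclass_act
  | exact: nfclass_inner0 | exact: nfclass_surj].
Qed.

Hypothesis lieE : lie (E 'X) = theta%:M.

(** [Ext10] only asks for some representative with zero constant term; since constant coefficients
    are class invariants, every representative has it. *)
Lemma Ext10_coef0 dl : Ext10 E C dl -> lie (dl 'X) = 0.
Proof.
case=> dlB [dl' [dlB' /(ext_eqP dlB dlB')[U _ dlU] lie0]].
apply/matrixP => a b; rewrite (ord1 a) !mxE; have := dlU b 0%N.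
rewrite vinner_coef0 // /rowseq => /eqP; rewrite subr_eq0 => /eqP ->.
by have /matrixP/(_ 0 b) := lie0; rewrite !mxE.
Qed.

Lemma lie_nfrow x : lie (nfrow n0 N x) = (N 0 *m x)^T.
Proof.
apply/matrixP => a b; rewrite (ord1 a) !mxE.
have := rowseq_nfrow x b 0; rewrite /rowseq mxE => ->.
by apply: eq_bigr => i _; rewrite Kpt_tconst.
Qed.

(** The constant row of a normal form is given by [N 0 *m x], so Ext^1_0 is the kernel of [N 0], and
    [u] is a t-equivariant parametrization of that kernel. *)
Theorem represents_Ext10 m (Z : tmodule iota m) (u : 'M[Kt]_(n, m)) :
  tmorphism Z X u ->
  (forall z, kpt u z = 0 -> z = 0) ->
  (forall x, N 0 *m x = 0 <-> exists z, kpt u z = x) ->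
  represents E C (Ext10 E C) Z (fun z => nfclass E n0 N (kpt u z)).
Proof.
move=> uZ uinj ux; split=> [z|y z|a z|z|dl Sdl].
- split; first exact: nfclass_biderivation.
  exists (nfclass E n0 N (kpt u z)); split; try exact: nfclass_biderivation.
    by apply/(nfclass_eqP _ (nfclass_biderivation _)); rewrite /nfclass biderX; apply: rcong_refl.
  rewrite /nfclass biderX lie_nfrow (_ : _ *m _ = 0) ?trmx0 //.
  by apply/ux; exists z.
- by rewrite kptDr; apply: nfclassD.
- by rewrite -kptM uZ kptM; apply: nfclass_act.
- by move/nfclass_inner0; apply: uinj.
have [x dlx] := nfclass_surj (proj1 Sdl).
have /ux[z uz] : N 0 *m x = 0; last by exists z; rewrite uz.
apply: trmx_inj; rewrite -lie_nfrow trmx0.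
have <- : nfclass E n0 N x 'X = nfrow n0 N x by rewrite /nfclass biderX.
apply: Ext10_coef0; split; first exact: nfclass_biderivation.
exists dl; split; [exact: (proj1 Sdl)| |exact: Ext10_coef0].
have [dlB _] := Sdl; apply/(ext_eqP (nfclass_biderivation x) dlB).
by apply: vcong_sym; apply/(ext_eqP dlB (nfclass_biderivation x)).
Qed.

End Represents.

(* The matrix of the pullback is read off the normal form of the pullback of
   the generic class, whose coordinates are the unit vectors of Kt^n'. *)
Theorem pullback_matrix d n n0 (E : tmodule iota d) (X : tmodule iota n) N
    d' n' n0' (F : tmodule iota d') (X' : tmodule iota n') N' beta :
  presents E X n0 N -> presents F X' n0' N' -> tmorphism E F beta ->
  lie (E 'X) = theta%:M ->
  exists h : 'M[Kt]_(n, n'), [/\ tmorphism X' X h,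
    forall x, ext_eq E C (nfclass E n0 N (kpt h x))
                         (pullback (nfclass F n0' N' x) beta)
    & map_mx tconst (N 0) *m h = map_mx tconst ((lie beta)^T *m N' 0)].
Proof.
move=> presE presF betaE lieE.
have [N0 surjE injE actE] := presE; have [N0' surjF injF actF] := presF.
pose V : lmodType Kt := 'rV[Kt]_n'.
pose xg (i : 'I_n') : V := delta_mx 0 i.
have fin_xg : finsupp (nform N' xg).
  exists n0' => b k le_k; apply: big1 => i _.
  by rewrite N0' // mxE rmorph0 scale0r.
have [y fy] := surjE V _ (finsupp_rmul beta fin_xg).
pose h := \matrix_(a, b) (y a 0 b); exists h; split.
(* Right multiplication by [X' 'X] moves the generic point to its image under X'_t. The pullback of
   that image has both [ev (y i)] and [vact (X 'X) y] as normal form coordinates; uniqueness over V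
   identifies them, which is h X'_t = X_t h. *)
- apply: tmorphismX; pose ev (v : V) : V := v *m X' 'X.
  have evD : {morph ev : v w / v + w} by move=> v w; apply: mulmxDl.
  have evZ a v : ev (a *: v) = a *: ev v by rewrite /ev -scalemxAl.
  have evx i : ev (xg i) = vact (X' 'X) xg i.
    rewrite /ev -rowE; apply/rowP => j; rewrite /vact summxE (bigD1 j) //= big1.
      by rewrite !mxE !eqxx mulr1 addr0.
    by move=> k nkj; rewrite !mxE [j == k]eq_sym (negPf nkj) andbF mulr0.
  have evy i : ev (y i) - vact (X 'X) y i = 0.
    apply: (injE V (fun i => ev (y i) - vact (X 'X) y i)).
    have z0 : vcong E (fun b k => lcarlitz (nform N y) b k - lcarlitz (nform N y) b k)
                      (fun _ _ => 0).
      by apply: vcong_refl => b k; rewrite subrr.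
    apply: vcong_trans z0; apply: (vcong_trans (g := fun b k =>
      nform N (fun i => ev (y i)) b k - nform N (vact (X 'X) y) b k)).
      by apply: vcong_refl => b k; rewrite nformB.
    apply: vcongB; last exact/vcong_sym/actE.
    apply: (@vcong_trans _ _ _ _ _ _ _ (rmul (nform N' (vact (X' 'X) xg)) beta)).
      apply: vcong_sym; apply: (vcong_trans _ (vcong_trans (ev_vcong evD evZ fy) _)).
        apply: vcong_refl => b k; rewrite (ev_rmul evD evZ); apply: eq_rmul => c l.
        by rewrite (ev_nform evD evZ); apply: eq_bigr => j _; rewrite evx.
      by apply: vcong_refl => b k; rewrite (ev_nform evD evZ).
    apply: (vcong_trans (vcong_pullback betaE (vcong_sym (actF V xg)))).
    apply: (@vcong_trans _ _ _ _ _ _ _ (lcarlitz (rmul (nform N' xg) beta))).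
      by apply: vcong_refl => b k; rewrite lcarlitz_rmul.
    exact: vcong_lcarlitz.
  apply/row_matrixP => i; rewrite row_mul.
  have -> : row i h = y i by apply/rowP => j; rewrite !mxE.
  have /eqP := evy i; rewrite subr_eq0 => /eqP; rewrite /ev => ->.
  apply/rowP => j; rewrite /vact summxE !mxE; apply: eq_bigr => k _.
  by rewrite !mxE.
(* Evaluation at [x] is the K{tau}-linear map to K that sends the generic point to [x], and the
   coordinates [y] to those of [kpt h x]. *)
- move=> x; pose ev (v : V) : Kpt iota := \sum_b v 0 b *: (x b 0 : Kpt iota).
  have evD : {morph ev : v w / v + w}.
    by move=> v w; rewrite /ev -big_split; apply: eq_bigr => b _; rewrite mxE scalerDl.
  have evZ a v : ev (a *: v) = a *: ev v.
    by rewrite /ev scaler_sumr; apply: eq_bigr => b _; rewrite mxE scalerA.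
  have evx i : ev (xg i) = x i 0.
    rewrite /ev (bigD1 i) //= big1 => [|b /negPf nbi]; first by rewrite mxE !eqxx scale1r addr0.
    by rewrite mxE nbi scale0r.
  have evy i : ev (y i) = kpt h x i 0.
    by rewrite kptE; apply: eq_bigr => b _; rewrite mxE.
  apply/nfclass_eqP.
    by apply: (biderivation_pullback _ betaE); apply: nfclass_biderivation.
  rewrite /pullback /nfclass biderX; apply: rcong_sym; apply/rcongP.
  have := ev_vcong evD evZ fy => evf.
  apply: (vcong_trans _ (vcong_trans evf _)).
    apply: vcong_refl => b k; rewrite rowseq_mul (ev_rmul evD evZ).
    apply: eq_rmul => c l; rewrite (ev_nform evD evZ) (rowseq_nfrow presF).
    by apply: eq_bigr => i _; rewrite evx.
  apply: vcong_refl => b k; rewrite (ev_nform evD evZ) (rowseq_nfrow presE).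
  by apply: eq_bigr => i _; rewrite evy.
(* Inner rows have no constant term, so comparing coefficients of tau^0 shows how h acts on the
   quotients by Ext^1_0. *)
case: fy => U _ /(_ _ 0%N) fy; apply/row_matrixP => b.
have /eqP := fy b; rewrite vinner_coef0 // subr_eq0 => /eqP fyb.
have -> : row b (map_mx tconst (N 0) *m h) = nform N y b 0.
  apply/rowP => j; rewrite /nform summxE !mxE; apply: eq_bigr => i _.
  by rewrite !mxE.
rewrite -fyb; apply/rowP => j; rewrite /rmul summxE !mxE rmorph_sum.
apply: eq_bigr => c _; rewrite big_ord1 subn0 frob0n !mxE rmorphM; congr (_ * _).
rewrite /nform summxE (bigD1 j) //= big1 => [|i nij].
  by rewrite !mxE !eqxx mulr1 addr0.
by rewrite !mxE eq_sym (negPf nij) andbF mulr0.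
Qed.

End Presentations.

(** * Extensions of a Drinfeld module by the Carlitz module *)

Section DrinfeldExt.

Variables (Fq : finFieldType) (K : fieldType).
Variable iota : {rmorphism {poly Fq} -> K}.
Local Notation Kt := (Ktau iota).
Local Notation frob := (@frob Fq K).
Local Notation theta := (theta iota).

Section Coordinates.

Variable V : lmodType Kt.

(* Coordinates indexed by nat, with value 0 from r on. *)
Definition ncoord r (x : 'I_r -> V) (k : nat) : V := \sum_(i < r | i == k :> nat) x i.

Lemma ncoord_ord r (x : 'I_r -> V) (i : 'I_r) : ncoord x i = x i.
Proof. by rewrite /ncoord (big_pred1 i) // => j; rewrite -val_eqE. Qed.

Lemma ncoord_ge r (x : 'I_r -> V) k : (r <= k)%N -> ncoord x k = 0.
Proof.
move=> le_rk; apply: big_pred0 => i; apply/negbTE; rewrite neq_ltn.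
by rewrite (leq_trans (ltn_ord i)).
Qed.

Lemma ncoord_sum r (x : 'I_r -> V) (a : Kt) k :
  \sum_(j < r) (if j == k :> nat then a else 0) *: x j = a *: ncoord x k.
Proof.
rewrite scaler_sumr [RHS]big_mkcond; apply: eq_bigr => j _.
by case: ifP => // _; rewrite scale0r.
Qed.

End Coordinates.

(** The last column contains the correction for x_(r-1) tau^(r-1): C_t lifts this term to degree r,
    and subtracting the inner row of U = (tau x_(r-1)) / a_r brings it down. The terms in a_i / a_r
    come from U E_t, the tau^2 in row 1 from C_t U. Deleting row and column 0 leaves the
    Cartier-Taguchi matrix. *)
Definition ext_mx (r : nat) (E : tmodule iota 1) : 'M[Kt]_r :=
  \matrix_(i, j)
    ((if j == i :> nat then tconst theta else 0)
     + (if j.+1 == i :> nat then tau else 0)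
     + (if (0 < i)%N && (j.+1 == r)
        then - (tconst (dcoef E i / dcoef E r) * tau) else 0)
     + (if (i == 1%N :> nat) && (j.+1 == r)
        then tconst (dcoef E r ^+ #|Fq|)^-1 * tau ^+ 2 else 0)).

Fact ext_lie r E : lie (ext_mx r E) = theta%:M.
Proof.
have t0 a : tcoef (tconst a * tau : Kt) 0 = 0 by rewrite tcoef_Mtau.
have t2 a : tcoef (tconst a * tau ^+ 2 : Kt) 0 = 0.
  by rewrite expr2 mulrA tcoef_Mtau.
have t1 : tcoef (tau : Kt) 0 = 0 by rewrite /tcoef coefX.
apply/matrixP => i j; rewrite !mxE !tcoef_add.
rewrite !(fun_if (fun f : Kt => tcoef f 0)) tcoefN t0 t2 t1 tcoef_const tcoef0.
by rewrite oppr0 !if_same !addr0 -val_eqE eq_sym; case: eqP.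
Qed.

Definition ext_tmodule r E : tmodule iota r := tmodule_of (ext_lie r E).

Definition unitrows r (k : nat) : 'M[K]_(1, r) := \row_i (i == k :> nat)%:R.

(** A nilpotent 1 x 1 matrix over a field vanishes. *)
Lemma lie_dim1 (E : tmodule iota 1) : lie (E 'X) = theta%:M.
Proof.
have [m] := tact_lie E; set N := _ - _ => nilN.
have N00 k : (N ^+ k) 0 0 = N 0 0 ^+ k.
  elim: k => [|k IHk]; first by rewrite !expr0 !mxE.
  by rewrite !exprS mxE big_ord1 IHk.
have /eqP : N 0 0 ^+ m = 0 by rewrite -N00 nilN mxE.
rewrite expf_eq0 => /andP[_ /eqP N0]; apply/eqP; rewrite -subr_eq0 -/N.
by apply/eqP/matrixP => i j; rewrite (ord1 i) (ord1 j) N0 mxE.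
Qed.

Lemma dcoef0 (E : tmodule iota 1) : dcoef E 0 = theta.
Proof. by have /matrixP/(_ 0 0) := lie_dim1 E; rewrite !mxE eqxx mulr1n. Qed.

Section Presentation.

Variables (r : nat) (E : tmodule iota 1).
Hypotheses (le2r : (2 <= r)%N) (rkE : drinfeld_of_rank r E).

Lemma dcoef_lead : dcoef E r != 0.
Proof.
have [_ sz] := rkE; rewrite /dcoef /tcoef.
by rewrite -[r]/(r.+1.-1) -sz -/(lead_coef _) lead_coef_eq0 -size_poly_eq0 sz.
Qed.

Lemma dcoef_gt k : (r < k)%N -> dcoef E k = 0.
Proof. by have [_ sz] := rkE; move=> lt_rk; rewrite /dcoef /tcoef nth_default ?sz. Qed.

Variable V : lmodType Kt.

Definition vsingle d (m : nat) (v : 'I_d -> V) : vrow V d :=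
  fun b k => if k == m then v b else 0.

Lemma finsupp_vsingle d m (v : 'I_d -> V) : finsupp (vsingle m v).
Proof. by exists m.+1 => b k le_mk; rewrite /vsingle gtn_eqF. Qed.

Lemma vinner_dim1 (U : vrow V 1) b k : vinner E U b k =
  \sum_(l < k.+1) tconst (frob l (dcoef E (k - l))) *: U 0 l
    - (tconst theta *: U 0 k + (if k is k'.+1 then tau *: U 0 k' else 0)).
Proof. by rewrite (ord1 b) /vinner /rmul big_ord1. Qed.

Lemma vinner_vsingle m c b k : vinner E (vsingle m (fun _ => c)) b k =
  (if (m <= k)%N then tconst (frob m (dcoef E (k - m))) *: c else 0)
  - (tconst theta *: (if k == m then c else 0) + (if k == m.+1 then tau *: c else 0)).
Proof.
rewrite vinner_dim1 /vsingle; congr (_ - (_ + _)); last first.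
  by case: k => // k; rewrite eqSS; case: ifP; rewrite // scaler0.
have [le_mk|lt_km] := leqP m k.
  rewrite (bigD1 (inord m)) //= inordK // eqxx big1 ?addr0 // => l nl.
  case: eqP => [lm|_]; last by rewrite scaler0.
  by case/eqP: nl; apply: val_inj; rewrite /= inordK.
rewrite big1 // => l _; rewrite ltn_eqF ?scaler0 //.
by rewrite (leq_trans (ltn_ord l)).
Qed.

Lemma nform_unitrows (x : 'I_r -> V) b k : nform (unitrows r) x b k = ncoord x k.
Proof.
rewrite -[RHS]scale1r -ncoord_sum; apply: eq_bigr => i _.
by rewrite mxE; case: eqP; rewrite ?rmorph1 ?rmorph0.
Qed.

Lemma drinfeld_reduce (f : vrow V 1) : finsupp f ->
  exists x : 'I_r -> V, vcong E f (nform (unitrows r) x).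
Proof.
case=> n f0; suff [g g0 fg] : exists2 g : vrow V 1,
    forall b k, (r <= k)%N -> g b k = 0 & vcong E f g.
  exists (fun i : 'I_r => g 0 i); apply: vcong_trans fg (vcong_refl _ _) => b k.
  rewrite nform_unitrows (ord1 b); have [lt_kr|le_rk] := ltnP k r.
    by rewrite -[k]/(nat_of_ord (Ordinal lt_kr)) ncoord_ord.
  by rewrite ncoord_ge // g0.
elim: n f f0 => [|n IHn] f f0.
  by exists f; [move=> b k _; apply: f0 | apply: vcong_refl].
have [lt_nr|le_rn] := ltnP n r.
  by exists f; [move=> b k /(leq_trans lt_nr); apply: f0 | apply: vcong_refl].
(* U = c tau^(n-r) cancels the coefficient of tau^n, as the leading term of U E_t is a_r^(q^(n-r)) c
   tau^n. Since r >= 2, C_t U has degree at most n-r+1 < n and does not interfere. *)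
pose c := tconst (frob (n - r) (dcoef E r))^-1 *: f 0 n.
pose W := vinner E (vsingle (n - r) (fun _ => c)).
have fin_g b k : (n <= k)%N -> f b k - W b k = 0.
  move=> le_nk; rewrite /W vinner_vsingle (leq_trans (leq_subr _ _) le_nk).
  rewrite (gtn_eqF (leq_trans _ le_nk)); last by rewrite ltn_subrL (leq_trans _ le2r) ?(leq_trans _ le_rn) // ltnW.
  rewrite (gtn_eqF (leq_trans _ le_nk)); last first.
    by rewrite -subSn // ltn_subLR ?leqW // ; rewrite -[n.+1]add1n ltn_add2r.
  rewrite scaler0 addr0 subr0 (ord1 b); move: le_nk; rewrite leq_eqVlt => /predU1P[<-|lt_nk].
    rewrite subKn // scalerA -rmorphM mulfV ?rmorph1 ?scale1r ?subrr //.
    by rewrite expf_neq0 // dcoef_lead.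
  rewrite f0 // dcoef_gt ?frob_zero ?rmorph0 ?scale0r ?subrr //.
  by rewrite ltn_subRL subnK.
have [g g0 gW] := IHn _ fin_g; exists g => //; apply: vcong_trans gW.
exists (vsingle (n - r) (fun _ => c)); first exact: finsupp_vsingle.
by move=> b k; rewrite opprB addrC subrK.
Qed.

(** If U has degree n, then U E_t has the term a_r^(q^n) U_n tau^(n+r), beyond the reach of C_t U
    and of normal forms; so U = 0. *)
Lemma drinfeld_nform_inj (x : 'I_r -> V) :
  vcong E (nform (unitrows r) x) (fun _ _ => 0) -> forall i, x i = 0.
Proof.
case=> U [n U0] xU.
have {}U0 b k : U b k = 0.
  elim: n U0 => [|n IHn] U0; first exact: U0.
  apply: IHn => {b}b {}k; rewrite leq_eqVlt => /predU1P[<-|]; last exact: U0.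
  have := xU 0 (n + r)%N; rewrite nform_unitrows ncoord_ge ?leq_addl // subrr.
  rewrite vinner_dim1; have lt_n : (n < n + r)%N by rewrite -[X in (X < _)%N]addn0 ltn_add2l ltnW.
  rewrite U0 // scaler0 add0r.
  have -> : (if (n + r)%N is k'.+1 then tau *: U 0 k' else 0) = 0.
    have : (n.+2 <= n + r)%N by rewrite -addn2 leq_add2l.
    by case: (n + r)%N => // k' lt_nk; rewrite U0 ?scaler0.
  rewrite subr0 (bigD1 (inord n)) //= inordK ?ltnS ?leq_addr // big1 => [|l].
    rewrite addKn addr0 => /(congr1 (fun v => tconst (frob n (dcoef E r))^-1 *: v)).
    rewrite scaler0 scalerA -rmorphM mulVf ?rmorph1 ?scale1r //; last first.
      by rewrite expf_neq0 // dcoef_lead.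
    by rewrite (ord1 b).
  rewrite -val_eqE /= inordK ?ltnS ?leq_addr // neq_ltn => /orP[lt_ln|lt_nl].
    by rewrite dcoef_gt ?frob_zero ?rmorph0 ?scale0r // ltn_subRL ltn_add2r.
  by rewrite U0 ?scaler0.
move=> i; rewrite -ncoord_ord -(nform_unitrows x 0) -[LHS]subr0 xU vinner_dim1.
rewrite U0 scaler0 add0r big1 => [|l _]; last by rewrite U0 scaler0.
by case: (nat_of_ord i) => [|j]; rewrite ?U0 ?scaler0 subrr.
Qed.

Lemma vact_ext (x : 'I_r -> V) (i : 'I_r) : vact (ext_mx r E) x i =
  tconst theta *: ncoord x i
  + (if nat_of_ord i is k'.+1 then tau *: ncoord x k' else 0)
  - (if (0 < i)%N then tconst (dcoef E i / dcoef E r) *: (tau *: ncoord x r.-1) else 0)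
  + (if i == 1%N :> nat then tconst (dcoef E r ^+ #|Fq|)^-1 *: (tau *: (tau *: ncoord x r.-1)) else 0).
Proof.
have lastE (j : 'I_r) : (j.+1 == r) = (j == r.-1 :> nat).
  by rewrite -[RHS]eqSS prednK // ltnW.
rewrite /vact; under eq_bigr do rewrite mxE !scalerDl.
rewrite !big_split /= ncoord_sum; congr (_ + _ + _ + _).
- case: (nat_of_ord i) => [|k]; first by rewrite big1 // => j _; rewrite scale0r.
  by rewrite ncoord_sum.
- case: (0 < i)%N; last by rewrite oppr0 big1 // => j _; rewrite scale0r.
  under eq_bigr do rewrite lastE.
  by rewrite ncoord_sum scalerA scaleNr.
- case: (i == 1%N :> nat); last by rewrite big1 // => j _; rewrite scale0r.
  under eq_bigr do rewrite lastE.
  by rewrite ncoord_sum !scalerA expr2 !mulrA.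
Qed.

Lemma drinfeld_nform_act (x : 'I_r -> V) :
  vcong E (lcarlitz (nform (unitrows r) x)) (nform (unitrows r) (vact (ext_tmodule r E 'X) x)).
Proof.
rewrite /ext_tmodule tmodule_ofX; set c := tau *: ncoord x r.-1.
pose c' := tconst (dcoef E r)^-1 *: c.
exists (vsingle 0 (fun _ => c')); first exact: finsupp_vsingle.
move=> b k; rewrite vinner_vsingle /lcarlitz !nform_unitrows subn0 frob0n /=.
have -> : (if k is k'.+1 then tau *: nform (unitrows r) x b k' else 0) =
          (if k is k'.+1 then tau *: ncoord x k' else 0).
  by case: k => // k; rewrite nform_unitrows.
have [lt_kr|] := ltnP k r.
  rewrite [ncoord (vact _ _) k](ncoord_ord _ (Ordinal lt_kr)) vact_ext /= -/c.
  case: k lt_kr => [|k] lt_kr.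
    by rewrite dcoef0 !addr0 !subr0 !subrr.
  rewrite scaler0 add0r eqSS opprD opprB addrA [X in X - _ = _]addrC subrK.
  rewrite /c' [tconst (dcoef E k.+1) *: _]scalerA -rmorphM; congr (_ - _); case: eqP => // _.
  by rewrite !scalerA tau_const exprVn.
(* In degree r, the term tau x_(r-1) produced by C_t cancels against a_r times [c']. *)
rewrite leq_eqVlt => /predU1P[<-|lt_rk].
  rewrite (ncoord_ge x) // (ncoord_ge _ (leqnn r)) scaler0 add0r subr0.
  rewrite (gtn_eqF (ltnW le2r)) (gtn_eqF le2r) scaler0 addr0 subr0.
  rewrite /c' scalerA -rmorphM mulfV ?dcoef_lead // rmorph1 scale1r /c.
  suff pred_r m : (0 < m)%N -> (if m is k'.+1 then tau *: ncoord x k' else 0)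
      = tau *: ncoord x m.-1 by apply: pred_r; apply: ltnW.
  by case: m.
rewrite !ncoord_ge ?(ltnW lt_rk) // scaler0 add0r subr0.
have lt1k := leq_trans le2r (ltnW lt_rk).
rewrite (gtn_eqF (ltnW lt1k)) (gtn_eqF lt1k) scaler0 addr0 subr0 dcoef_gt //.
rewrite rmorph0 scale0r; case: k lt_rk {lt1k} => // k le_rk.
by rewrite ncoord_ge ?scaler0.
Qed.

End Presentation.

Lemma drinfeld_presents r (E : tmodule iota 1) : (2 <= r)%N -> drinfeld_of_rank r E ->
  presents E (ext_tmodule r E) r (@unitrows r).
Proof.
move=> le2r rkE; split=> [k le_rk|V f|V x|V x].
- apply/matrixP => i j; rewrite !mxE ltn_eqF // (leq_trans _ le_rk) //.
- exact: drinfeld_reduce.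
- exact: drinfeld_nform_inj.
- exact: drinfeld_nform_act.
Qed.

End DrinfeldExt.

(** * Extensions of the Cartier-Taguchi dual by the Carlitz module *)

Section DualExt.

Variables (Fq : finFieldType) (K : fieldType).
Variable iota : {rmorphism {poly Fq} -> K}.
Local Notation Kt := (Ktau iota).
Local Notation frob := (@frob Fq K).
Local Notation theta := (theta iota).

(* The coordinate 0 is a_r times the coefficient of tau in the last entry of a
   normal form; the others are its constant coefficients. *)
Definition bidual_mx (r : nat) (E : tmodule iota 1) : 'M[Kt]_r :=
  \matrix_(i, j) ((if j == i :> nat then tconst theta else 0)
    + (if i == 0%N :> nat then
         \sum_(b < r | (j <= b)%N) tconst (dcoef E b.+1) * tau ^+ (b.+1 - j)
       else 0)).

Fact bidual_lie r E : lie (bidual_mx r E) = theta%:M.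
Proof.
apply/matrixP => i j; rewrite !mxE tcoef_add.
rewrite !(fun_if (fun f : Kt => tcoef f 0)) tcoef_const tcoef0 tcoef_sum.
rewrite [X in _ + (if _ then X else _)]big1 => [|b le_jb]; last first.
  by rewrite tcoef_const_tauX ltn_eqF // subn_gt0 ltnS.
by rewrite if_same addr0 -val_eqE eq_sym; case: eqP.
Qed.

Definition bidual_tmodule r E : tmodule iota r := tmodule_of (bidual_lie r E).

Definition bidual_nf (r : nat) (E : tmodule iota 1) (k : nat) : 'M[K]_(r.-1, r) :=
  \matrix_(b, i) (if k is k'.+1 then
    (if (k' == 0)%N && (b.+1 == r.-1) && (i == 0%N :> nat) then (dcoef E r)^-1 else 0)
    else (i == b.+1 :> nat)%:R).

Section Presentation.

Variables (n : nat) (E : tmodule iota 1).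
Local Notation d := n.+1.
Local Notation r := n.+2.
Hypothesis rkE : drinfeld_of_rank r E.
Local Notation Ed := (ctdual r E).
Local Notation a_r := (dcoef E r).
Variable V : lmodType Kt.

Let ar0 : a_r != 0. Proof. exact: dcoef_lead rkE. Qed.

Definition smul (f : nat -> V) (g : Kt) (k : nat) : V :=
  \sum_(l < k.+1) tconst (frob l (tcoef g (k - l))) *: f l.

Lemma smulD f g g' k : smul f (g + g') k = smul f g k + smul f g' k.
Proof.
rewrite /smul -big_split; apply: eq_bigr => l _ /=.
by rewrite tcoef_add (frob_add iota) rmorphD scalerDl.
Qed.

Lemma smul0 f k : smul f 0 k = 0.
Proof. by apply: big1 => l _; rewrite tcoef0 (frob_zero iota) rmorph0 scale0r. Qed.

Lemma smulN f g k : smul f (- g) k = - smul f g k.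
Proof. by apply: (addrI (smul f g k)); rewrite -smulD !subrr smul0. Qed.

Lemma smul_mono f a m k : smul f (tconst a * tau ^+ m) k =
  if (m <= k)%N then tconst (frob (k - m) a) *: f (k - m)%N else 0.
Proof.
rewrite /smul; under eq_bigr do rewrite tcoef_const_tauX.
have [le_mk|lt_km] := leqP m k; last first.
  apply: big1 => l _; rewrite ltn_eqF ?(frob_zero iota) ?rmorph0 ?scale0r //.
  exact: leq_ltn_trans (leq_subr _ _) lt_km.
have lt_k : (k - m < k.+1)%N by rewrite ltnS leq_subr.
rewrite (bigD1 (Ordinal lt_k)) //= subKn // eqxx big1 ?addr0 // => l nl.
case: eqP => [kl|_]; last by rewrite (frob_zero iota) rmorph0 scale0r.
by case/eqP: nl; apply: val_inj; rewrite /= -kl subKn // -ltnS.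
Qed.

Local Notation coord U c k := (ncoord (fun b => U b k) c).

(** Off the last column, D_t has theta on the diagonal, tau just below it and nothing else, so entry
    c of U D_t only involves U_c and U_(c+1). The recursion [chain] rests on this shape. *)
Lemma rmul_dual (U : vrow V d) (c : 'I_d) k : rmul U (Ed 'X) c k =
  tconst (frob k theta) *: U c k
  + (if k is k'.+1 then coord U c.+1 k' else 0)
  - (if c.+1 == d then
       (if k is k'.+1 then \sum_(b < d) tconst (frob k' (dcoef E b.+1 / a_r)) *: U b k' else 0)
     else 0)
  + (if c.+1 == d then
       (if k is k'.+2 then tconst (frob k' (a_r ^+ #|Fq|)^-1) *: coord U 0%N k' else 0)
     else 0).
Proof.
rewrite /ctdual tmodule_ofX.
transitivity (\sum_b smul (U b) (ctdual_mx r E b c) k); first by [].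
under eq_bigr do rewrite mxE !smulD.
rewrite !big_split /=; congr (_ + _ + _ + _).
- rewrite (bigD1 c) //= eqxx big1 => [|b /negPf->]; last by rewrite smul0.
  by rewrite addr0 -[tconst _]mulr1 -(expr0 tau) smul_mono subn0.
- case: k => [|k].
    apply: big1 => b _; case: ifP => _; rewrite ?smul0 //.
    by have := smul_mono (U b) 1 1 0; rewrite rmorph1 mul1r.
  rewrite -[RHS]scale1r -ncoord_sum; apply: eq_bigr => b _.
  case: ifP => _; rewrite ?smul0 ?scale0r // scale1r.
  have := smul_mono (U b) 1 1 k.+1; rewrite rmorph1 mul1r expr1 => ->.
  by rewrite subn1 frob_one rmorph1 scale1r.
- case: eqP => _; last by rewrite oppr0 big1 // => b _; rewrite smul0.
  have tE (b : 'I_d) : smul (U b) (- (tconst (dcoef E b.+1 / a_r) * tau)) k =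
      - (if k is k'.+1 then tconst (frob k' (dcoef E b.+1 / a_r)) *: U b k' else 0).
    rewrite smulN -(expr1 (tau : Kt)) smul_mono; congr (- _).
    by case: k => // k; rewrite subn1.
  under eq_bigr => b _ do rewrite tE.
  rewrite sumrN; congr (- _); case: k {tE} => // *; exact: big1.
- case: eqP => _; last by rewrite big1 // => b _; rewrite andbF smul0.
  have tE (b : 'I_d) : smul (U b) (if (b == 0%N :> nat) && true then
      tconst (a_r ^+ #|Fq|)^-1 * tau ^+ 2 else 0) k =
      (if k is k'.+2 then (if b == 0%N :> nat then tconst (frob k' (a_r ^+ #|Fq|)^-1) else 0) *: U b k' else 0).
    rewrite andbT; case: ifP => _; last by rewrite smul0; case: k => [|[|k]]; rewrite ?scale0r.
    by rewrite smul_mono; case: k => [|[|k]] //; rewrite subn2.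
  under eq_bigr => b _ do rewrite tE.
  case: k {tE} => [|[|k]]; try exact: big1.
  by rewrite ncoord_sum.
Qed.

Lemma nform_bidual (x : 'I_r -> V) (b : 'I_d) k : nform (bidual_nf r E) x b k =
  match k with
  | 0 => ncoord x b.+1
  | 1 => if b.+1 == d then tconst a_r^-1 *: ncoord x 0 else 0
  | _ => 0
  end.
Proof.
case: k => [|[|k]].
- rewrite -[RHS]scale1r -ncoord_sum; apply: eq_bigr => i _; rewrite mxE.
  by case: ifP => _; rewrite ?rmorph1 ?rmorph0.
- case: ifP => bd.
    rewrite -ncoord_sum; apply: eq_bigr => i _; rewrite mxE /= bd /=.
    by case: ifP; rewrite ?rmorph0.
  by apply: big1 => i _; rewrite mxE /= bd rmorph0 scale0r.
- by apply: big1 => i _; rewrite mxE /= rmorph0 scale0r.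
Qed.

(* Once the first entry u of U is given, the remaining ones are forced by
   prescribing the nonconstant coefficients f of all entries but the last. *)
Fixpoint chain (f : vrow V d) (u : nat -> V) (j : nat) : nat -> V :=
  if j is j'.+1 then fun k =>
    tau *: chain f u j' k
    + tconst (theta - frob k.+1 theta) *: chain f u j' k.+1 + coord f j' k.+1
  else u.

(** Degree k of an entry uses the preceding entry only in degrees k and k+1, so supports do not grow
    along the chain. *)
Lemma chain0 f u j m : (forall b k, (m <= k)%N -> f b k = 0) ->
  (forall k, (m <= k)%N -> u k = 0) -> forall k, (m <= k)%N -> chain f u j k = 0.
Proof.
move=> f0 u0; elim: j => // j IHj k le_mk /=; rewrite !IHj ?scaler0 ?(leqW le_mk) //.
by rewrite !add0r; apply: big1 => b _; apply: f0; apply: leqW.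
Qed.

Definition chain_row f u : vrow V d := fun b k => chain f u b k.

Lemma coord_chain f u c k : (c < d)%N -> coord (chain_row f u) c k = chain f u c k.
Proof. by move=> lt_cd; rewrite -[c]/(nat_of_ord (Ordinal lt_cd)) ncoord_ord. Qed.

Lemma vinner_chain f u (c : 'I_d) k : (c.+1 < d)%N ->
  vinner Ed (chain_row f u) c k.+1 = f c k.+1.
Proof.
move=> lt_cd; rewrite /vinner rmul_dual (ltn_eqF lt_cd) subr0 addr0 coord_chain //.
rewrite /lcarlitz /= [X in _ + X - _](_ : _ = tau *: chain_row f u c k
   + tconst (theta - frob k.+1 theta) *: chain_row f u c k.+1 + f c k.+1); last first.
  by rewrite /= ncoord_ord.
rewrite rmorphB scalerBl /= -/(chain_row f u c k) -/(chain_row f u c k.+1).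
have abel (Q T P F : V) : Q + (T + (P - Q) + F) - (P + T) = F; last exact: abel.
rewrite [T + _]addrC -[_ + T + F]addrA [Q + _]addrA [Q + (P - Q)]addrC subrK.
by rewrite [P + (T + F)]addrA [P + T + F]addrC addrK.
Qed.

Definition last_col : 'I_d := ord_max.

(** The chain starts at u = 0 here; the freedom in u is kept for lowering the degree of the last
    entry. *)
Lemma dual_normalize (f : vrow V d) : finsupp f -> exists2 g : vrow V d,
  vcong Ed f g & finsupp g /\ forall (c : 'I_d) k, (c.+1 < d)%N -> g c k.+1 = 0.
Proof.
case=> m f0; pose U := chain_row f (fun _ => 0).
have U0 : finsupp U by exists m => b k le_mk; apply: chain0 le_mk.
exists (fun b k => f b k - vinner Ed U b k).
  by exists U => // b k; rewrite opprB addrC subrK.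
split=> [|c k lt_cd]; last by rewrite vinner_chain // subrr.
apply: finsuppB; first by exists m.
by apply: finsuppB; [apply: finsupp_rmul | apply: finsupp_lcarlitz].
Qed.

Lemma dual_reduce (f : vrow V d) : finsupp f ->
  exists x : 'I_r -> V, vcong Ed f (nform (bidual_nf r E) x).
Proof.
move=> /dual_normalize[g fg [[m g0] gc]].
suff [x gx] : exists x : 'I_r -> V, vcong Ed g (nform (bidual_nf r E) x).
  by exists x; apply: vcong_trans fg gx.
elim: m g g0 gc {f fg} => [|m IHm] f f0 fc.
  exists (fun _ => 0); apply: vcong_refl => b k; rewrite f0 //.
  by rewrite [RHS]big1 // => i _; rewrite scaler0.
have [lt_m2|le2m] := ltnP m 2.
  (* Only degrees 0 and 1 remain; the factor a_r undoes the a_r^-1 in [bidual_nf]. *)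
  exists (fun i => if i == 0%N :> nat then tconst a_r *: f last_col 1%N
                   else coord f i.-1 0%N).
  apply: vcong_refl => b [|[|k]]; rewrite nform_bidual.
  - by have := ncoord_ord (fun i : 'I_r => if i == 0%N :> nat then _ else coord f i.-1 0%N) (lift ord0 b) => ->; rewrite /= ncoord_ord.
  - have := ncoord_ord (fun i : 'I_r => if i == 0%N :> nat then
      tconst a_r *: f last_col 1%N else coord f i.-1 0%N) ord0 => /= ->.
    case: eqP => [bd|/eqP bd].
      rewrite scalerA -rmorphM mulVf // rmorph1 scale1r.
      by congr (f _ _); apply: val_inj; case: bd.
    by apply: fc; rewrite ltn_neqAle bd ltn_ord.
  - by apply: f0; rewrite (leq_trans lt_m2).
(* In the last entry, the only part of U D_t - C_t U reaching degree m comes from u a_r^(-q) tau^2,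
   so u is placed in degree m - 2 and solved for. The chain with zero data fills in the rest of U
   without touching nonconstant coefficients elsewhere. *)
pose u k := if k == (m - 2)%N then tconst (frob (m - 2) (a_r ^+ #|Fq|)) *: f last_col m else 0.
have u0 k : (m.-1 <= k)%N -> u k = 0.
  move=> le_mk; rewrite /u gtn_eqF // (leq_trans _ le_mk) //.
  by rewrite subn2 -!subn1 ltn_subrL; case: m le2m {f0 le_mk IHm u} => [|[]].
pose U := chain_row (fun _ _ => 0) u.
have U0 b k : (m.-1 <= k)%N -> U b k = 0 by apply: chain0.
have m_gt0 : (0 < m)%N by apply: leq_trans le2m.
have [|c k lt_cd|x gx] := IHm (fun b k => f b k - vinner Ed U b k).
- move=> b k le_mk.
  have k_gt0 : (0 < k)%N by apply: leq_trans le_mk.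
  case: (leqP d b.+1) => [le_db|lt_bd]; last first.
    case: k le_mk k_gt0 => // k _ _.
    by rewrite fc // vinner_chain // subrr.
  have bE : b = last_col.
    by apply: val_inj; apply/eqP; rewrite eqn_leq [(b <= _)%N]leq_ord.
  rewrite {}bE {b le_db}; suff -> : vinner Ed U last_col k = if m == k then f last_col m else 0.
    case: eqP => [->|/eqP nmk]; rewrite ?subrr //.
    by rewrite subr0 f0 // ltn_neqAle nmk.
  case: k le_mk k_gt0 => [|[|k]] // le_mk _; first by case: (m) le2m le_mk => [|[]].
  have le_mk1 : (m.-1 <= k.+1)%N by rewrite -ltnS prednK.
  rewrite /vinner rmul_dual eqxx /lcarlitz !U0 ?(leqW le_mk1) // !scaler0 addr0 subr0.
  rewrite ncoord_ge // !add0r big1 => [|b _]; last by rewrite U0 ?scaler0.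
  rewrite oppr0 add0r coord_chain //= /u; case: (eqVneq m k.+2) => [mk|nmk].
    rewrite mk subn2 /= eqxx scalerA -rmorphM -frob_mul mulVf ?frob_one ?rmorph1 ?scale1r //.
    by rewrite expf_neq0.
  rewrite ifN ?scaler0 //; apply: contra nmk => /eqP->.
  by rewrite -addn2 subnK.
- by rewrite fc // vinner_chain // subrr.
exists x; apply: vcong_trans gx; exists U; first by exists m.-1.
by move=> b k; rewrite opprB addrC subrK.
Qed.

(** Descent on the top degree m of U: in the last entry, degree m + 2 only sees the first entry of
    U, whose coefficient m therefore vanishes, and the chain relation passes this on to the other
    entries. *)
Lemma dual_nform_inj (x : 'I_r -> V) :
  vcong Ed (nform (bidual_nf r E) x) (fun _ _ => 0) -> forall i, x i = 0.
Proof.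
case=> U [m U0] xU.
have stepU (c : 'I_d) k : (c.+1 < d)%N -> coord U c.+1 k =
    tau *: U c k + tconst (theta - frob k.+1 theta) *: U c k.+1.
  move=> lt_cd; have := xU c k.+1.
  have -> : nform (bidual_nf r E) x c k.+1 = 0.
    by rewrite nform_bidual (ltn_eqF lt_cd); case: (k).
  rewrite subr0 /vinner rmul_dual (ltn_eqF lt_cd) subr0 addr0 /lcarlitz => /esym/eqP.
  rewrite subr_eq0 => /eqP; rewrite addrC => /(canRL (addrK _)) ->.
  by rewrite rmorphB scalerBl addrAC [_ + tau *: _]addrC.
have {}U0 b k : U b k = 0.
  elim: m U0 b k => [|m IHm] U0; first by move=> b k; apply: U0.
  apply: IHm => b k; rewrite leq_eqVlt => /predU1P[<-{k}|]; last exact: U0.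
  have U00 : coord U 0%N m = 0.
    have := xU last_col m.+2; rewrite nform_bidual subrr /vinner rmul_dual eqxx.
    rewrite /lcarlitz !U0 // !scaler0 ncoord_ge // !add0r subr0 big1 ?oppr0 ?add0r.
      move=> /(congr1 (fun v => tconst (frob m (a_r ^+ #|Fq|)) *: v)).
      rewrite scaler0 scalerA -rmorphM -frob_mul mulfV ?frob_one ?rmorph1 ?scale1r //.
      by rewrite expf_neq0.
    by move=> b' _; rewrite U0 ?scaler0.
  suff cU c : (c < d)%N -> coord U c m = 0 by rewrite -(ncoord_ord (fun b => U b m)) cU.
  elim: c => // c IHc lt_cd; have lt_cd' := ltnW lt_cd.
  rewrite (stepU (Ordinal lt_cd')) // (U0 _ m.+1) // scaler0 addr0.
  by rewrite -(ncoord_ord (fun b => U b m)) IHc ?scaler0.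
have nx0 b k : nform (bidual_nf r E) x b k = 0.
  rewrite -[LHS]subr0 xU -(vinner0 V Ed b k).
  by congr (_ - _); [apply: eq_rmul | apply: eq_lcarlitz].
move=> i; rewrite -ncoord_ord; case: (unliftP ord0 i) => [b|] ->.
  by have := nx0 b 0%N; rewrite nform_bidual.
have := nx0 last_col 1%N; rewrite nform_bidual eqxx.
move=> /(congr1 (fun v => tconst a_r *: v)).
by rewrite scaler0 scalerA -rmorphM mulfV // rmorph1 scale1r.
Qed.

(** The entries of a U concentrated in degree 0 that reduces C_t times a normal form. Degree 2 of
    the last entry forces U_0 = tau x_0, degree 1 of the others U_(j+1) = tau (U_j + x_(j+1)). The
    value at j = r - 1 lies beyond the entries of U, yet appears with the factor a_r in the
    result. *)
Fixpoint bichain (x : 'I_r -> V) (j : nat) : V :=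
  tau *: (if j is j'.+1 then bichain x j' + ncoord x j else ncoord x 0).

Lemma bichainE x j : bichain x j =
  \sum_(i < j.+1) tau ^+ (j.+1 - i) *: ncoord x i.
Proof.
elim: j => [|j IHj]; first by rewrite big_ord1 subn0 expr1.
rewrite big_ord_recr /= subSnn expr1 IHj scalerDr scaler_sumr; congr (_ + _).
by apply: eq_bigr => i _; rewrite scalerA -exprS (subSn (ltnW (ltn_ord i))).
Qed.

(** If only x_0 is nonzero, [bichain x b] is tau^(b+1) x_0 and row 0 becomes E_t x_0: this is how E
    reappears. *)
Lemma vact_bidual (x : 'I_r -> V) (i : 'I_r) : vact (bidual_mx r E) x i =
  tconst theta *: ncoord x i
  + (if i == 0%N :> nat then \sum_(b < r) tconst (dcoef E b.+1) *: bichain x b else 0).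
Proof.
rewrite /vact; under eq_bigr do rewrite mxE scalerDl.
rewrite big_split /= ncoord_sum; congr (_ + _).
case: (i == 0%N :> nat); last by rewrite big1 // => j _; rewrite scale0r.
under eq_bigr do rewrite scaler_suml.
rewrite (exchange_big_dep predT) //=; apply: eq_bigr => b _.
rewrite bichainE scaler_sumr.
rewrite (big_ord_widen r (fun j => tconst (dcoef E b.+1) *: (tau ^+ (b.+1 - j) *: ncoord x j))) //.
by apply: eq_big => [j|j _]; rewrite ?ltnS // scalerA ncoord_ord.
Qed.

Lemma dual_nform_act (x : 'I_r -> V) :
  vcong Ed (lcarlitz (nform (bidual_nf r E) x))
    (nform (bidual_nf r E) (vact (bidual_tmodule r E 'X) x)).
Proof.
rewrite /bidual_tmodule tmodule_ofX.
pose U : vrow V d := fun b k => if k == 0%N then bichain x b else 0.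
exists U; first by exists 1%N => b [].
have cU c : (c < d)%N -> coord U c 0%N = bichain x c.
  by move=> lt_cd; rewrite -[c in LHS]/(nat_of_ord (Ordinal lt_cd)) ncoord_ord.
have U0 b k : U b k.+1 = 0 by [].
have cU0 c k : coord U c k.+1 = 0 by apply: big1.
move=> b k; rewrite nform_bidual /lcarlitz nform_bidual /vinner rmul_dual /lcarlitz.
have vactE (i : 'I_r) : ncoord (vact (bidual_mx r E) x) i = _ := etrans (ncoord_ord _ i) (vact_bidual x i).
case: k => [|[|[|k]]] /=.
- rewrite (vactE (lift ord0 b)) /= !addr0 frob0n if_same subr0 addr0 !subrr.
  by [].
- rewrite nform_bidual (vactE ord0) /= !scaler0 !add0r if_same addr0.
  case: eqP => [bd|/eqP bd]; last first.
    rewrite scaler0 add0r !subr0 cU; last by rewrite ltn_neqAle bd ltn_ord.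
    by rewrite /= scalerDr addrAC subrr add0r.
  (* Last entry, degree 1: tau x_(r-1) and tau U_(r-2) combine to [bichain x] at r - 1, the summand
     of row 0 that carries a_r. *)
  rewrite [coord U b.+1 0%N]ncoord_ge ?bd // (scalerDr (tconst a_r^-1 : Kt)) big_ord_recr /=.
  have thC : tconst theta *: (tconst a_r^-1 *: ncoord x 0) = tconst a_r^-1 *: (tconst theta *: ncoord x 0).
    by rewrite !scalerA -!rmorphM mulrC.
  have arK (v : V) : tconst a_r^-1 *: (tconst a_r *: v) = v.
    by rewrite scalerA -rmorphM mulVf // rmorph1 scale1r.
  rewrite thC (scalerDr (tconst a_r^-1 : Kt)) arK.
  rewrite scalerDr [tconst a_r^-1 *: \sum_(i0 < d) _]scaler_sumr.
  have -> : \sum_(b0 < d) tconst (frob 0 (dcoef E b0.+1 / a_r)) *: U b0 0%N =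
            \sum_(b0 < d) tconst a_r^-1 *: (tconst (dcoef E b0.+1) *: bichain x b0).
    by apply: eq_bigr => b0 _; rewrite frob0n scalerA -rmorphM [a_r^-1 * _]mulrC.
  have -> : U b 0%N = bichain x n by case: bd => <-.
  have abel (P Q S T : V) : P + Q - (P + (S + (T + Q))) = 0 - S - T; last exact: abel.
  rewrite opprD addrACA subrr !add0r addrA opprD addrCA subrr addr0.
  exact: opprD.
- rewrite nform_bidual !U0 !cU0 big1 => [|b0 _]; last by rewrite U0 scaler0.
  rewrite !scaler0 if_same !add0r !subr0 ?add0r.
  rewrite oppr0 add0r cU // frob0n; case: eqP => _; last exact: scaler0.
  by rewrite /= !scalerA tau_const exprVn.
- rewrite nform_bidual !U0 !cU0 big1 => [|b0 _]; last by rewrite U0 scaler0.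
  by rewrite !scaler0 !if_same !addr0 !subr0 ?addr0.
Qed.

End Presentation.

Lemma dual_presents r (E : tmodule iota 1) : (2 <= r)%N -> drinfeld_of_rank r E ->
  presents (ctdual r E) (bidual_tmodule r E) 2 (bidual_nf r E).
Proof.
case: r => [|[|n]] // _ rkE; split=> [[|[|k]] // _|V f|V x|V x].
- by apply/matrixP => i j; rewrite !mxE.
- exact: dual_reduce.
- exact: dual_nform_inj.
- exact: dual_nform_act.
Qed.

End DualExt.

(** * Exact sequences and duality *)

Section ExactSequences.

Variables (Fq : finFieldType) (K : fieldType).
Variable iota : {rmorphism {poly Fq} -> K}.
Local Notation Kt := (Ktau iota).
Local Notation theta := (theta iota).
Local Notation C := (carlitz iota).

(** Together with [head_incl] this splits r coordinates into the first one and the rest; the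
    transposes are the projections. Both exact sequences use these matrices, with roles
    exchanged. *)
Definition tail_incl (r : nat) : 'M[Kt]_(r, r.-1) := \matrix_(i, j) (i == j.+1 :> nat)%:R.

Definition head_incl (r : nat) : 'M[Kt]_(r, 1) := \col_i (i == 0%N :> nat)%:R.

Section Size.

Variable n : nat.
Local Notation r := n.+2.

Lemma tail_inclM m (M : 'M[Kt]_(r.-1, m)) :
  tail_incl r *m M = \matrix_(i, j) (if unlift ord0 i is Some b then M b j else 0).
Proof.
apply/matrixP => i j; rewrite !mxE; case: unliftP => [b|] ->.
  rewrite (bigD1 b) //= big1 => [|c /negPf nbc]; first by rewrite !mxE /= eqxx mul1r addr0.
  by rewrite !mxE /= eqSS [_ == _ :> nat]eq_sym [_ == _ :> nat]nbc mul0r.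
by apply: big1 => c _; rewrite mxE mul0r.
Qed.

Lemma mul_tail_incl m (M : 'M[Kt]_(m, r)) :
  M *m tail_incl r = \matrix_(i, j) M i (lift ord0 j).
Proof.
apply/matrixP => i j; rewrite !mxE (bigD1 (lift ord0 j)) //= big1 => [|c /negPf nc].
  by rewrite !mxE /= eqxx mulr1 addr0.
by rewrite mxE [_ == _ :> nat]nc mulr0.
Qed.

Lemma head_inclTM m (M : 'M[Kt]_(r, m)) : (head_incl r)^T *m M = row ord0 M.
Proof.
apply/matrixP => i j; rewrite !mxE (bigD1 ord0) //= big1 => [|c /negPf nc].
  by rewrite !mxE mul1r addr0.
by rewrite !mxE [_ == _ :> nat]nc mul0r.
Qed.

Lemma mul_head_incl m (M : 'M[Kt]_(m, r)) : M *m head_incl r = col ord0 M.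
Proof.
apply/matrixP => i j; rewrite !mxE (bigD1 ord0) //= big1 => [|c /negPf nc].
  by rewrite !mxE mulr1 addr0.
by rewrite !mxE [_ == _ :> nat]nc mulr0.
Qed.

Lemma tail_inclTM m (M : 'M[Kt]_(r, m)) :
  (tail_incl r)^T *m M = \matrix_(i, j) M (lift ord0 i) j.
Proof.
apply/matrixP => i j; rewrite !mxE (bigD1 (lift ord0 i)) //= big1 => [|c /negPf nc].
  by rewrite !mxE /= eqxx mul1r addr0.
by rewrite !mxE [_ == _ :> nat]nc mul0r.
Qed.

Lemma tail_inclK : (tail_incl r)^T *m tail_incl r = 1%:M.
Proof.
rewrite tail_inclTM; apply/matrixP => i j.
by rewrite !mxE /= eqSS val_eqE; case: eqP.
Qed.

Lemma head_tail_incl : (head_incl r)^T *m tail_incl r = 0.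
Proof. by rewrite head_inclTM; apply/matrixP => i j; rewrite !mxE. Qed.

Lemma tail_head_decomp :
  tail_incl r *m (tail_incl r)^T = 1%:M - head_incl r *m (head_incl r)^T.
Proof.
rewrite tail_inclM; apply/matrixP => i j; rewrite !mxE big_ord1 !mxE.
case: unliftP => [b|] -> /=; rewrite -val_eqE /= ?mxE ?mul0r ?subr0 1?eq_sym.
  by case: eqP.
by rewrite mul1r eq_sym; case: eqP; rewrite subrr.
Qed.

Section Points.

Variables (A : comPzRingType) (i : {rmorphism K -> A}).

Lemma tev_bool (b : bool) x : tev i (b%:R : Kt) x = b%:R * x.
Proof.
case: b; rewrite /tev.
  by rewrite size_polyC oner_eq0 big_ord1 /tcoef coefC rmorph1 expn0 expr1.
by rewrite size_poly0 big_ord0 mul0r.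
Qed.

Lemma mxev_tail0 (x : 'cV[A]_(r.-1)) : mxev i (tail_incl r) x ord0 0 = 0.
Proof. by rewrite mxE big1 // => b _; rewrite mxE tev_bool mul0r. Qed.

Lemma mxev_tailS (x : 'cV[A]_(r.-1)) b : mxev i (tail_incl r) x (lift ord0 b) 0 = x b 0.
Proof.
rewrite mxE (bigD1 b) //= big1 => [|c /negPf nbc].
  by rewrite mxE tev_bool /= eqxx mul1r addr0.
by rewrite mxE tev_bool /= eqSS [_ == _ :> nat]eq_sym [_ == _ :> nat]nbc mul0r.
Qed.

Lemma mxev_tailT (y : 'cV[A]_r) b : mxev i (tail_incl r)^T y b 0 = y (lift ord0 b) 0.
Proof.
rewrite mxE (bigD1 (lift ord0 b)) //= big1 => [|c /negPf nc].
  by rewrite !mxE tev_bool /= eqxx mul1r addr0.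
by rewrite !mxE tev_bool [_ == _ :> nat]nc mul0r.
Qed.

Lemma mxev_head (x : 'cV[A]_1) a : mxev i (head_incl r) x a 0 = (a == 0%N :> nat)%:R * x 0 0.
Proof. by rewrite mxE big_ord1 mxE tev_bool. Qed.

Lemma mxev_headT (y : 'cV[A]_r) : mxev i (head_incl r)^T y 0 0 = y ord0 0.
Proof.
rewrite mxE (bigD1 ord0) //= big1 => [|c /negPf nc].
  by rewrite !mxE tev_bool mul1r addr0.
by rewrite !mxE tev_bool [_ == _ :> nat]nc mul0r.
Qed.

Lemma mxev_tail_inj : injective (mxev i (tail_incl r)).
Proof.
by move=> x y exy; apply/colP => b; rewrite -!mxev_tailS exy.
Qed.

Lemma mxev_head_inj : injective (mxev i (head_incl r)).
Proof.
move=> x y exy; apply/colP => b; rewrite (ord1 b).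
by have /colP/(_ ord0) := exy; rewrite !mxev_head !mul1r.
Qed.

Lemma mxev_ker_headT (y : 'cV[A]_r) :
  mxev i (head_incl r)^T y = 0 <-> exists x, mxev i (tail_incl r) x = y.
Proof.
split=> [y0|[x <-]]; last first.
  by apply/colP => b; rewrite (ord1 b) mxev_headT mxev_tail0 mxE.
exists (mxev i (tail_incl r)^T y); apply/colP => a; case: (unliftP ord0 a) => [b|] ->.
  by rewrite mxev_tailS mxev_tailT.
by rewrite mxev_tail0 -mxev_headT y0 mxE.
Qed.

Lemma mxev_ker_tailT (y : 'cV[A]_r) :
  mxev i (tail_incl r)^T y = 0 <-> exists x, mxev i (head_incl r) x = y.
Proof.
split=> [y0|[x <-]]; last first.
  by apply/colP => b; rewrite mxev_tailT mxev_head mul0r mxE.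
exists (mxev i (head_incl r)^T y); apply/colP => a; rewrite mxev_head mxev_headT.
case: (unliftP ord0 a) => [b|] ->; last exact: mul1r.
by rewrite mul0r -mxev_tailT y0 mxE.
Qed.

Lemma mxev_headT_surj z : exists y, mxev i (head_incl r)^T y = z.
Proof.
exists (mxev i (head_incl r) z); apply/colP => b.
by rewrite (ord1 b) mxev_headT mxev_head mul1r.
Qed.

Lemma mxev_tailT_surj z : exists y, mxev i (tail_incl r)^T y = z.
Proof.
exists (mxev i (tail_incl r) z); apply/colP => b.
by rewrite mxev_tailT mxev_tailS.
Qed.

End Points.

Lemma GaX m : Ga iota m 'X = (tconst theta)%:M.
Proof. exact: tmodule_ofX. Qed.

Lemma tail_incl_tmorphism E : tmorphism (ctdual r E) (ext_tmodule r E) (tail_incl r).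
Proof.
apply: tmorphismX; rewrite /ctdual /ext_tmodule !tmodule_ofX tail_inclM mul_tail_incl.
apply/matrixP => a j; rewrite !mxE; case: unliftP => [b|] -> /=.
  by rewrite mxE /= !eqSS [nat_of_ord j == b]eq_sym [j.+1 == b]eq_sym.
by rewrite !addr0.
Qed.

Lemma head_inclT_tmorphism E : tmorphism (ext_tmodule r E) (Ga iota 1) (head_incl r)^T.
Proof.
apply: tmorphismX; rewrite /ext_tmodule tmodule_ofX GaX head_inclTM mul_scalar_mx.
apply/matrixP => a j; rewrite !mxE /= !addr0.
by case: (_ == _); rewrite ?mulr1 ?mulr0.
Qed.

(** As algebraic groups the sequence splits by coordinates, so exactness holds on the points of any
    K-algebra; t enters only through the two morphism conditions. *)
Lemma ext_exact E : short_exact (ctdual r E) (ext_tmodule r E) (Ga iota 1)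
  (tail_incl r) (head_incl r)^T.
Proof.
split; [exact: tail_incl_tmorphism | exact: head_inclT_tmorphism | |].
  by move=> A i; split; [exact: mxev_tail_inj | exact: mxev_ker_headT].
by move=> L i z; exact: mxev_headT_surj.
Qed.

(** Column 0 of [bidual_mx] is E_t on top of zeros. *)
Lemma head_incl_tmorphism E : drinfeld_of_rank r E ->
  tmorphism E (bidual_tmodule r E) (head_incl r).
Proof.
move=> [_ sz]; apply: tmorphismX; rewrite /bidual_tmodule tmodule_ofX mul_head_incl.
apply/matrixP => a j; rewrite (ord1 j) [LHS]mxE big_ord1 !mxE.
case: (unliftP ord0 a) => [b|] -> /=; first by rewrite mul0r addr0.
rewrite mul1r {1}(Ktau_expand (eq_leq sz)) big_ord_recl expr0 mulr1.
by congr (_ + _); rewrite -(dcoef0 E).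
Qed.

Lemma tail_inclT_tmorphism E : tmorphism (bidual_tmodule r E) (Ga iota r.-1) (tail_incl r)^T.
Proof.
apply: tmorphismX; rewrite /bidual_tmodule tmodule_ofX GaX tail_inclTM mul_scalar_mx.
apply/matrixP => a j; rewrite !mxE /= addr0.
by case: (_ == _); rewrite ?mulr1 ?mulr0.
Qed.

Lemma bidual_exact E : drinfeld_of_rank r E ->
  short_exact E (bidual_tmodule r E) (Ga iota r.-1) (head_incl r) (tail_incl r)^T.
Proof.
move=> rkE; split; [exact: head_incl_tmorphism | exact: tail_inclT_tmorphism | |].
  by move=> A i; split; [exact: mxev_head_inj | exact: mxev_ker_tailT].
by move=> L i z; exact: mxev_tailT_surj.
Qed.

Lemma ctdual_represents E : drinfeld_of_rank r E ->
  represents E C (Ext10 E C) (ctdual r E)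
    (fun x => nfclass E r (@unitrows K r) (kpt (tail_incl r) x)).
Proof.
move=> rkE; apply: (represents_Ext10 (drinfeld_presents _ rkE)) => //.
- exact: lie_dim1.
- exact: tail_incl_tmorphism.
- move=> z z0; apply: (@mxev_tail_inj _ idfun); rewrite -/(kpt _ _) z0.
  apply/colP => a; case: (unliftP ord0 a) => [b|] ->; rewrite ?mxev_tailS ?mxev_tail0 ?mxE //.
move=> x; apply: iff_trans (mxev_ker_headT idfun x).
have <- : unitrows K r 0 *m x = mxev idfun (head_incl r)^T x; last by [].
apply/colP => b; rewrite (ord1 b) mxev_headT mxE (bigD1 ord0) //= big1.
  by rewrite mxE mul1r addr0.
by move=> c /negPf nc; rewrite mxE [_ == _ :> nat]nc mul0r.
Qed.

Lemma bidual_represents E : drinfeld_of_rank r E ->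
  represents (ctdual r E) C (Ext10 (ctdual r E) C) E
    (fun x => nfclass (ctdual r E) 2 (bidual_nf r E) (kpt (head_incl r) x)).
Proof.
move=> rkE; apply: (represents_Ext10 (dual_presents _ rkE)) => //.
- by rewrite /ctdual tmodule_ofX ctdual_lie.
- exact: head_incl_tmorphism.
- move=> z z0; apply: (@mxev_head_inj _ idfun); rewrite -/(kpt _ _) z0.
  by apply/colP => a; rewrite mxev_head !mxE mulr0.
move=> x; apply: iff_trans (mxev_ker_tailT idfun x).
have <- : bidual_nf r E 0 *m x = mxev idfun (tail_incl r)^T x; last by [].
apply/colP => b; rewrite mxev_tailT mxE (bigD1 (lift ord0 b)) //= big1.
  by rewrite mxE eqxx mul1r addr0.
by move=> c /negPf nc; rewrite mxE [_ == _ :> nat]nc mul0r.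
Qed.

End Size.

Lemma ext_pullback r s (E F : tmodule iota 1) (beta : 'M[Kt]_1) :
  (2 <= r)%N -> drinfeld_of_rank r E -> (2 <= s)%N -> drinfeld_of_rank s F ->
  tmorphism E F beta ->
  pullback_tmorphism E C beta (ext_tmodule s F) (nfclass F s (@unitrows K s))
    (ext_tmodule r E) (nfclass E r (@unitrows K r)).
Proof.
move=> le2r rkE le2s rkF betaE.
have [h [hE hx _]] := pullback_matrix (drinfeld_presents le2r rkE)
  (drinfeld_presents le2s rkF) betaE (lie_dim1 E).
by exists h.
Qed.

Lemma bidual_pullback r s (E F : tmodule iota 1) (gamma : 'M[Kt]_(r.-1, s.-1)) :
  (2 <= r)%N -> drinfeld_of_rank r E -> (2 <= s)%N -> drinfeld_of_rank s F ->
  tmorphism (ctdual s F) (ctdual r E) gamma ->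
  pullback_tmorphism (ctdual s F) C gamma
    (bidual_tmodule r E) (nfclass (ctdual r E) 2 (bidual_nf r E))
    (bidual_tmodule s F) (nfclass (ctdual s F) 2 (bidual_nf s F)).
Proof.
move=> le2r rkE le2s rkF gammaE.
have lieF : lie (ctdual s F 'X) = theta%:M by rewrite /ctdual tmodule_ofX ctdual_lie.
have [h [hE hx _]] := pullback_matrix (dual_presents le2s rkF)
  (dual_presents le2r rkE) gammaE lieF.
by exists h.
Qed.

(** Comparison of constant coefficients shows that the matrix h of the pullback on Ext^1 multiplies
    the head projection by Lie(beta). So h preserves the kernel of that projection, which is the
    image of the tail inclusion, and [h'] is its block there. *)
Lemma ctdual_pullback r s (E F : tmodule iota 1) (beta : 'M[Kt]_1) :
  (2 <= r)%N -> drinfeld_of_rank r E -> (2 <= s)%N -> drinfeld_of_rank s F ->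
  tmorphism E F beta ->
  pullback_tmorphism E C beta
    (ctdual s F) (fun x => nfclass F s (@unitrows K s) (kpt (tail_incl s) x))
    (ctdual r E) (fun x => nfclass E r (@unitrows K r) (kpt (tail_incl r) x)).
Proof.
move=> le2r rkE le2s rkF betaE.
have [h [hE hx h0]] := pullback_matrix (drinfeld_presents le2r rkE)
  (drinfeld_presents le2s rkF) betaE (lie_dim1 E).
case: r le2r rkE h hE hx h0 => [|[|m]] // _ rkE; case: s le2s rkF => [|[|n]] // _ rkF.
move=> h hE hx h0.
have headE k : map_mx tconst (unitrows K k.+2 0) = (head_incl k.+2)^T :> 'M[Kt]_(1, k.+2).
  by apply/matrixP => a b; rewrite !mxE; case: (_ == _); rewrite ?rmorph1 ?rmorph0.
pose h' := (tail_incl m.+2)^T *m h *m tail_incl n.+2.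
have head_h : (head_incl m.+2)^T *m h = map_mx tconst (lie beta)^T *m (head_incl n.+2)^T.
  by rewrite -headE h0 map_mxM headE.
have hh' : tail_incl m.+2 *m h' = h *m tail_incl n.+2.
  rewrite /h' !mulmxA tail_head_decomp mulmxBl mul1mx mulmxBl -(mulmxA _ _ h).
  by rewrite head_h -!mulmxA head_tail_incl !mulmx0 subr0.
exists h'; clearbody h'; split=> [|x].
  (* The transpose of [tail_incl] is a left inverse, so equivariance of [h'] may be tested after
     applying [tail_incl], where it follows from that of h. *)
  apply: tmorphismX; rewrite -[LHS]mul1mx -[RHS]mul1mx -tail_inclK -!mulmxA.
  congr (_ *m _); rewrite mulmxA hh' -mulmxA.
  by rewrite (@tail_incl_tmorphism n F 'X) mulmxA hE -mulmxA -hh' mulmxA -(@tail_incl_tmorphism m E 'X) -mulmxA.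
by rewrite -kptM hh' kptM; apply: hx.
Qed.

End ExactSequences.

(** * Exterior powers of free modules of corank one *)

Section Alternating.

Variables (R : comNzRingType) (n : nat) (M N : lmodType R).
Variable h : {ffun 'I_n -> M} -> N.
Hypothesis altH : alternating_multilinear h.

Lemma subst_at_id (m : {ffun 'I_n -> M}) i : subst_at m i (m i) = m.
Proof. by apply/ffunP => j; rewrite ffunE; case: eqP => // ->. Qed.

Lemma subst_atC (m : {ffun 'I_n -> M}) i j x y : i != j ->
  subst_at (subst_at m i x) j y = subst_at (subst_at m j y) i x.
Proof.
move=> nij; apply/ffunP => k; rewrite !ffunE.
by case: (eqVneq k j) => // ->; rewrite eq_sym (negPf nij).
Qed.

Lemma alt_subst0 m i : h (subst_at m i 0) = 0.
Proof.
have [hL _] := altH; have := hL m i 1 0 0; rewrite scaler0 addr0 scale1r => /eqP.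
by rewrite -subr_eq0 opprD addNKr oppr_eq0 => /eqP.
Qed.

Lemma alt_substD m i x y : h (subst_at m i (x + y)) = h (subst_at m i x) + h (subst_at m i y).
Proof. by have [hL _] := altH; have := hL m i 1 x y; rewrite !scale1r. Qed.

Lemma alt_substZ m i a x : h (subst_at m i (a *: x)) = a *: h (subst_at m i x).
Proof. by have [hL _] := altH; have := hL m i a x 0; rewrite alt_subst0 !addr0. Qed.

Lemma alt_subst_sum m i (I : Type) (s : seq I) (F : I -> M) :
  h (subst_at m i (\sum_(k <- s) F k)) = \sum_(k <- s) h (subst_at m i (F k)).
Proof.
exact: (big_morph (fun x => h (subst_at m i x)) (alt_substD m i) (alt_subst0 m i)).
Qed.

(** Polarization: expanding h with m i + m j in both places gives antisymmetry. *)
Lemma alt_tperm (m : {ffun 'I_n -> M}) i j : h [ffun k => m (tperm i j k)] = h m *~ (if i == j then 1 else -1).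
Proof.
case: (eqVneq i j) => [<-|nij].
  by rewrite mulr1z; congr h; apply/ffunP => k; rewrite ffunE tperm1 perm1.
pose g x y := h (subst_at (subst_at m i x) j y).
have g0 x : g x x = 0.
  have [_ h0] := altH; apply: (h0 _ i j nij).
  by rewrite !ffunE eqxx (negPf nij) eqxx.
have gDr x y z : g x (y + z) = g x y + g x z by apply: alt_substD.
have gDl x y z : g (x + y) z = g x z + g y z.
  by rewrite /g !(subst_atC _ _ _ nij) alt_substD.
have gC : g (m j) (m i) = - g (m i) (m j).
  have := g0 (m i + m j); rewrite gDr !gDl !g0 add0r addr0 => /eqP.
  by rewrite addr_eq0 => /eqP.
have <- : g (m i) (m j) = h m.
  rewrite /g; congr h; apply/ffunP => k; rewrite !ffunE.
  by case: eqP => [->|_] //; case: eqP => [->|].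
rewrite mulrNz mulr1z -gC /g; congr h; apply/ffunP => k; rewrite !ffunE.
case: tpermP => [->|->|/eqP/negPf-> /eqP/negPf->] //; last by rewrite eqxx.
by rewrite (negPf nij) eqxx.
Qed.

Lemma alt_perm0 m (s : {perm 'I_n}) : h m = 0 -> h [ffun k => m (s k)] = 0.
Proof.
have [ts -> _] := prod_tpermP s; elim: ts m => [|t ts IHts] m hm0.
  by rewrite big_nil -{}hm0; congr h; apply/ffunP => k; rewrite ffunE perm1.
rewrite big_cons.
have -> : [ffun k => m ((tperm t.1 t.2 * \prod_(i <- ts) tperm i.1 i.2)%g k)] =
    [ffun k => [ffun k' => m ((\prod_(i <- ts) tperm i.1 i.2)%g k')] (tperm t.1 t.2 k)].
  by apply/ffunP => k; rewrite !ffunE permM.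
by rewrite alt_tperm IHts // mul0rz.
Qed.

End Alternating.

(** By counting, an injection misses some index i, and [lift i] enumerates the others. *)
Lemma injective_lift n (f : 'I_n -> 'I_n.+1) : injective f ->
  exists (i : 'I_n.+1) (s : {perm 'I_n}), forall k, f k = lift i (s k).
Proof.
move=> injf.
have [i nfi] : exists i, i \notin codom f.
  apply/existsP; rewrite -negb_forall; apply/negP => /forallP im_f.
  have := card_codom injf; rewrite card_ord (eq_card (B := predT)) ?card_ord; last first.
    by move=> i; rewrite im_f.
  by move/eqP; rewrite gtn_eqF.
have nif k : i != f k by apply: contraNneq nfi => ->; apply: codom_f.
pose s k := s2val (unlift_some (nif k)).
have fE k : f k = lift i (s k) := s2valP (unlift_some (nif k)).
have injs : injective s by move=> k l skl; apply: injf; rewrite !fE skl.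
by exists i, (perm injs) => k; rewrite permE.
Qed.

Section FreeExterior.

Variables (R : comNzRingType) (n : nat) (M : lmodType R) (b : 'I_n.+1 -> M).

Lemma alt_eq0 (N : lmodType R) (h : {ffun 'I_n -> M} -> N) :
  alternating_multilinear h ->
  (forall m : M, exists c : 'I_n.+1 -> R, m = \sum_i c i *: b i) ->
  (forall i, h [ffun k => b (lift i k)] = 0) -> forall m, h m = 0.
Proof.
move=> altH spanb hb0.
have hb (f : 'I_n -> 'I_n.+1) : h [ffun k => b (f k)] = 0.
  have [/injectiveP injf|/injectivePn[k [l nkl fkl]]] := boolP (injectiveb f).
    have [i [s fE]] := injective_lift injf.
    rewrite -[RHS](alt_perm0 altH s (hb0 i)); congr h.
    by apply/ffunP => k; rewrite !ffunE fE.
  by have [_ h0] := altH; apply: (h0 _ _ _ nkl); rewrite !ffunE fkl.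
(* Arguments of index at least k are already basis vectors; expanding argument k in the basis
   reduces the case k + 1 to the case k. *)
suff hk k (m : {ffun 'I_n -> M}) (f : 'I_n -> 'I_n.+1) : (k <= n)%N ->
    (forall j : 'I_n, (k <= j)%N -> m j = b (f j)) -> h m = 0.
  by move=> m; apply: (hk n m (fun=> ord0)) => // j; rewrite leqNgt ltn_ord.
elim: k m f => [|k IHk] m f le_kn mf.
  rewrite -[RHS](hb f); congr h; apply/ffunP => j.
  by rewrite ffunE mf.
pose i := Ordinal le_kn; have [c mi] := spanb (m i).
rewrite -(subst_at_id m i) mi (alt_subst_sum altH) big1 // => j _.
rewrite (alt_substZ altH); set m' := subst_at _ _ _.
rewrite (IHk m' (fun l => if l == i then j else f l)) ?scaler0 ?(ltnW le_kn) // => l le_kl.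
rewrite ffunE; case: eqVneq => // nli; apply: mf.
by rewrite ltn_neqAle le_kl andbT eq_sym -[k]/(nat_of_ord i).
Qed.

Variables (P : lmodType R) (bP : 'I_n.+1 -> P).
Variables (cM : {linear M -> 'rV[R]_n.+1}) (cP : {linear P -> 'rV[R]_n.+1}).
Hypothesis cMb : forall i, cM (b i) = delta_mx 0 i.
Hypothesis cMK : forall m, m = \sum_i cM m 0 i *: b i.
Hypothesis cPb : forall i, cP (bP i) = delta_mx 0 i.
Hypothesis cPK : forall p, p = \sum_i cP p 0 i *: bP i.

(** The sign makes det [v; B] equal to the pairing of v with the vector of minors. *)
Definition minor (B : 'M[R]_(n, n.+1)) (i : 'I_n.+1) : R := (-1) ^+ i * \det (col' i B).

Definition coord_rows (m : {ffun 'I_n -> M}) : 'M[R]_(n, n.+1) := \matrix_k cM (m k).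

(** In this model [bP i] stands for (-1)^i times the wedge of all basis vectors except [b i]. *)
Definition wedge (m : {ffun 'I_n -> M}) : P :=
  \sum_i minor (coord_rows m) i *: bP i.

Lemma minor_alternating i :
  (forall m k a x y, minor (coord_rows (subst_at m k (a *: x + y))) i =
     a * minor (coord_rows (subst_at m k x)) i + minor (coord_rows (subst_at m k y)) i)
  /\ (forall (m : {ffun 'I_n -> M}) k l, k != l -> m k = m l -> minor (coord_rows m) i = 0).
Proof.
split=> [m k a x y|m k l nkl mkl]; rewrite /minor; last first.
  rewrite (determinant_alternate nkl) ?mulr0 // => j.
  by rewrite !mxE mkl.
rewrite (@determinant_multilinear _ _ _ (col' i (coord_rows (subst_at m k x)))
   (col' i (coord_rows (subst_at m k y))) k a 1).
- by rewrite mul1r mulrDr mulrCA.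
- by apply/rowP => j; rewrite !mxE !ffunE eqxx linearP mul1r !mxE.
- by apply/matrixP => p q; rewrite !mxE !ffunE eq_sym (negPf (neq_lift _ _)).
- by apply/matrixP => p q; rewrite !mxE !ffunE eq_sym (negPf (neq_lift _ _)).
Qed.

Lemma wedge_alternating : alternating_multilinear wedge.
Proof.
split=> [m k a x y|m k l nkl mkl].
  rewrite scaler_sumr -big_split; apply: eq_bigr => i _ /=.
  by have [-> _] := minor_alternating i; rewrite scalerDl scalerA.
apply: big1 => i _; have [_ min0] := minor_alternating i.
by rewrite (min0 m k l) ?scale0r.
Qed.

Lemma wedge_basis i : wedge [ffun k => b (lift i k)] = (-1) ^+ i *: bP i.
Proof.
have BE : coord_rows [ffun k => b (lift i k)] = row' i 1%:M.
  by apply/matrixP => k j; rewrite !mxE ffunE cMb mxE eqxx [j == _]eq_sym.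
(* The maximal minors of the identity with one row removed are, up to sign, cofactors of the
   identity, and these are read off from adj(1) = 1. *)
have adj1 : \adj (1%:M : 'M[R]_n.+1) = 1%:M by rewrite -[LHS]mul1mx mul_mx_adj det1.
have detE j : \det (col' j (row' i (1%:M : 'M[R]_n.+1))) = (i == j)%:R.
  have /matrixP/(_ j i) := adj1; rewrite !mxE /cofactor => /(congr1 (fun x => (-1) ^+ (i + j) * x)).
  rewrite mulrA -expr2 -exprM mulnC exprM sqrrN expr1n expr1n mul1r.
  have -> : row' i (col' j 1%:M) = col' j (row' i 1%:M) :> 'M[R]_n.
    by apply/matrixP => k l; rewrite !mxE.
  move=> ->; rewrite eq_sym; case: eqP => [->|_]; last by rewrite mulr0.
  by rewrite addnn -mul2n exprM sqrrN expr1n expr1n mulr1.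
rewrite /wedge BE (bigD1 i) //= big1 => [|j nji].
  by rewrite /minor detE eqxx mulr1 addr0.
by rewrite /minor detE eq_sym (negPf nji) mulr0 scale0r.
Qed.

Lemma wedge_exterior_power : exterior_power wedge.
Proof.
split; first exact: wedge_alternating.
(* [wedge_basis] dictates the values of g on [bP]. *)
move=> N f altf; pose g p : N := \sum_i (cP p 0 i * (-1) ^+ i) *: f [ffun k => b (lift i k)].
have g_linear : linear g.
  move=> a p q; rewrite scaler_sumr -big_split; apply: eq_bigr => i _ /=.
  by rewrite linearP !mxE mulrDl scalerDl scalerA mulrA.
pose gL : {linear P -> N} := HB.pack g (GRing.isLinear.Build R P N *:%R g g_linear).
have gb i : g (bP i) = (-1) ^+ i *: f [ffun k => b (lift i k)].
  rewrite /g (bigD1 i) //= big1 => [|j nji]; first by rewrite cPb mxE !eqxx mul1r addr0.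
  by rewrite cPb mxE (negPf nji) andbF mul0r scale0r.
have signK i (x : N) : (-1) ^+ i *: ((-1) ^+ i *: x) = x.
  by rewrite scalerA -exprMn mulrNN mulr1 expr1n scale1r.
exists gL; split=> [m|g' g'f p].
  apply/eqP; rewrite -subr_eq0; apply/eqP.
  (* The difference of two alternating maps is alternating, so it only has to vanish on tuples of
     distinct basis vectors. *)
  apply: (@alt_eq0 _ (fun m => gL (wedge m) - f m)) => [|x|i].
  - have [wL w0] := wedge_alternating; have [fL f0] := altf.
    split=> [x i a y z|x i j nij xij].
      by rewrite wL linearP fL scalerBr opprD addrACA.
    by rewrite (w0 _ _ _ nij xij) (f0 _ _ _ nij xij) linear0 subrr.
  - by exists (fun i => cM x 0 i); apply: cMK.
  - by rewrite wedge_basis linearZ /= gb signK subrr.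
rewrite [p in LHS]cPK [p in RHS]cPK !linear_sum; apply: eq_bigr => i _.
rewrite !linearZ /=; congr (_ *: _); rewrite gb -g'f wedge_basis linearZ /=.
by rewrite signK.
Qed.

End FreeExterior.

(** * Maximal minors of a product of matrices *)

Section Minors.

Variables (R : comNzRingType) (n : nat).

Lemma det_col_mx_minor (v : 'rV[R]_n.+1) (B : 'M[R]_(n, n.+1)) :
  \det (col_mx v B : 'M[R]_(1 + n)) = \sum_j v 0 j * minor B j.
Proof.
rewrite (expand_det_row _ (ord0 : 'I_(1 + n))); apply: eq_bigr => j _.
have -> : (ord0 : 'I_(1 + n)) = lshift n (ord0 : 'I_1) by apply: val_inj.
rewrite col_mxEu; congr (_ * _); rewrite /cofactor /= add0n; congr (_ * \det _).
apply/matrixP => k l; rewrite !mxE.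
have -> : lift (lshift n (ord0 : 'I_1)) k = rshift 1 k by apply: val_inj.
by case: split_ordP => [k' /eqP|k' /rshift_inj->] //; rewrite eq_rlshift.
Qed.

(* Expanding det [v; B] * det A = det [v A; B A] along the first row. *)
Lemma minor_mulmx (B : 'M[R]_(n, n.+1)) (A : 'M[R]_n.+1) (i : 'I_n.+1) :
  \sum_j A i j * minor (B *m A) j = \det A * minor B i.
Proof.
have rowE : delta_mx 0 i *m A = row i A :> 'rV[R]_n.+1 by rewrite rowE.
transitivity (\det (col_mx (delta_mx 0 i) B : 'M[R]_(1 + n)) * \det A).
  have := det_mulmx (col_mx (delta_mx 0 i) B : 'M[R]_(1 + n)) (A : 'M[R]_(1 + n)) => <-.
  rewrite mul_col_mx rowE det_col_mx_minor.
  by apply: eq_bigr => j _; rewrite mxE.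
rewrite mulrC det_col_mx_minor; congr (_ * _).
rewrite (bigD1 i) //= big1 => [|j nji]; first by rewrite mxE !eqxx mul1r addr0.
by rewrite mxE (negPf nji) andbF mul0r.
Qed.

Lemma map_minor (R' : comNzRingType) (f : {rmorphism R -> R'}) (B : 'M[R]_(n, n.+1)) i :
  minor (map_mx f B) i = f (minor B i).
Proof. by rewrite /minor rmorphM rmorph_sign -map_col' det_map_mx. Qed.

End Minors.

(** * Bases of t-motives *)

(** The argument iota is kept because additivity of x -> x^q rests on K containing Fq; this lets a
    ring morphism structure be attached. *)
Definition frob1 (Fq : finFieldType) (K : fieldType)
  (iota : {rmorphism {poly Fq} -> K}) : K -> K := @frob Fq K 1.

Section MotiveBasis.

Variables (Fq : finFieldType) (K : fieldType).
Variable iota : {rmorphism {poly Fq} -> K}.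
Local Notation Kt := (Ktau iota).
Local Notation frob := (@frob Fq K).

Fact frob1_is_additive : zmod_morphism (frob1 iota).
Proof.
move=> x y; rewrite /frob1 (frob_add iota); congr (_ + _).
by apply: (addrI (frob 1 y)); rewrite -(frob_add iota) !subrr (frob_zero iota).
Qed.

Fact frob1_is_monoid : monoid_morphism (frob1 iota).
Proof. by split=> [|x y]; rewrite /frob1 ?frob_one ?frob_mul. Qed.

HB.instance Definition _ := GRing.isZmodMorphism.Build K K (frob1 iota) frob1_is_additive.
HB.instance Definition _ := GRing.isMonoidMorphism.Build K K (frob1 iota) frob1_is_monoid.

Local Notation ftw := (map_poly (frob1 iota)).

Section Tau.

Variables (d : nat) (E : tmodule iota d).

Lemma motive_scaleX (m : motive E) : 'X *: m = (m : 'rV[Kt]_d) *m E 'X.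
Proof.
rewrite -['X]mul1r; exact: etrans (motive_scaleMX 1 m) (motive_scale1 _).
Qed.

Lemma motive_tauD : {morph (@motive_tau _ _ _ _ E) : m m' / m + m'}.
Proof. by move=> m m'; apply: (@scalerDr Kt 'rV[Kt]_d tau m m'). Qed.

Lemma motive_tauZ (p : {poly K}) (m : motive E) :
  motive_tau (p *: m) = ftw p *: motive_tau m.
Proof.
elim/poly_ind: p m => [|p c IHp] m.
  by rewrite rmorph0 !scale0r; apply: (@scaler0 Kt 'rV[Kt]_d tau).
rewrite rmorphD rmorphM /= map_polyX map_polyC /= !scalerDl motive_tauD -!scalerA IHp.
congr (_ *: _ + _).
  by rewrite !motive_scaleX /motive_tau scalemxAl.
rewrite [LHS](congr1 (fun m => tau *: (m : 'rV[Kt]_d)) (motive_scaleC c m)).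
rewrite [RHS]motive_scaleC /motive_tau !scalerA tau_const.
by rewrite /frob1 /Defs.frob expn1.
Qed.

Lemma motive_tau_sum I (s : seq I) (F : I -> motive E) :
  motive_tau (\sum_(i <- s) F i) = \sum_(i <- s) motive_tau (F i).
Proof.
apply: (big_morph _ motive_tauD).
exact: (@scaler0 Kt 'rV[Kt]_d tau).
Qed.

End Tau.

Section Basis.

Variables (d r : nat) (E : tmodule iota d) (b : 'I_r -> motive E).
Variables (A : 'M[{poly K}]_r) (S : 'M[{poly K}]_(d, r)).

(** The action of tau in coordinates: coefficients in K are raised to the q-th power, t is fixed,
    and [A] is the matrix of tau on the basis. *)
Definition semilin (v : 'rV[{poly K}]_r) : 'rV[{poly K}]_r := map_mx ftw v *m A.

Let sc (a : K) (v : 'rV[{poly K}]_r) := a%:P *: v.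
Let scDr a : {morph sc a : x y / x + y}. Proof. exact: scalerDr. Qed.
Let scDl x : {morph sc^~ x : a b / a + b}.
Proof. by move=> a a'; rewrite /sc polyCD scalerDl. Qed.
Let scA a a' x : sc a (sc a' x) = sc (a * a') x.
Proof. by rewrite /sc scalerA polyCM. Qed.
Let sc1 x : sc 1 x = x. Proof. exact: scale1r. Qed.

Lemma semilinD : {morph semilin : x y / x + y}.
Proof. by move=> x y; rewrite /semilin map_mxD mulmxDl. Qed.

Lemma semilinZ p x : semilin (p *: x) = ftw p *: semilin x.
Proof. by rewrite /semilin map_mxZ -scalemxAl. Qed.

Let TZ a x : semilin (sc a x) = sc (frob 1 a) (semilin x).
Proof. by rewrite /sc semilinZ map_polyC. Qed.

Definition motive_act : Kt -> 'rV[{poly K}]_r -> 'rV[{poly K}]_r := twact sc semilin.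

Lemma motive_actE n (f : Kt) v : (size (f : {poly K}) <= n)%N ->
  motive_act f v = \sum_(k < n) (tcoef f k)%:P *: iter k semilin v.
Proof. exact: twactE. Qed.

Lemma motive_act_mono a k v :
  motive_act (tconst a * tau ^+ k) v = a%:P *: iter k semilin v.
Proof. exact: twact_mono. Qed.

Lemma motive_act_tconst a v : motive_act (tconst a) v = a%:P *: v.
Proof. exact: twact_tconst. Qed.

Lemma motive_act_tauX k v : motive_act (tau ^+ k) v = iter k semilin v.
Proof. exact: twact_tauX. Qed.

Lemma motive_act0 v : motive_act 0 v = 0.
Proof. by rewrite /motive_act /twact size_poly0 big_ord0. Qed.

Lemma motive_actD f g v : motive_act (f + g) v = motive_act f v + motive_act g v.
Proof. exact: twactDl. Qed.

(** The motive is free over K{tau} on the unit vectors, so a K{tau}-linear coordinate map is fixed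
    by the rows of [S]; the hypothesis [coordX] will make it linear over K[t]. *)
Definition motive_coord (m : motive E) : 'rV[{poly K}]_r :=
  \sum_i motive_act ((m : 'rV[Kt]_d) 0 i) (row i S).

Hypothesis tau_b : forall i, motive_tau (b i) = \sum_j A i j *: b j.
Hypothesis unit_b : forall i, (delta_mx 0 i : motive E) = \sum_k S i k *: b k.
Hypothesis coordX : forall i, motive_coord (row i (E 'X)) = 'X *: row i S.
Hypothesis coord_b : forall i, motive_coord (b i) = delta_mx 0 i.

Let motive_coordD : {morph motive_coord : x y / x + y}.
Proof.
move=> x y; rewrite /motive_coord -big_split; apply: eq_bigr => i _ /=.
by rewrite mxE /motive_act twactDl.
Qed.

Let motive_coordZt f (m : 'rV[Kt]_d) : motive_coord (f *: m) = motive_act f (motive_coord m).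
Proof.
rewrite /motive_coord /motive_act (twact_sumr scDr semilinD); apply: eq_bigr => i _.
by rewrite mxE (twactA scDr scDl scA semilinD TZ).
Qed.

Let iterX k v : iter k semilin ('X *: v) = 'X *: iter k semilin v.
Proof. by elim: k => //= k ->; rewrite semilinZ map_polyX. Qed.

Let actX f v : motive_act f ('X *: v) = 'X *: motive_act f v.
Proof.
rewrite /motive_act /twact scaler_sumr; apply: eq_bigr => k _.
by rewrite iterX /sc !scalerA mulrC.
Qed.

Let motive_coordX (m : motive E) : motive_coord ('X *: m) = 'X *: motive_coord m.
Proof.
rewrite motive_scaleX /motive_coord scaler_sumr.
transitivity (\sum_i \sum_j motive_act ((m : 'rV[Kt]_d) 0 j)
    (motive_act (E 'X j i) (row i S))).
  apply: eq_bigr => i _; rewrite mxE /motive_act (twact_sum _ scDl).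
  by apply: eq_bigr => j _; rewrite (twactA scDr scDl scA semilinD TZ).
rewrite exchange_big; apply: eq_bigr => j _ /=.
rewrite -actX -coordX /motive_coord /motive_act (twact_sumr scDr semilinD).
by apply: eq_bigr => i _; rewrite mxE.
Qed.

Let motive_coordZ (p : {poly K}) (m : motive E) :
  motive_coord (p *: m) = p *: motive_coord m.
Proof.
elim/poly_ind: p m => [|p c IHp] m.
  rewrite !scale0r; apply: (addrI (motive_coord 0)).
  by rewrite -motive_coordD !addr0.
rewrite !scalerDl motive_coordD -!scalerA IHp motive_coordX; congr (_ + _).
rewrite [c%:P *: m]motive_scaleC motive_coordZt.
exact: motive_act_tconst.
Qed.

Let comb (v : 'rV[{poly K}]_r) : motive E := \sum_i v 0 i *: b i.

Let combD v w : comb (v + w) = comb v + comb w.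
Proof.
rewrite /comb -big_split; apply: eq_bigr => i _ /=.
by rewrite mxE scalerDl.
Qed.

Let combZ p v : comb (p *: v) = p *: comb v.
Proof. by rewrite /comb scaler_sumr; apply: eq_bigr => i _; rewrite mxE scalerA. Qed.

Let comb_sum I (s : seq I) F : comb (\sum_(k <- s) F k) = \sum_(k <- s) comb (F k).
Proof.
apply: (big_morph comb combD); rewrite /comb big1 // => i _.
by rewrite mxE scale0r.
Qed.

Let comb_semilin v : comb (semilin v) = motive_tau (comb v).
Proof.
rewrite motive_tau_sum /comb /semilin.
under eq_bigr do rewrite mxE scaler_suml.
rewrite exchange_big; apply: eq_bigr => i _ /=.
rewrite motive_tauZ tau_b scaler_sumr; apply: eq_bigr => j _.
by rewrite !mxE scalerA.
Qed.

Let comb_act f v : comb (motive_act f v) = f *: (comb v : 'rV[Kt]_d).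
Proof.
rewrite /motive_act /twact comb_sum.
rewrite [in RHS](Ktau_expand (leqnn (size (f : {poly K})))) scaler_suml.
apply: eq_bigr => k _; rewrite /sc combZ [LHS]motive_scaleC -scalerA.
apply: (congr1 (fun w : 'rV[Kt]_d => tconst (tcoef f k) *: w)).
elim: (nat_of_ord k) => [|l IHl]; first by rewrite expr0 scale1r.
by rewrite iterS comb_semilin /motive_tau IHl scalerA exprS.
Qed.

(** Coordinates and linear combinations are inverse to each other: [coord_b] settles one composite,
    and [unit_b] the other by K{tau}-linearity. *)
Lemma motive_basis : exists c : {linear motive E -> 'rV[{poly K}]_r},
  (forall i, c (b i) = delta_mx 0 i) /\ (forall m, m = \sum_i c m 0 i *: b i).
Proof.
have c_linear : linear motive_coord.
  by move=> p x y; rewrite motive_coordD motive_coordZ.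
pose c : {linear motive E -> 'rV[{poly K}]_r} := HB.pack motive_coord
  (GRing.isLinear.Build _ _ _ _ motive_coord c_linear).
exists c; split=> [|m]; first exact: coord_b.
rewrite -/(comb (c m)) [c m]/(motive_coord m) comb_sum {1}[m]row_sum_delta.
apply: eq_bigr => i _; rewrite comb_act.
apply: (congr1 (fun w : 'rV[Kt]_d => (m : 'rV[Kt]_d) 0 i *: w)); rewrite unit_b.
by apply: eq_bigr => j _; rewrite mxE.
Qed.

End Basis.

End MotiveBasis.

(** * The exterior power of a Drinfeld module *)

Section DrinfeldExterior.

Variables (Fq : finFieldType) (K : fieldType).
Variable iota : {rmorphism {poly Fq} -> K}.
Local Notation Kt := (Ktau iota).
Local Notation theta := (theta iota).
Local Notation ftw := (map_poly (frob1 iota)).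

(** A variant of the Cartier-Taguchi matrix, chosen so that tau acts on [exterior_basis] through
    [adjugate_mx]. *)
Definition exterior_mx (r : nat) (E : tmodule iota 1) : 'M[Kt]_(r.-1) :=
  \matrix_(i, j)
    ((if i == j then tconst theta else 0)
     + (if i == j.+1 :> nat then tconst ((-1) ^+ r.-1 * dcoef E r) * tau else 0)
     + (if j.+1 == r.-1
        then - (tconst ((-1) ^+ r.-1 * dcoef E i.+1) * tau) else 0)
     + (if (i == 0 :> nat) && (j.+1 == r.-1)
        then tconst (dcoef E r) * tau ^+ 2 else 0)).

Fact exterior_lie r E : lie (exterior_mx r E) = theta%:M.
Proof.
have t0 a : tcoef (tconst a * tau : Kt) 0 = 0 by rewrite tcoef_Mtau.
have t2 a : tcoef (tconst a * tau ^+ 2 : Kt) 0 = 0.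
  by rewrite expr2 mulrA tcoef_Mtau.
apply/matrixP => i j; rewrite !mxE !tcoef_add.
rewrite !(fun_if (fun f : Kt => tcoef f 0)) tcoefN !t0 t2 tcoef_const tcoef0.
by rewrite oppr0 !if_same !addr0; case: eqP.
Qed.

Definition exterior_tmodule r E : tmodule iota r.-1 := tmodule_of (exterior_lie r E).

Section MotiveEntries.

Variables (d : nat) (F : tmodule iota d).

Definition mentry (j : 'I_d) (m : motive F) : Kt := (m : 'rV[Kt]_d) 0 j.

Lemma mentry_inj (x y : motive F) : (forall j, mentry j x = mentry j y) -> x = y.
Proof. by move=> xy; exact: ((@rowP Kt d (x : 'rV[Kt]_d) y).1 xy). Qed.

Lemma mentryD j x y : mentry j (x + y) = mentry j x + mentry j y.
Proof. exact: (@mxE Kt 1 d). Qed.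

Lemma mentryN j x : mentry j (- x) = - mentry j x.
Proof. exact: (@mxE Kt 1 d). Qed.

Lemma mentry_sum j (I : Type) (s : seq I) (G : I -> motive F) :
  mentry j (\sum_(k <- s) G k) = \sum_(k <- s) mentry j (G k).
Proof. by apply: (big_morph _ (mentryD j)); apply: (@mxE Kt 1 d). Qed.

Lemma mentryZ j c x : mentry j (c%:P *: x) = tconst c * mentry j x.
Proof. by rewrite [c%:P *: x]motive_scaleC /mentry mxE. Qed.

Lemma mentryX j x : mentry j ('X *: x) = \sum_k mentry k x * F 'X k j.
Proof. by rewrite motive_scaleX /mentry mxE. Qed.

Lemma mentry_tau j x : mentry j (motive_tau x) = tau * mentry j x.
Proof. by rewrite /mentry mxE. Qed.

End MotiveEntries.

Section Rank.

Variables (n : nat) (E : tmodule iota 1).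
Local Notation r := n.+2.
Hypothesis rkE : drinfeld_of_rank r E.
Local Notation a_r := (dcoef E r).
Local Notation eps := ((-1) ^+ n.+1).
Local Notation W := (exterior_tmodule r E).

Let ar0 : a_r != 0. Proof. exact: dcoef_lead rkE. Qed.

Let epsM (R : pzRingType) : eps * eps = 1 :> R.
Proof. by rewrite -expr2 exprAC sqrrN !expr1n. Qed.

(** The index is any natural number, so that [unit_row r] is 0 and the last shift needs no separate
    formula. *)
Definition unit_row (k : nat) : 'rV[{poly K}]_r := \row_j (j == k :> nat)%:R.

Lemma semilin_unit_row (A : 'M[{poly K}]_r) (i : 'I_r) :
  semilin iota A (unit_row i) = row i A.
Proof.
rewrite /semilin rowE; congr (_ *m _); apply/rowP => j.
by rewrite !mxE eqxx /=; case: (j == i :> nat) / eqP => ij; rewrite ?rmorph1 ?rmorph0 -val_eqE /=; case: eqP.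
Qed.

(** The matrix of tau on 1, tau, ..., tau^(r-1); its last row is the relation t = theta + a_1 tau +
    ... + a_r tau^r solved for tau^r. *)
Definition companion_mx : 'M[{poly K}]_r := \matrix_(i, j)
  (if i == n.+1 :> nat then
     (if j == 0%N :> nat then (a_r^-1)%:P * ('X - theta%:P)
      else - (dcoef E j / a_r)%:P)
   else (j == i.+1 :> nat)%:R).

Definition tau_power (i : 'I_r) : motive E := \row_(j < 1) tau ^+ i.

Lemma iter_companion k : (k < r)%N -> iter k (semilin iota companion_mx) (unit_row 0) = unit_row k.
Proof.
elim: k => // k IHk lt_kr; rewrite iterS IHk ?(ltnW lt_kr) //.
rewrite (semilin_unit_row _ (Ordinal (ltnW lt_kr))); apply/rowP => j.
by rewrite !mxE /= ltn_eqF.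
Qed.

Lemma tau_tau_power i :
  motive_tau (tau_power i) = \sum_j companion_mx i j *: tau_power j.
Proof.
case: (eqVneq (i : nat) n.+1) => [i_last|ni_last]; last first.
    have lt_ir : (i.+1 < r)%N by rewrite ltnS ltn_neqAle ni_last -ltnS ltn_ord.
    rewrite (bigD1 (Ordinal lt_ir)) //= big1 => [|j nji].
      rewrite mxE (negPf ni_last) eqxx scale1r addr0.
      by apply: mentry_inj => j; rewrite mentry_tau /mentry !mxE exprS.
    by rewrite mxE (negPf ni_last) [_ == _ :> nat](negPf nji) scale0r.
  have [_ sz] := rkE.
  have EX : E 'X 0 0 = tconst theta
      + \sum_(k < n.+1) tconst (dcoef E k.+1) * tau ^+ k.+1 + tconst a_r * tau ^+ r.
    rewrite [LHS](Ktau_expand (eq_leq sz)) big_ord_recr big_ord_recl /= expr0 mulr1.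
    by rewrite -(dcoef0 E).
  apply: mentry_inj => j; rewrite (ord1 j) mentry_tau mentry_sum big_ord_recl.
  rewrite mxE i_last eqxx /= -scalerA mentryZ scalerBl mentryD mentryN mentryZ mentryX.
  rewrite big_ord1 /mentry !mxE i_last -exprS expr0 mul1r mulr1 EX.
  rewrite addrAC [tconst theta + _]addrC addrK mulrDr mulr_sumr mulrA -rmorphM mulVf //.
  rewrite rmorph1 mul1r addrAC -big_split big1 ?add0r // => k _ /=.
  rewrite mxE i_last eqxx /= -polyCN [(_%:P *: _)]motive_scaleC !mxE rmorphN mulNr.
  by rewrite mulrA -rmorphM mulrC subrr.
Qed.

Lemma drinfeld_motive_coord : exists c : {linear motive E -> 'rV[{poly K}]_r},
  (forall i, c (tau_power i) = delta_mx 0 i) /\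
  (forall m, m = \sum_i c m 0 i *: tau_power i).
Proof.
pose S : 'M[{poly K}]_(1, r) := \matrix_(i, j) (j == 0%N :> nat)%:R.
have rowS i : row i S = unit_row 0 by apply/rowP => j; rewrite !mxE.
have coordE m : motive_coord companion_mx S m =
    motive_act companion_mx ((m : 'rV[Kt]_1) 0 0) (unit_row 0).
  by rewrite /motive_coord big_ord1 rowS.
apply: (@motive_basis _ _ _ _ _ E tau_power companion_mx S).
- exact: tau_tau_power.
- move=> i; rewrite (ord1 i) (bigD1 ord0) //= big1 => [|j nj0].
    rewrite mxE scale1r addr0; apply: mentry_inj => j.
    by rewrite /mentry !mxE (ord1 j).
  by rewrite mxE [_ == _ :> nat](negPf nj0) scale0r.
- move=> i; rewrite (ord1 i) coordE rowS mxE.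
  (* Applied to the first unit row, tau^r gives the last row of the companion matrix; in E_t its
     multiple by a_r cancels all lower terms and leaves t. *)
  have last_step : iter r (semilin iota companion_mx) (unit_row 0) = row ord_max companion_mx.
    by rewrite iterS iter_companion // -semilin_unit_row.
  have [_ sz] := rkE; rewrite (motive_actE _ _ (eq_leq sz)) big_ord_recr last_step.
  under eq_bigr => k _ do rewrite /= iter_companion ?ltn_ord //.
  apply/rowP => j; rewrite !mxE summxE eqxx (bigD1 j) //= big1 => [|k nkj]; last first.
    by rewrite !mxE eq_sym [_ == _ :> nat](negPf nkj) mulr0.
  rewrite !mxE eqxx mulr1 addr0.
  case: (eqVneq (j : nat) 0%N) => [j0|nj0].
    by rewrite mulrA -polyCM mulfV // mul1r mulr1 -[tcoef _ _]/(dcoef E j) j0 dcoef0 addrC subrK.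
  by rewrite mulrN -polyCM mulrCA mulfV // mulr1 mulr0 subrr.
- move=> i; rewrite coordE mxE motive_act_tauX iter_companion //.
  by apply/rowP => j; rewrite !mxE.
Qed.


(** The transpose of the adjugate of [companion_mx], written out: see [companion_adjugate] and
    [det_companion]. *)
Definition adjugate_mx : 'M[{poly K}]_r := \matrix_(i, j)
  ((if j == i.+1 :> nat then eps * (a_r^-1)%:P * ('X - theta%:P) else 0)
   + (if j == 0%N :> nat then (eps * (dcoef E i.+1 / a_r))%:P else 0)).

(** W has dimension r - 1, but its motive has rank r over K[t]. The vector that the unit vectors
    lack comes from the last row of [adjugate_mx]: tau times the last basis vector must be eps times
    the first. *)
Definition exterior_basis (i : 'I_r) : motive W :=
  if unlift ord0 i is Some b then delta_mx 0 b
  else \row_(j < r.-1) (if j.+1 == r.-1 then eps * tau else 0).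

Lemma exteriorX : W 'X = exterior_mx r E.
Proof. exact: tmodule_ofX. Qed.

Let ftw_eps : ftw eps = eps. Proof. exact: rmorph_sign. Qed.

Lemma semilin_adjugate (i : nat) : (i < r)%N -> semilin iota adjugate_mx (unit_row i) =
  (eps * (a_r^-1)%:P * ('X - theta%:P)) *: unit_row i.+1
  + (eps * (dcoef E i.+1 / a_r))%:P *: unit_row 0.
Proof.
move=> lt_ir; rewrite (semilin_unit_row _ (Ordinal lt_ir)); apply/rowP => j.
by rewrite !mxE /=; congr (_ + _); case: (_ == _); rewrite ?mulr1 ?mulr0.
Qed.

Lemma unit_row_ge : unit_row r = 0.
Proof. by apply/rowP => j; rewrite !mxE ltn_eqF. Qed.

Lemma semilin_adjugate_last : semilin iota adjugate_mx (unit_row n.+1) = eps *: unit_row 0.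
Proof.
rewrite semilin_adjugate // unit_row_ge scaler0 add0r mulfV // mulr1.
by rewrite rmorph_sign.
Qed.

Lemma tau_exterior_basis i :
  motive_tau (exterior_basis i) = \sum_j adjugate_mx i j *: exterior_basis j.
Proof.
have epsP (R : nzRingType) (f : {rmorphism K -> R}) : f eps = eps by apply: rmorph_sign.
apply: mentry_inj => k.
  have eb0 : mentry k (exterior_basis ord0) = if k.+1 == n.+1 then eps * tau else 0.
    by rewrite /exterior_basis unlift_none /mentry mxE.
  have ebS j : mentry k (exterior_basis (lift ord0 j)) = (k == j)%:R.
    by rewrite /exterior_basis liftK /mentry mxE.
  have epsT : eps = tconst eps :> Kt by rewrite rmorph_sign.
  have tau_eps : tau * eps = eps * tau :> Kt by rewrite commr_sign.
  rewrite mentry_tau big_ord_recl mentryD mxE add0r mentryZ eb0.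
  (* Besides column 0, row i of [adjugate_mx] has one entry, in column i + 1; for the last i there
     is none, whence [insub]. *)
  have sumE : mentry k (\sum_(j < n.+1) adjugate_mx i (lift ord0 j) *: exterior_basis (lift ord0 j))
    = if insub (i : nat) is Some i' then
        tconst (eps / a_r) * (exterior_mx r E i' k - tconst theta * (k == i')%:R) else 0.
    rewrite mentry_sum; case: insubP => [i' lt_i i'E|ge_i]; last first.
      apply: big1 => j _; rewrite mxE /= eqSS addr0 ltn_eqF; last first.
        by rewrite (leq_trans (ltn_ord j)) // leqNgt.
      by rewrite -polyC0 mentryZ rmorph0 mul0r.
    rewrite (bigD1 i') //= big1 => [|j nji]; last first.
      rewrite mxE /= eqSS addr0 -i'E [_ == _ :> nat](negPf nji).
      by rewrite -polyC0 mentryZ rmorph0 mul0r.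
    rewrite mxE /= i'E eqxx !addr0 -(epsP _ (@polyC K)) -polyCM -scalerA mentryZ.
    rewrite scalerBl mentryD mentryN mentryZ mentryX ebS; congr (_ * (_ - _)).
    rewrite (bigD1 i') //= big1 => [|l nl].
      by rewrite /exterior_basis liftK /mentry mxE !eqxx mul1r addr0 exteriorX.
    by rewrite /exterior_basis liftK /mentry mxE (negPf nl) andbF mul0r.
  rewrite {}sumE; case: insubP => [i' lt_i i'E|ge_i]; last first.
    have iE : i = lift ord0 (ord_max : 'I_n.+1).
      apply: val_inj; apply/eqP; rewrite eqn_leq -ltnS ltn_ord /=.
      by rewrite leqNgt.
    rewrite iE ebS addr0 /= mulfV // mulr1 -val_eqE /= eqSS.
    by case: (_ == _); rewrite ?mulr1 ?mulr0 // -epsT mulrA epsM mul1r.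
  have h1 : tconst (eps * (dcoef E i.+1 / a_r)) * (if k.+1 == n.+1 then eps * tau else 0)
      = if k.+1 == n.+1 then tconst (dcoef E i.+1 / a_r) * tau else 0 :> Kt.
    case: ifP => _; last exact: mulr0.
    by rewrite epsT mulrA -rmorphM /= mulrAC epsM mul1r.
  (* Multiplying row i' of W_t - theta by eps / a_r isolates the subdiagonal tau; the term in
     a_(i+1) / a_r cancels against [h1]. *)
  have h2 : tconst (eps / a_r) * (exterior_mx r E i' k - tconst theta * (k == i')%:R)
      = (if i' == k.+1 :> nat then tau else 0)
        - (if k.+1 == n.+1 then tconst (dcoef E i.+1 / a_r) * tau else 0)
        + (if (i' == 0%N :> nat) && (k.+1 == n.+1) then eps * tau ^+ 2 else 0) :> Kt.
    have -> : exterior_mx r E i' k - tconst theta * (k == i')%:R =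
        (if i' == k.+1 :> nat then tconst (eps * a_r) * tau else 0)
        + (if k.+1 == n.+1 then - (tconst (eps * dcoef E i.+1) * tau) else 0)
        + (if (i' == 0%N :> nat) && (k.+1 == n.+1) then tconst a_r * tau ^+ 2 else 0).
      have th : (if i' == k then tconst theta else 0) = tconst theta * (k == i')%:R :> Kt.
        by rewrite eq_sym; case: (_ == _); rewrite ?mulr1 ?mulr0.
      by rewrite mxE th addrC !addrA addNr add0r /= i'E.
    have cK (a : K) (f : Kt) : tconst (eps / a_r) * (tconst (eps * a) * f) = tconst (a / a_r) * f.
      by rewrite mulrA -rmorphM /= mulrACA epsM mul1r [_^-1 * _]mulrC.
    rewrite !mulrDr; congr (_ + _ + _).
    - by case: ifP => _; rewrite ?mulr0 // cK mulfV // rmorph1 mul1r.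
    - by case: ifP => _; rewrite ?mulr0 ?oppr0 // mulrN cK.
    - by case: ifP => _; rewrite ?mulr0 // mulrA -rmorphM /= divfK // -epsT.
  rewrite h1 h2 addrA addrCA subrr addr0; move: i'E.
  case: (unliftP ord0 i) => [i0|] -> /= i'E; rewrite i'E.
    rewrite ebS addr0 /bump /= add1n eqSS [nat_of_ord i0 == k]eq_sym.
    by rewrite val_eqE; case: (_ == _); rewrite ?mulr1 ?mulr0.
  rewrite eb0 add0r; case: ifP => _; last exact: mulr0.
  by rewrite expr2 !mulrA tau_eps.
Qed.

Lemma exterior_motive_coord : exists c : {linear motive W -> 'rV[{poly K}]_r},
  (forall i, c (exterior_basis i) = delta_mx 0 i) /\
  (forall m, m = \sum_i c m 0 i *: exterior_basis i).
Proof.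
pose S : 'M[{poly K}]_(r.-1, r) := \matrix_(i, j) (j == i.+1 :> nat)%:R.
have rowS i : row i S = unit_row i.+1 by apply/rowP => j; rewrite !mxE.
pose act : Kt -> 'rV[{poly K}]_r -> 'rV[{poly K}]_r := motive_act adjugate_mx.
have actD f g v : act (f + g) v = act f v + act g v by apply: motive_actD.
have act0 v : act 0 v = 0 by apply: motive_act0.
have actN f v : act (- f) v = - act f v.
  by apply: (addrI (act f v)); rewrite -actD !subrr act0.
have act_mono a k v : act (tconst a * tau ^+ k) v = a%:P *: iter k (semilin iota adjugate_mx) v.
  exact: motive_act_mono.
have actc a v : act (tconst a) v = a%:P *: v by apply: motive_act_tconst.
have act_ctau a v : act (tconst a * tau) v = a%:P *: semilin iota adjugate_mx v.
  by have := act_mono a 1%N v; rewrite expr1.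
have epsP (R : nzRingType) (f : {rmorphism K -> R}) : f eps = eps by apply: rmorph_sign.
have row_lift (b : 'I_(r.-1)) : delta_mx 0 (lift ord0 b) = unit_row b.+1.
  by apply/rowP => j; rewrite !mxE.
apply: (@motive_basis _ _ _ _ _ W exterior_basis adjugate_mx S).
- exact: tau_exterior_basis.
- move=> i; rewrite (bigD1 (lift ord0 i)) //= big1 => [|j nji].
    by rewrite mxE eqxx scale1r addr0 /exterior_basis liftK.
  by rewrite mxE [_ == _ :> nat](negPf nji) scale0r.
- move=> i; rewrite /motive_coord rowS exteriorX.
  transitivity (\sum_j act (exterior_mx r E i j) (unit_row j.+1)).
    by apply: eq_bigr => j _; rewrite mxE rowS.
  under eq_bigr => j _ do rewrite mxE !actD.
  rewrite !big_split /=.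
  have -> : \sum_(j < n.+1) act (if i == j then tconst theta else 0) (unit_row j.+1)
      = theta%:P *: unit_row i.+1.
    rewrite (bigD1 i) //= eqxx big1 ?addr0 ?actc // => j /negPf nji.
    by rewrite eq_sym nji act0.
  have -> : \sum_(j < n.+1) act (if j.+1 == n.+1 then
        - (tconst (eps * dcoef E i.+1) * tau) else 0) (unit_row j.+1)
      = - ((eps * dcoef E i.+1)%:P *: (eps *: unit_row 0)).
    rewrite big_ord_recr /= eqxx big1 => [|j _]; last by rewrite eqSS ltn_eqF.
    by rewrite add0r actN act_ctau semilin_adjugate_last.
  set S1 := \sum_(j < n.+1) act _ _; set S2 := \sum_(j < n.+1) act _ _.
  (* Both kinds of terms are eps a_r tau applied to basis vector i: the subdiagonal tau for i > 0,
     and for i = 0 the tau^2, since basis vector 0 is itself eps tau times the last unit vector. *)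
  have S12 : S1 + S2 = (eps * a_r)%:P *: semilin iota adjugate_mx (unit_row i).
    rewrite /S1 /S2; case: (unliftP ord0 i) => [i'|] -> /=; last first.
      rewrite big1 ?add0r => [|j _]; last exact: act0.
      rewrite big_ord_recr /= eqxx big1 => [|j _]; last first.
        by rewrite eqSS (ltn_eqF (ltn_ord j)); apply: act0.
      rewrite add0r act_mono /= semilin_adjugate_last semilinZ ftw_eps scalerA.
      by rewrite -(epsP _ (@polyC K)) -polyCM mulrC.
    rewrite addrC big1 ?add0r => [|j _]; last exact: act0.
    rewrite (bigD1 (widen_ord (leqnSn n) i')) //= eqxx big1 => [|j nji]; last first.
      rewrite eqSS [_ == _ :> nat]eq_sym.
      by rewrite [_ == _ :> nat](negPf nji) act0.
    by rewrite addr0 act_ctau.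
  have epsK (p : {poly K}) : eps * (eps * p) = p by rewrite mulrA epsM mul1r.
  have epsC a : (eps * a)%:P = eps * a%:P :> {poly K}.
    by rewrite polyCM rmorph_sign.
  rewrite addrAC -[_ + S1 + S2]addrA S12 (semilin_adjugate (leqW (ltn_ord i))).
  have h1 : (eps * a_r)%:P * (eps * (a_r^-1)%:P * ('X - theta%:P)) = 'X - theta%:P :> {poly K}.
    by rewrite epsC -!mulrA [a_r%:P * (eps * _)]mulrCA epsK mulrA -polyCM mulfV // mul1r.
  have h2 : (eps * a_r)%:P * (eps * (dcoef E i.+1 / a_r))%:P = (dcoef E i.+1)%:P.
    by rewrite -polyCM mulrACA epsM mul1r mulrC divfK.
  have h3 : (eps * dcoef E i.+1)%:P * eps = (dcoef E i.+1)%:P.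
    by rewrite epsC mulrAC epsM mul1r.
  by rewrite scalerDr !scalerA h1 h2 h3 addrA addrK scalerBl addrC subrK.
- move=> i; rewrite /motive_coord; under eq_bigr do rewrite rowS.
  rewrite /exterior_basis; case: unliftP => [b|] ->.
    rewrite (bigD1 b) //= big1 => [|j /negPf njb].
      rewrite mxE !eqxx addr0 row_lift; have := actc 1 (unit_row b.+1).
      by rewrite rmorph1 scale1r.
    by rewrite mxE njb andbF mulr0n; apply: act0.
  rewrite big_ord_recr /= mxE eqxx big1 => [|j _]; last first.
    by rewrite mxE /= eqSS (ltn_eqF (ltn_ord j)); apply: act0.
  rewrite add0r -(epsP _ (@tconst _ _ iota)); apply: etrans (act_ctau _ _) _.
  rewrite semilin_adjugate_last epsP scalerA epsM scale1r.
  by apply/rowP => j; rewrite !mxE.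
Qed.

Lemma companion_adjugate :
  companion_mx *m adjugate_mx^T = (eps * (a_r^-1)%:P * ('X - theta%:P))%:M.
Proof.
apply/matrixP => i j; rewrite [RHS]mxE; set c := eps * _ * _.
have adjE k : adjugate_mx^T k j = (if k == j.+1 :> nat then c else 0)
    + (if k == 0%N :> nat then (eps * (dcoef E j.+1 / a_r))%:P else 0) by rewrite !mxE.
rewrite mxE; case: (eqVneq (i : nat) n.+1) => [i_last|ni_last]; last first.
  have lt_ir : (i.+1 < r)%N by rewrite ltnS ltn_neqAle ni_last -ltnS ltn_ord.
  rewrite (bigD1 (Ordinal lt_ir)) //= big1 => [|k nki].
    rewrite adjE mxE (negPf ni_last) eqxx mul1r !addr0 /= eqSS val_eqE.
    by case: (i == j).
  by rewrite mxE (negPf ni_last) [_ == _ :> nat](negPf nki) mul0r.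
rewrite big_ord_recl adjE mxE i_last eqxx add0r.
under eq_bigr => k _ do rewrite adjE mxE i_last eqxx /= addr0 eqSS.
have c0 : (a_r^-1)%:P * ('X - theta%:P) * (eps * (dcoef E j.+1 / a_r))%:P =
    (dcoef E j.+1 / a_r)%:P * c.
  by rewrite polyCM rmorph_sign /c mulrCA [RHS]mulrC !mulrA.
rewrite {}c0; case: (ltnP j n.+1) => [lt_j|le_j].
  rewrite (bigD1 (Ordinal lt_j)) //= eqxx big1 => [|k nkj]; last first.
    by rewrite [_ == _ :> nat](negPf nkj) mulr0.
  rewrite addr0 mulNr subrr -val_eqE /= i_last gtn_eqF //.
rewrite big1 ?addr0 => [|k _]; last by rewrite ltn_eqF ?mulr0 // (leq_trans (ltn_ord k)).
have jE : j = n.+1 :> nat by apply/eqP; rewrite eqn_leq le_j -ltnS ltn_ord.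
by rewrite jE mulfV // mul1r -val_eqE /= i_last jE eqxx.
Qed.

(** Column 0 has a single nonzero entry, in the last row, and removing both leaves the identity. *)
Lemma det_companion : \det companion_mx = eps * (a_r^-1)%:P * ('X - theta%:P).
Proof.
rewrite (expand_det_col _ ord0) big_ord_recr /= big1 ?add0r => [|i _]; last first.
  by rewrite mxE /= ltn_eqF ?mul0r.
rewrite mxE /= eqxx /cofactor /= addn0.
have -> : row' ord_max (col' ord0 companion_mx) = 1%:M.
  apply/matrixP => i j; rewrite !mxE lift_max ltn_eqF //= /bump add1n eqSS.
  by rewrite eq_sym.
by rewrite det1 mulr1 -mulrA mulrC.
Qed.

Lemma det_companion_neq0 : \det companion_mx != 0.
Proof.
rewrite det_companion -mulrA mulf_neq0 ?signr_eq0 // mulf_neq0 ?polyXsubC_eq0 //.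
by rewrite polyC_eq0 invr_eq0.
Qed.

(** Both sides agree after multiplication by the companion matrix, by [minor_mulmx]. That matrix is
    not invertible over K[t], so it is cancelled through its adjugate and its nonzero
    determinant. *)
Lemma minor_companion (B : 'M[{poly K}]_(n.+1, r)) j :
  minor (B *m companion_mx) j = \sum_i minor B i * adjugate_mx i j.
Proof.
pose x : 'cV_r := \col_j minor (B *m companion_mx) j.
pose y : 'cV_r := \col_j minor B j.
suff xy : companion_mx *m x = companion_mx *m (adjugate_mx^T *m y).
  have : \adj companion_mx *m (companion_mx *m x)
      = \adj companion_mx *m (companion_mx *m (adjugate_mx^T *m y)) by rewrite xy.
  rewrite !mulmxA mul_adj_mx -[_ *m y]mulmxA !mul_scalar_mx => /colP/(_ j).
  rewrite mxE [RHS]mxE => /(mulfI det_companion_neq0); rewrite !mxE => ->.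
  by apply: eq_bigr => i _; rewrite !mxE mulrC.
rewrite mulmxA companion_adjugate -det_companion mul_scalar_mx.
apply/colP => i; rewrite mxE [RHS]mxE [in RHS]mxE -minor_mulmx.
by apply: eq_bigr => k _; rewrite [x k 0]mxE.
Qed.

Theorem exterior_tmodule_power : tmodule_exterior_power n.+1 E W.
Proof.
have [cE [cEb cEK]] := drinfeld_motive_coord.
have [cW [cWb cWK]] := exterior_motive_coord.
exists (wedge exterior_basis cE); split.
  exact: (wedge_exterior_power cEb cEK cWb cWK).
move=> m; have coord_tau x : cE (motive_tau x) = map_mx ftw (cE x) *m companion_mx.
  rewrite [x in LHS]cEK motive_tau_sum linear_sum.
  under eq_bigr => i _ do rewrite motive_tauZ linearZ /= tau_tau_power linear_sum.
  apply/rowP => j; rewrite summxE [RHS]mxE; apply: eq_bigr => i _.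
  rewrite !mxE summxE (bigD1 j) //= big1 => [|k nkj].
    by rewrite linearZ /= cEb !mxE !eqxx mulr1 addr0.
  by rewrite linearZ /= cEb !mxE [j == k]eq_sym (negPf nkj) andbF mulr0.
have -> : wedge exterior_basis cE [ffun i => motive_tau (m i)] =
    \sum_j minor (map_mx ftw (coord_rows cE m) *m companion_mx) j *: exterior_basis j.
  apply: eq_bigr => j _; congr (minor _ _ *: _); apply/row_matrixP => k.
  by rewrite row_mul -map_row !rowK ffunE coord_tau.
rewrite motive_tau_sum.
under eq_bigr => i _ do rewrite motive_tauZ tau_exterior_basis scaler_sumr.
rewrite exchange_big; apply: eq_bigr => j _ /=.
rewrite minor_companion scaler_suml; apply: eq_bigr => i _.
by rewrite scalerA map_minor.
Qed.

End Rank.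

End DrinfeldExterior.

(** * The dual and the exterior power over an extension field *)

Section ExteriorIso.

Variables (Fq : finFieldType) (K L : fieldType).
Variables (iota : {rmorphism {poly Fq} -> K}) (i : {rmorphism K -> L}).
Local Notation iL := (iotaL iota i).
Local Notation Lt := (Ktau iL).

Lemma tmap_const a : tmap i (tconst a : Ktau iota) = tconst (i a).
Proof.
by apply: tcoefP => k; rewrite tcoef_map !tcoef_const; case: eqP; rewrite ?rmorph0.
Qed.

Lemma tmap_tau : tmap i (tau : Ktau iota) = tau.
Proof. by apply: tcoefP => k; rewrite tcoef_map /tcoef !coefX rmorph_nat. Qed.

Lemma base_changeE d (E : tmodule iota d) a : base_change i E a = map_mx (tmap i) (E a).
Proof. by []. Qed.

Variables (r : nat) (E : tmodule iota 1) (lambda : L).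
Hypotheses (le2r : (2 <= r)%N) (rkE : drinfeld_of_rank r E).
Hypothesis lambdaP : lambda ^+ #|Fq|.-1 = (-1) ^+ r.-1 * i (dcoef E r).
Local Notation alpha := (i (dcoef E r)).
Local Notation eps := ((-1) ^+ r.-1 : L).

(* The matrix of t on the exterior power is conjugate to that on the dual by
   the scalar 1/lambda, which satisfies mu = eps a_r mu^q. *)
Lemma ctdual_exterior_iso :
  tiso (base_change i (ctdual r E)) (base_change i (exterior_tmodule r E)).
Proof.
have alpha0 : alpha != 0 by rewrite fmorph_eq0 dcoef_lead.
have eps2 : eps * eps = 1 by rewrite -expr2 exprAC sqrrN !expr1n.
have q_gt0 : (0 < #|Fq|)%N by apply/card_gt0P; exists 0.
have q1_gt0 : (0 < #|Fq|.-1)%N by rewrite -ltnS prednK // finRing_gt1.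
(* As q - 1 > 0, a zero lambda would force a_r = 0. *)
have lambda0 : lambda != 0.
  apply: contraNneq alpha0 => l0; move: lambdaP; rewrite l0 expr0n gtn_eqF // => /esym/eqP.
  by rewrite mulf_eq0 signr_eq0.
pose mu := lambda^-1.
have muE : mu = eps * alpha * mu ^+ #|Fq|.
  rewrite -lambdaP /mu -{2}(prednK q_gt0) exprSr exprVn mulrA mulfV ?mul1r //.
  by rewrite expf_neq0.
have epsq : eps ^+ #|Fq| = eps.
  have : frob1 iL eps = eps by apply: rmorph_sign.
  by rewrite /frob1 /frob expn1.
(* In the tau^2 entry mu passes tau twice, so the relation for mu is needed once more after
   Frobenius. *)
have muq : mu ^+ #|Fq| = eps * alpha ^+ #|Fq| * (mu ^+ #|Fq|) ^+ #|Fq|.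
  by rewrite {1}muE !exprMn epsq.
have tauC (a : L) : tau * tconst a = tconst (a ^+ #|Fq|) * tau :> Lt by apply: tau_const.
have DX : base_change i (ctdual r E) 'X = map_mx (tmap i) (ctdual_mx r E).
  exact: etrans (base_changeE (ctdual r E) 'X) (congr1 (map_mx (tmap i)) (tmodule_ofX _)).
have GX : base_change i (exterior_tmodule r E) 'X = map_mx (tmap i) (exterior_mx r E).
  exact: etrans (base_changeE (exterior_tmodule r E) 'X)
    (congr1 (map_mx (tmap i)) (tmodule_ofX _)).
have conj : (tconst mu)%:M *m map_mx (tmap i) (ctdual_mx r E)
    = map_mx (tmap i) (exterior_mx r E) *m (tconst mu)%:M.
  rewrite mul_scalar_mx.
  apply/matrixP => a b; rewrite [LHS]mxE [RHS]mxE (bigD1 b) //= big1 => [|c nc]; last first.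
    by rewrite [_%:M _ _]mxE (negPf nc) mulr0.
  rewrite addr0 [_%:M _ _]mxE eqxx mulr1n ![map_mx _ _ _ _]mxE.
  rewrite ![ctdual_mx _ _ _ _]mxE ![exterior_mx _ _ _ _]mxE !rmorphD !mulrDr !mulrDl.
  congr (_ + _ + _ + _).
  - by case: ifP => _; rewrite ?rmorph0 ?mulr0 ?mul0r //= tmap_const -!rmorphM mulrC.
  - case: ifP => _; rewrite ?rmorph0 ?mulr0 ?mul0r // rmorphM /= tmap_tau tmap_const.
    rewrite -mulrA tauC mulrA -rmorphM; congr (tconst _ * _).
    by rewrite {1}muE rmorphM rmorph_sign.
  - case: ifP => _; rewrite ?rmorph0 ?mulr0 ?mul0r // !rmorphN !rmorphM /= tmap_tau !tmap_const.
    rewrite mulrN mulNr; congr (- _).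
    rewrite -[RHS]mulrA tauC !mulrA -!rmorphM; congr (tconst _ * _).
    rewrite rmorphM rmorph_sign fmorphV; apply: (mulIf alpha0); rewrite divfK // {1}muE.
    by rewrite mulrAC [RHS]mulrAC; congr (_ * _); apply: mulrAC.
  - case: ifP => _; rewrite ?rmorph0 ?mulr0 ?mul0r // !rmorphM /= tmap_tau !tmap_const.
    have tau2C a' : tau * tau * tconst a' = tconst ((a' ^+ #|Fq|) ^+ #|Fq|) * (tau * tau) :> Lt.
      by rewrite -mulrA tauC mulrA tauC mulrA.
    rewrite mulrA -[RHS]mulrA tau2C [RHS]mulrA -!rmorphM; congr (tconst _ * _).
    rewrite fmorphV rmorphXn /=; apply: (mulIf (expf_neq0 #|Fq| alpha0)).
    rewrite divfK ?expf_neq0 // [LHS]muE [X in _ * X = _]muq -(mulrA eps (alpha ^+ _)).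
    by rewrite mulrACA eps2 mul1r mulrA [RHS]mulrAC.
exists (tconst mu)%:M, (tconst lambda)%:M; split.
- apply: tmorphismX; exact: etrans (congr1 (mulmx (tconst mu)%:M) DX)
    (etrans conj (congr1 (mulmx^~ (tconst mu)%:M) (esym GX))).
- by rewrite -scalar_mxM -rmorphM mulVf ?rmorph1.
- by rewrite -scalar_mxM -rmorphM mulfV ?rmorph1.
Qed.

End ExteriorIso.

Theorem theorem1p1 (Fq : finFieldType) (K : fieldType)
    (iota : {rmorphism {poly Fq} -> K}) (perfK : perfect_field K) :
  exists (X Y : forall r : nat, tmodule iota 1 -> tmodule iota r)
         (phi : forall r : nat, tmodule iota 1 -> 'cV[K]_r -> bifun iota 1 1)
         (phi0 : forall r : nat, tmodule iota 1 -> 'cV[K]_(r.-1) -> bifun iota 1 1)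
         (psi : forall r : nat, tmodule iota 1 -> 'cV[K]_r -> bifun iota r.-1 1),
    (* (a) *)
    (forall (r : nat) (E : tmodule iota 1), (2 <= r)%N -> drinfeld_of_rank r E ->
      let C := carlitz iota in
      let Edual := ctdual r E in
      [/\ represents E C (Ext1 E C) (X r E) (phi r E),
          represents E C (Ext10 E C) Edual (phi0 r E),
          exists u v, short_exact Edual (X r E) (Ga iota 1) u v /\
            forall x, ext_eq E C (phi r E (kpt u x)) (phi0 r E x),
          forall (s : nat) (F : tmodule iota 1) (beta : 'M[Ktau iota]_1),
            (2 <= s)%N -> drinfeld_of_rank s F -> tmorphism E F beta ->
            pullback_tmorphism E C beta (X s F) (phi s F) (X r E) (phi r E)
        & exists (n : nat) (W : tmodule iota n),
            tmodule_exterior_power r.-1 E W /\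
            forall (L : fieldType) (i : {rmorphism K -> L}) (lambda : L),
              lambda ^+ #|Fq|.-1 = (-1) ^+ r.-1 * i (dcoef E r) ->
              tiso (base_change i Edual) (base_change i W)])
    /\
    (* (b): the second clause identifies the sub-t-module E of Y r E with
       Ext^1_0(Edual, C), which is the dual of Edual *)
    (forall (r : nat) (E : tmodule iota 1), (2 <= r)%N -> drinfeld_of_rank r E ->
      let C := carlitz iota in
      let Edual := ctdual r E in
      [/\ represents Edual C (Ext1 Edual C) (Y r E) (psi r E),
          exists u v, short_exact E (Y r E) (Ga iota r.-1) u v /\
            represents Edual C (Ext10 Edual C) E (fun x => psi r E (kpt u x))
        & forall (s : nat) (F : tmodule iota 1) (gamma : 'M[Ktau iota]_(r.-1, s.-1)),
            (2 <= s)%N -> drinfeld_of_rank s F ->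
            tmorphism (ctdual s F) Edual gamma ->
            pullback_tmorphism (ctdual s F) C gamma
              (Y r E) (psi r E) (Y s F) (psi s F)])
    /\
    (* (c) *)
    (forall (r s : nat) (E F : tmodule iota 1) (beta : 'M[Ktau iota]_1),
      (2 <= r)%N -> drinfeld_of_rank r E ->
      (2 <= s)%N -> drinfeld_of_rank s F -> tmorphism E F beta ->
      pullback_tmorphism E (carlitz iota) beta
        (ctdual s F) (phi0 s F) (ctdual r E) (phi0 r E)).
Proof.
exists (@ext_tmodule _ _ iota), (@bidual_tmodule _ _ iota),
  (fun r E => nfclass E r (@unitrows K r)),
  (* The identification of Ext^1_0 is that of Ext^1 restricted along the tail inclusion, so the
     compatibility required in (a) holds by reflexivity. *)
  (fun r E x => nfclass E r (@unitrows K r) (kpt (tail_incl iota r) x)),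
  (fun r E => nfclass (ctdual r E) 2 (bidual_nf r E)).
split; [|split] => [r E le2r rkE|r E le2r rkE|r s E F beta].
- split=> [||||].
  + exact: (represents_Ext1 (drinfeld_presents le2r rkE)).
  + by case: r le2r rkE => [|[|n]] // _ rkE; apply: ctdual_represents.
  + case: r le2r rkE => [|[|n]] // _ rkE.
    exists (tail_incl iota n.+2), (head_incl iota n.+2)^T; split; first exact: ext_exact.
    move=> x; apply/(nfclass_eqP _ _ _ (nfclass_biderivation _ _ _ _)).
    by rewrite /nfclass biderX; apply: rcong_refl.
  + by move=> s F beta le2s rkF betaE; apply: ext_pullback.
  exists r.-1, (exterior_tmodule r E); split.
    by case: r le2r rkE => [|[|n]] // _ rkE; apply: exterior_tmodule_power.
  by move=> L i lambda lambdaE; apply: ctdual_exterior_iso lambdaE.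
- split=> [||s F gamma le2s rkF gammaE].
  + exact: (represents_Ext1 (dual_presents le2r rkE)).
  + case: r le2r rkE => [|[|n]] // _ rkE.
    exists (head_incl iota n.+2), (tail_incl iota n.+2)^T; split.
      exact: bidual_exact.
    exact: bidual_represents.
  + exact: bidual_pullback.
by move=> le2r rkE le2s rkF betaE; apply: ctdual_pullback.
Qed.
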